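(* Fix $0\le u\le\pi/4$ and $\theta\in(0,\pi/4]$. Let $\Psi$ be the (real, centred, continuous) stationary Gaussian field on $\mathbb{R}^2$ with spectral measure $\sigma_\theta$, and let $\mathcal{Z}$ be the number of zeroes of $\Psi$ on the segment $\{t(\cos u,\sin u):0\le t\le L\}$. Then, as $L\to\infty$, $$\log\mathbb{P}(\mathcal{Z}=0)\asymp -L\qquad\text{if } u\le\theta,$$ and $$\log\mathbb{P}(\mathcal{Z}=0)\asymp -L^2\qquad\text{if }\theta<u .$$
   Context: $\sigma_\theta$ denotes the probability measure on the unit circle $\mathbb{S}^1\subset\mathbb{C}\cong\mathbb{R}^2$ that is uniform (normalised arc length) on the union of the four arcs $\{z\in\mathbb{S}^1:\arg z\in\bigcup_{j=0}^{3}[j\pi/2-\theta,\,j\pi/2+\theta]\}$. The field with spectral measure $\sigma_\theta$ has covariance $\mathbb{E}[\Psi(x)\Psi(y)]=\int_{\mathbb{S}^1}e^{2\pi i\langle x-y,z\rangle}\,d\sigma_\theta(z)$. The notation $A(L)\asymp -B(L)$ as $L\to\infty$, with $B>0$, means that there are constants $c_1,c_2>0$ (which may depend on $u$ and $\theta$, not on $L$) with $-c_1B(L)\le A(L)\le -c_2B(L)$ for all sufficiently large $L$. *)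

(* Defs.v *)
From HB Require Import structures.
From mathcomp Require Import all_boot all_order all_algebra.
From mathcomp Require Import complex.
From mathcomp Require Import all_classical all_reals all_analysis.

Set Implicit Arguments.
Unset Strict Implicit.
Unset Printing Implicit Defensive.

Import Order.TTheory GRing.Theory Num.Theory.
Import numFieldNormedType.Exports.

Local Open Scope classical_set_scope.
Local Open Scope ring_scope.

Section plane.
Context {R : realType}.
Implicit Types (p q : R * R) (t : R).

Definition dotp p q : R := p.1 * q.1 + p.2 * q.2.

Definition cis : measurableTypeR R -> R * R := fun t => (cos (t : R), sin (t : R)).

Lemma measurable_cis : measurable_fun [set: measurableTypeR R] cis.
Proof.
by apply/measurable_fun_pairP; split; apply: measurable_realfun.continuous_measurable_fun;
  [exact: continuous_cos | exact: continuous_sin].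
Qed.

Definition segment (u L : R) : set (R * R) :=
  [set p | exists2 t, 0 <= t <= L & p = (t * cos u, t * sin u)].

End plane.

HB.instance Definition _ (R : realType) :=
  @isMeasurableFun.Build _ _ _ _ (@cis R) measurable_cis.

Section arcs.
Context {R : realType}.
Variable theta : R.

Definition arc_angles : set R :=
  \bigcup_(j in `I_4) `[j%:R * (pi / 2) - theta, j%:R * (pi / 2) + theta]%classic.

Lemma measurable_arc_angles : measurable arc_angles.
Proof. by apply: bigcup_measurable => j _; exact: measurable_itv. Qed.

Lemma arc_angles_length_gt0 :
  0 < theta -> (0 < lebesgue_measure arc_angles)%E.
Proof.
move=> t0; apply: (@lt_le_trans _ _ (lebesgue_measure `[- theta, theta]%classic)).
  by rewrite lebesgue_measure_itv /= lte_fin gtrN // -EFinD lte_fin subr_gt0 gtrN.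
apply: le_measure; rewrite ?inE; [exact: measurable_itv|exact: measurable_arc_angles|].
by move=> x xt; exists 0%N => //=; rewrite mul0r sub0r add0r.
Qed.

Lemma arc_angles_length_lty : (lebesgue_measure arc_angles < +oo)%E.
Proof.
apply: (@le_lt_trans _ _ (lebesgue_measure `[- theta, 3 * (pi / 2) + theta]%classic)).
  apply: le_measure; rewrite ?inE; [exact: measurable_arc_angles|exact: measurable_itv|].
  have pi2 : 0 <= pi / 2 :> R by rewrite divr_ge0 ?pi_ge0.
  move=> x [j /= j4]; rewrite !in_itv /= => /andP[ax xb]; apply/andP; split.
    by apply: le_trans ax; rewrite lerDr mulr_ge0.
  apply: (le_trans xb); rewrite lerD2r ler_wpM2r// ler_nat -ltnS//.
by rewrite lebesgue_measure_itv /=; case: ifPn => // _; rewrite -EFinD ltry.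
Qed.

(* When 0 < theta <= pi / 4, [arc_angles] has positive finite length, so the
   Dirac fallback of [mnormalize] is not used, and it lies in
   [- pi / 4, 7 * pi / 4], where [cis] is injective up to the endpoints:
   pushing its uniform law forward by [cis] gives normalised arc length on
   the four arcs. *)
Definition arc_angles_uniform : probability (measurableTypeR R) R :=
  mnormalize
    (mrestr lebesgue_measure measurable_arc_angles) \d_(0 : measurableTypeR R).

Definition sigma_arcs : probability (R * R)%type R :=
  distribution arc_angles_uniform cis.

End arcs.

Section fourier.
Context {R : realType}.

Definition expi (t : R) : R[i] := (cos t +i* sin t)%C.

Definition Cintegral d (T : measurableType d) (mu : {measure set T -> \bar R})
    (f : T -> R[i]) : R[i] :=
  (Rintegral mu setT (fun z => complex.Re (f z)) +i*
   Rintegral mu setT (fun z => complex.Im (f z)))%C.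

Definition fourier (mu : {measure set (R * R) -> \bar R}) (v : R * R) : R[i] :=
  Cintegral mu (fun z => expi (2 * pi * dotp v z)).

End fourier.

Section gaussian_field.
Context d (T : measurableType d) (R : realType) (P : probability T R).

(* Constants count as Gaussian. [normal_prob m 0] is not the Dirac mass at m,
   hence the case distinction. *)
Definition gaussian_rv (X : T -> R) : Prop :=
  exists m s : R, forall B, measurable B ->
    P (X @^-1` B) = if s == 0 then \d_m B else normal_prob m s B.

Definition gaussian_process (I : Type) (Psi : I -> {RV P >-> R}) : Prop :=
  forall (n : nat) (x : 'I_n -> I) (a : 'I_n -> R),
    gaussian_rv (fun w => \sum_(i < n) a i * Psi (x i) w).

(* Stationarity follows from [field_cov] since the covariance depends on x - y
   only. The expectation in [field_cov] is finite for a Gaussian process. *)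
Record gaussian_field_with_spectral_measure
    (mu : {measure set (R * R) -> \bar R}) (Psi : R * R -> {RV P >-> R}) : Prop := {
  field_gaussian : gaussian_process Psi;
  field_centred : forall x, ('E_P[Psi x] = 0)%E;
  field_continuous : forall w, continuous (fun x => Psi x w);
  field_cov : forall x y, (fine 'E_P[(Psi x \* Psi y)%R]%E)%:C%C = fourier mu (x - y)
}.

(* +oo if there are infinitely many zeroes *)
Definition nb_zeroes (Psi : R * R -> {RV P >-> R}) (S : set (R * R)) (w : T) : \bar R :=
  counting (S `&` [set x | Psi x w = 0]).

End gaussian_field.

Definition asymp_opp (R : realType) (A : R -> \bar R) (B : R -> R) : Prop :=
  exists c1 c2 : R, [/\ 0 < c1, 0 < c2 &
    \forall L \near +oo, ((- (c1 * B L))%:E <= A L <= (- (c2 * B L))%:E)%E].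

(* Main.v *)
Require Import Defs.
From HB Require Import structures.
From mathcomp Require Import all_boot all_order all_algebra.
From mathcomp Require Import complex ring lra zify.
From mathcomp Require Import all_classical all_reals all_analysis measurable_realfun.

(** Along the segment the field is a stationary Gaussian process [f], and the
    variance of [\sum_i a i * f (t i)] is the mean of the symbol
    [Q l = `|\sum_i a i * expi (2 * pi * t i * l)| ^+ 2] at [l = cos (x - u)], for [x]
    uniform on the angles of the arcs. This measure on frequencies dominates
    Lebesgue measure on the interval from [sin (u - theta)] to
    [sin (u + theta)]. The dichotomy is whether frequency 0 is available: if
    [u <= theta] it belongs to that interval, while if [theta < u] the measure
    vanishes near 0. In the first case a constant sign has a cost for each unit
    of length; in the second every slowly varying average of [f] is
    exponentially small, so a constant sign forces [f] itself to be
    exponentially small in [L] at order of [L] places.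

    Upper bounds ([persistence_upper_linear], [persistence_upper_quadratic]).
    If [f] keeps its sign on the grid of step [1 / 2], either a nonnegative
    combination [S] of its values is large, or many well spaced values are
    nonnegative with a small sum. The first event is a Gaussian tail: the
    variance of a plain sum is linear in [L] ([ray_sum_var]), and beyond the gap
    binomial averages have exponentially small variance ([ray_binomial_var]).
    For the second, spaced samples have a covariance bounded below by a
    multiple of the identity ([ray_spaced_lb]), and a Chernoff bound with
    products of Fejer kernels shows that this alone gives small ball
    probabilities of the independent type ([small_ball_sum]).

    Lower bounds ([persistence_lower_linear], [persistence_lower_quadratic]).
    By convex duality ([nonneg_duality]), an inequality
    [(\sum_i m i * K i) ^+ 2 <= V * Var (\sum_i m i * f i)] for all nonnegative [m]
    provides a Gaussian variable of variance at most [V] whose covariance with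
    each [f i] is at least [K i]; the Cameron-Martin shift along it turns
    [1 - K i <= f i] into [1 <= f i] at the price [expR (- O(V))]
    ([lower_by_shift]). If [u <= theta] the inequality holds with [V] of order [L]
    for profiles [K] with [\sum K ^+ 2] of order [L] ([ray_local_lb]), and chaining
    together with a pigeonhole over profiles supplies the event to be shifted.
    If [theta < u] the mass of [m] is recovered from the frequencies in the
    interval only up to an exponential factor ([ray_turan_lb]), so [f] must first be made
    exponentially small. That has probability [expR (- O(L ^+ 2))], because [f] is
    predictable from order of [L] of its values ([ray_taylor],
    [ray_small_ball]).

    All estimates on grids are uniform in the mesh. Path continuity and the
    intermediate value theorem identify the absence of zeroes with a constant
    sign on the segment, a monotone limit of grid events
    ([grid_event_le_no_zeroes], [no_zeroes_le_half_grid]). *)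

Set Implicit Arguments.
Unset Strict Implicit.
Unset Printing Implicit Defensive.
Import Order.TTheory GRing.Theory Num.Theory.
Import numFieldNormedType.Exports.
Local Open Scope classical_set_scope.
Local Open Scope ring_scope.

(** * Integrals against a centred normal density *)

Section normal.
Context {R : realType}.
Implicit Types (s x t : R).
Notation mu := (@lebesgue_measure R).

Lemma ge0_integral_normal_prob (m s : R) (f : R -> \bar R) :
  (forall x, 0 <= f x)%E -> measurable_fun setT f ->
  (\int[normal_prob m s]_x f x = \int[mu]_x (f x * (normal_pdf m s x)%:E))%E.
Proof.
move=> f0 mf.
have dom := normal_prob_dominates m s.
rewrite -(Radon_Nikodym_SigmaFinite.change_of_variables dom f0 measurableT mf).
have intg := Radon_Nikodym_SigmaFinite.f_integrable dom.
apply: ae_eq_integral => //.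
- by apply: emeasurable_funM => //; exact: (measurable_int mu).
- apply: emeasurable_funM => //=; apply/measurableT_comp => //=.
  exact: measurable_normal_pdf.
- apply: ae_eqe_mul2l => /=.
  apply: integral_ae_eq => //=.
  + by apply/measurableT_comp =>//; exact: measurable_normal_pdf.
  + by move=> E _ mE; rewrite -(Radon_Nikodym_SigmaFinite.f_integral dom).
Qed.

Lemma normal_pdf0E s x : s != 0 ->
  normal_pdf 0 s x = normal_peak s * expR (- (x ^+ 2 / (s ^+ 2 * 2))).
Proof.
by move=> s0; rewrite normal_pdfE// /normal_fun subr0 -(mulr_natr (s ^+ 2)) mulNr.
Qed.

Section fixed.
Variable s : R.
Hypothesis s0 : s != 0.
Notation psi := (normal_pdf 0 s).

Let s2gt0 : 0 < s ^+ 2. Proof. by rewrite exprn_even_gt0. Qed.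

Lemma is_derive_normal_pdf x : is_derive x 1 psi (- (x / s ^+ 2) * psi x).
Proof.
have -> : psi = (cst (normal_peak s) *
    (expR \o (cst (- (s ^+ 2 * 2)^-1) * (@id R) ^+ 2)))%R.
  apply/funext => y; rewrite normal_pdf0E// /=; congr (_ * expR _).
  by rewrite /= fctE /= fctE mulNr mulrC.
have h1 := @is_derive_cst R R R (- (s ^+ 2 * 2)^-1) x 1.
have h2 := is_deriveX 2 (@is_derive_id R R x 1).
have h3 := is_deriveM h1 h2.
have h4 := is_derive1_comp (@is_derive_expR R _) h3.
have h5 := is_deriveM (@is_derive_cst R R R (normal_peak s) x 1) h4.
apply: is_derive_eq h5 _.
rewrite /= !fctE /= !scaler0 !addr0 /GRing.scale /= !mulr1.
by field.
Qed.

(** Since [y * expR (- y) <= 1], half of the exponent absorbs the factor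
    [x ^+ 2] and leaves a normal density of twice the variance. *)
Lemma integrable_sqr_normal_pdf :
  mu.-integrable setT (EFin \o (fun x => x ^+ 2 * psi x)).
Proof.
have t0 : Num.sqrt 2 * s != 0 :> R by rewrite mulf_neq0// sqrtr_eq0 -ltNge.
pose C := 4 * s ^+ 2 * normal_peak s / normal_peak (Num.sqrt 2 * s).
have pk := normal_peak_gt0 t0.
have C0 : 0 <= C.
  by rewrite divr_ge0 ?normal_peak_ge0// mulr_ge0 ?normal_peak_ge0// mulr_ge0 ?sqr_ge0.
apply: (@le_integrable _ _ _ mu _ measurableT _
    (fun x => (C * normal_pdf 0 (Num.sqrt 2 * s) x)%:E)).
- apply/measurable_EFinP; apply: measurable_funM => //.
  exact: measurable_normal_pdf.
- move=> x _; rewrite lee_fin !ger0_norm; last 2 first.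
  + by rewrite mulr_ge0 ?normal_pdf_ge0.
  + by rewrite mulr_ge0 ?sqr_ge0 ?normal_pdf_ge0.
  rewrite !normal_pdf0E// exprMn sqr_sqrtr// /C.
  rewrite [leRHS]mulrA divfK ?gt_eqF//.
  set y := x ^+ 2 / (4 * s ^+ 2).
  have -> : x ^+ 2 / (s ^+ 2 * 2) = y + y by rewrite /y; field.
  have -> : x ^+ 2 / (2 * s ^+ 2 * 2) = y by rewrite /y; field.
  have -> : x ^+ 2 = 4 * s ^+ 2 * y by rewrite /y; field.
  have yy : y * expR (- y) <= 1.
    rewrite expRN ler_pdivrMr ?expR_gt0// mul1r.
    by rewrite (le_trans _ (expR_ge1Dx y))// lerDr.
  have -> : 4 * s ^+ 2 * y * (normal_peak s * expR (- (y + y))) =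
      4 * s ^+ 2 * normal_peak s * expR (- y) * (y * expR (- y)).
    by rewrite opprD expRD; ring.
  rewrite ler_piMr// mulr_ge0 ?expR_ge0// mulr_ge0 ?normal_peak_ge0//.
  by rewrite mulr_ge0 ?sqr_ge0.
- exact: (@integrableZl _ _ _ mu _ measurableT C _ (integrable_normal_pdf _ _)).
Qed.

Lemma integrable_lin_normal_pdf (g : R -> R) (A : R) : measurable_fun setT g ->
  (forall x, `|g x| <= A * (1 + x ^+ 2)) ->
  mu.-integrable setT (EFin \o (fun x => g x * psi x)).
Proof.
move=> mg gA.
apply: (@le_integrable _ _ _ mu _ measurableT _
    (EFin \o (fun x => A * (psi x + x ^+ 2 * psi x)))).
- apply/measurable_EFinP; apply: measurable_funM => //.
  exact: measurable_normal_pdf.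
- move=> x _; rewrite lee_fin /=.
  rewrite normrM (ger0_norm (normal_pdf_ge0 _ _ _)).
  apply: le_trans (ler_norm _).
  by rewrite -{2}(mul1r (psi x)) -mulrDl mulrA ler_wpM2r// normal_pdf_ge0.
- apply: (@integrableZl _ _ _ mu _ _ A (EFin \o (fun x => psi x + x ^+ 2 * psi x))) => //.
  apply: (@integrableD _ _ _ mu _ _ (EFin \o psi) (EFin \o (fun x => x ^+ 2 * psi x))) => //.
    exact: integrable_normal_pdf.
  exact: integrable_sqr_normal_pdf.
Qed.

(** The integral over [[- n, n]] is a difference of two boundary values, and
    dominated convergence passes to the whole line. *)
Lemma Rintegral_derive_cvg0 (F f : R -> R) :
  continuous f -> mu.-integrable setT (EFin \o f) ->
  (forall x, is_derive x 1 F (f x)) ->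
  F n%:R @[n --> \oo] --> (0:R) -> F (- n%:R) @[n --> \oo] --> (0:R) ->
  \int[mu]_x f x = 0.
Proof.
move=> cf intf dF Fp Fm.
have mf : measurable_fun setT f by exact: continuous_measurable_fun.
have FTC n : (\int[mu]_x ((f \_ `[- n%:R, n%:R]) x)%:E = (F n%:R - F (- n%:R))%:E)%E.
  transitivity (\int[mu]_(x in `[(- n%:R)%R, n%:R%R]) (f x)%:E)%E.
    by rewrite [RHS]integral_mkcond restrict_EFin.
  case: n => [|n].
    by rewrite oppr0 subrr set_itv1 integral_set1.
  have cF : continuous F.
    by move=> x; apply: differentiable_continuous; apply/derivable1_diffP; case: (dF x).
  rewrite EFinB; apply: continuous_FTC2.
  - by rewrite gtrN.
  - exact: continuous_subspaceT.
  - split => [x _||]; first by case: (dF x).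
      by apply: cvg_at_right_filter; exact: cF.
    by apply: cvg_at_left_filter; exact: cF.
  - by move=> x _; rewrite derive1E derive_val.
have cvg1 : (\int[mu]_x ((f \_ `[(- n%:R)%R, n%:R%R]) x)%:E)%E @[n --> \oo] -->
    (\int[mu]_x (f x)%:E)%E.
  have [|||||_ _] := @dominated_convergence _ _ _ mu _ measurableT
    (fun n x => ((f \_ `[- n%:R, n%:R]) x)%:E) (EFin \o f) (abse \o (EFin \o f)).
  - move=> n; apply/measurable_EFinP.
    by apply/(measurable_restrictT f); [exact: measurable_itv|exact: measurable_funTS].
  - exact/measurable_EFinP.
  - apply: aeW => x _; apply: cvg_near_cst.
    near=> n.
    rewrite patchE ifT// inE /= in_itv /= -ler_norml.
    by near: n; exact: nbhs_infty_ger.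
  - exact: integrable_abse.
  - apply: aeW => x n _ /=; rewrite lee_fin patchE; case: ifPn => // _.
    by rewrite normr0.
  by [].
have cvg2 : (\int[mu]_x ((f \_ `[(- n%:R)%R, n%:R%R]) x)%:E)%E @[n --> \oo] --> (0%:E : \bar R).
  under eq_fun do rewrite FTC.
  apply: cvg_EFin; first by near=> n.
  rewrite -(subr0 (0:R)); exact: cvgB.
by rewrite /Rintegral (cvg_unique _ cvg1 cvg2).
Unshelve. all: by end_near. Qed.

(** Against the density, [expR (- y) <= y^-1] is already enough to beat linear
    growth; this disposes of the boundary terms in [normal_Stein]. *)
Lemma lin_normal_pdf_cvg0 (g : R -> R) (A : R) (sg : R) : `|sg| = 1 ->
  (forall x, `|g x| <= A * (1 + `|x|)) ->
  g (sg * n%:R) * psi (sg * n%:R) @[n --> \oo] --> (0:R).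
Proof.
move=> sg1 gA.
have A0 : 0 <= A by have := le_trans (normr_ge0 _) (gA 0); rewrite normr0 addr0 mulr1.
pose C := A * normal_peak s * (s ^+ 2 * 2) * 4.
apply: norm_cvg0.
apply: (@squeeze_cvgr _ _ _ _ (cst 0) (fun n => C * (n.+1%:R)^-1)); last 2 first.
- exact: cvg_cst.
- by rewrite -(mulr0 C); apply: cvgMr; exact: cvg_harmonic.
near=> n; rewrite normr_ge0 /=.
have n1 : (1 <= n)%N by near: n; exact: nbhs_infty_ge.
rewrite normrM (ger0_norm (normal_pdf_ge0 _ _ _)).
have := gA (sg * n%:R); rewrite normrM sg1 mul1r normr_nat => gn.
rewrite normal_pdf0E// exprMn.
have -> : sg ^+ 2 = 1 by rewrite -real_normK ?num_real// sg1 expr1n.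
rewrite mul1r.
have np : 0 < n%:R :> R by rewrite ltr0n.
set y := n%:R ^+ 2 / _.
have y0 : 0 < y by rewrite divr_gt0// ?exprn_gt0// mulr_gt0.
have ey : expR (- y) <= y^-1.
  rewrite expRN lef_pV2 ?posrE ?expR_gt0//.
  by rewrite (le_trans _ (expR_ge1Dx y))// lerDr.
apply: (@le_trans _ _ (A * (1 + n%:R) * (normal_peak s * y^-1))).
  by apply: ler_pM; rewrite ?mulr_ge0 ?normal_peak_ge0 ?expR_ge0// ler_wpM2l ?normal_peak_ge0.
rewrite /C /y invf_div.
have -> : A * (1 + n%:R) * (normal_peak s * (s ^+ 2 * 2 / n%:R ^+ 2)) =
   (A * normal_peak s * (s ^+ 2 * 2)) * ((1 + n%:R) / n%:R ^+ 2) by ring.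
rewrite -[leRHS]mulrA ler_wpM2l//.
  apply: mulr_ge0; first exact: mulr_ge0 A0 (normal_peak_ge0 _).
  by rewrite mulr_ge0 ?sqr_ge0.
rewrite ler_pdivrMr ?exprn_gt0// mulrAC ler_pdivlMr ?ltr0n//.
rewrite -natr1; have : 1 <= n%:R :> R by rewrite ler1n.
nra.
Unshelve. all: by end_near. Qed.

(** The derivative of [psi] is [- (x / s ^+ 2) * psi], so that the difference of
    the two sides is a multiple of the integral of the derivative of
    [g * psi], which vanishes. *)
Lemma normal_Stein (g g' : R -> R) (A B : R) :
  (forall x, is_derive x 1 g (g' x)) -> continuous g' ->
  (forall x, `|g x| <= A * (1 + `|x|)) -> (forall x, `|g' x| <= B * (1 + x ^+ 2)) ->
  \int[mu]_x (x * g x * psi x) = s ^+ 2 * \int[mu]_x (g' x * psi x).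
Proof.
move=> dg cg' gA gB.
have cg : continuous g.
  by move=> x; apply: differentiable_continuous; apply/derivable1_diffP; case: (dg x).
have A0 : 0 <= A by have := le_trans (normr_ge0 _) (gA 0); rewrite normr0 addr0 mulr1.
have i1 : mu.-integrable setT (EFin \o (fun x => x * g x * psi x)).
  apply: (@integrable_lin_normal_pdf (fun x => x * g x) (2 * A)).
    by apply: measurable_funM => //; exact: continuous_measurable_fun.
  move=> x; rewrite normrM.
  apply: (le_trans (ler_wpM2l (normr_ge0 x) (gA x))).
  have := normr_ge0 x; rewrite -(real_normK (num_real x)); set z := `|x| => z0.
  by have := mulr_ge0 A0 z0; have := mulr_ge0 A0 (sqr_ge0 (z - 1)); nra.
have i2 : mu.-integrable setT (EFin \o (fun x => g' x * psi x)).
  apply: (@integrable_lin_normal_pdf g' B) => //; exact: continuous_measurable_fun.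
have sn : s ^+ 2 != 0 by rewrite gt_eqF.
have i3 : mu.-integrable setT (EFin \o (fun x => (s ^+ 2)^-1 * (x * g x * psi x))).
  exact: (@integrableZl _ _ _ mu _ measurableT (s ^+ 2)^-1 _ i1).
have i4 : mu.-integrable setT (EFin \o (fun x => g' x * psi x - (s ^+ 2)^-1 * (x * g x * psi x))).
  exact: (@integrableB _ _ _ mu _ measurableT _ _ i2 i3).
have H : \int[mu]_x (g' x * psi x - (s ^+ 2)^-1 * (x * g x * psi x)) = 0.
  apply: (@Rintegral_derive_cvg0 (fun x => g x * psi x)) => //.
  - have cpsi := @continuous_normal_pdf R 0 s s0.
    move=> x; apply: cvgB; first by apply: cvgM; [exact: cg'|exact: cpsi].
    apply: cvgMr; apply: cvgM; last exact: cpsi.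
    by apply: cvgM; [exact: cvg_id|exact: cg].
  - move=> x; have := is_deriveM (dg x) (is_derive_normal_pdf x).
    by move/is_derive_eq; apply; rewrite /GRing.scale /=; field.
  - have := @lin_normal_pdf_cvg0 g A 1 (normr1 _) gA.
    by under eq_fun do rewrite mul1r.
  - have := @lin_normal_pdf_cvg0 g A (-1) (normrN1 _) gA.
    by under eq_fun do rewrite mulN1r.
move: H; rewrite RintegralB// RintegralZl// => /eqP; rewrite subr_eq0 => /eqP ->.
by rewrite mulVKf.
Qed.

Lemma normal_second_moment : \int[mu]_x (x ^+ 2 * psi x) = s ^+ 2.
Proof.
have := @normal_Stein id (cst 1) 1 1 (fun x => is_derive_id x 1).
move=> /(_ (fun x => cvg_cst _)) H.
rewrite -(mulr1 (s ^+ 2)).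
have -> : 1 = \int[mu]_x (cst 1 x * psi x) :> R.
  under eq_Rintegral do rewrite mul1r.
  by rewrite /Rintegral integral_normal_pdf.
rewrite -H.
- by apply: eq_Rintegral => x _; rewrite expr2.
- by move=> x; rewrite mul1r lerDr.
- by move=> x; rewrite mul1r normr1 lerDl sqr_ge0.
Qed.

Let is_derive_cosM (x b t : R) :
  is_derive t 1 (fun t => cos (t * x + b)) (- (x * sin (t * x + b))).
Proof.
have h1 : is_derive t (1:R) (fun t : R => t * x + b) x.
  have := is_deriveD (is_deriveM (@is_derive_id R R t 1) (@is_derive_cst R R R x t 1))
    (@is_derive_cst R R R b t 1).
  by move/is_derive_eq; apply; rewrite /GRing.scale /= mulr0 add0r mulr1 addr0.
have := @is_derive1_comp R cos (fun t => t * x + b) t _ _ (@is_derive_cos R (t * x + b)) h1.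
by move/is_derive_eq; apply; rewrite mulNr mulrC.
Qed.

Let is_derive_sinM (x b t : R) :
  is_derive x 1 (fun x => sin (t * x + b)) (t * cos (t * x + b)).
Proof.
have h1 : is_derive x (1:R) (fun x : R => t * x + b) t.
  have := is_deriveD (is_deriveM (@is_derive_cst R R R t x 1) (@is_derive_id R R x 1))
    (@is_derive_cst R R R b x 1).
  by move/is_derive_eq; apply; rewrite /GRing.scale /= mulr0 addr0 mulr1 addr0.
have := @is_derive1_comp R sin (fun x => t * x + b) x _ _ (@is_derive_sin R (t * x + b)) h1.
by move/is_derive_eq; apply; rewrite mulrC.
Qed.

Let contM (t b : R) : continuous (fun x : R => t * x + b).
Proof. by move=> x; apply: cvgD; [apply: cvgMr; exact: cvg_id|exact: cvg_cst]. Qed.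

Lemma measurable_cosM (t b : R) :
  measurable_fun setT (fun x : R => cos (t * x + b)).
Proof.
apply: continuous_measurable_fun => x.
by apply: continuous_comp; [exact: contM|exact: continuous_cos].
Qed.

Lemma integrable_cos_normal_pdf (t b : R) :
  mu.-integrable setT (EFin \o (fun x => cos (t * x + b) * psi x)).
Proof.
apply: (@integrable_lin_normal_pdf _ 1); first exact: measurable_cosM.
by move=> x; rewrite mul1r (le_trans (@cos_max _ _))// lerDl sqr_ge0.
Qed.

(** Differentiating in [t] under the integral sign and applying [normal_Stein]
    to [sin (t * x + b)], the left side satisfies [phi' = - s ^+ 2 * t * phi];
    hence its product with [expR (s ^+ 2 * t ^+ 2 / 2)] is constant. *)
Lemma normal_char t b :
  \int[mu]_x (cos (t * x + b) * psi x) = expR (- (s ^+ 2 * t ^+ 2 / 2)) * cos b.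
Proof.
pose phi t := \int[mu]_x (cos (t * x + b) * psi x).
have dphi u : is_derive u (1:R) phi (- (s ^+ 2 * u * phi u)).
  have mS : measurable_fun setT (fun x : R => x * sin (u * x + b)).
    apply: measurable_funM => //; apply: continuous_measurable_fun => x.
    by apply: continuous_comp; [exact: contM|exact: continuous_sin].
  have d1 (v x : R) : is_derive v 1 (fun v => cos (v * x + b) * psi x) (- (x * sin (v * x + b)) * psi x).
    have := is_deriveM (is_derive_cosM x b v) (@is_derive_cst R R R (psi x) v 1).
    by move/is_derive_eq; apply; rewrite /GRing.scale /= mulr0 add0r mulrC.
  have p1 v x : partial1of2 (fun v x => cos (v * x + b) * psi x) v x = - (x * sin (v * x + b)) * psi x.
    by rewrite partial1of2E; have := d1 v x; case.
  pose G x := `|x| * psi x.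
  have uI : `]u - 1, u + 1[%classic u by rewrite /= in_itv /= ltrBlDr ltrDl ltr01.
  have hi v : `]u - 1, u + 1[%classic v -> mu.-integrable setT (EFin \o (fun x => cos (v * x + b) * psi x)).
    by move=> _; exact: integrable_cos_normal_pdf.
  have hd v x : `]u - 1, u + 1[%classic v -> [set: R] x -> derivable ((fun v x => cos (v * x + b) * psi x)^~ x) v 1.
    by move=> _ _; case: (d1 v x).
  have G0 x : 0 <= G x by rewrite mulr_ge0 ?normal_pdf_ge0.
  have iG : mu.-integrable setT (EFin \o G).
    apply: (@integrable_lin_normal_pdf _ 1); first exact: normr_measurable.
    move=> x; rewrite mul1r normr_id -(real_normK (num_real x)).
    by have := sqr_ge0 (`|x| - 1); have := normr_ge0 x; nra.
  have Gub v x : `]u - 1, u + 1[%classic v -> [set: R] x ->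
      `|partial1of2 (fun v x => cos (v * x + b) * psi x) v x| <= G x.
    move=> _ _; rewrite p1 normrM normrN (ger0_norm (normal_pdf_ge0 _ _ _)).
    by rewrite ler_wpM2r ?normal_pdf_ge0// normrM ler_piMr// sin_max.
  apply: DeriveDef.
    exact: (derivable_under_integral measurableT uI hi hd G0 iG Gub).
  rewrite -derive1E (differentiation_under_integral measurableT uI hi hd G0 iG Gub).
  under eq_Rintegral do rewrite p1 mulNr -mulN1r.
  rewrite RintegralZl//; last first.
    apply: (@integrable_lin_normal_pdf _ 1) => //.
    move=> x; rewrite mul1r normrM.
    have := @sin_max _ (u * x + b); have := normr_ge0 x.
    rewrite -(real_normK (num_real x)).
    by have := sqr_ge0 (`|x| - 1); nra.
  rewrite mulN1r (@normal_Stein (fun x => sin (u * x + b)) (fun x => u * cos (u * x + b)) 1 `|u|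
     (fun x => is_derive_sinM x b u)) //.
  - by under eq_Rintegral do rewrite -mulrA; rewrite RintegralZl ?mulrA//; exact: integrable_cos_normal_pdf.
  - move=> x; apply: cvgMr.
    by apply: continuous_comp; [exact: contM|exact: continuous_cos].
  - by move=> x; rewrite mul1r (le_trans (@sin_max _ _))// lerDl.
  - move=> x; rewrite normrM ler_wpM2l// (le_trans (@cos_max _ _))//.
    by rewrite lerDl sqr_ge0.
have dH u : is_derive u (1:R) (fun u => phi u * expR (s ^+ 2 * u ^+ 2 / 2)) 0.
  have h1 : is_derive u (1:R) (fun u : R => s ^+ 2 * u ^+ 2 / 2) (s ^+ 2 * u).
    have := is_deriveM (@is_derive_cst R R R (s ^+ 2 / 2) u 1) (is_deriveX 2 (@is_derive_id R R u 1)).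
    move/is_derive_eq => /(_ (s ^+ 2 * u)).
    have -> : (cst (s ^+ 2 / 2) * id ^+ 2) = (fun u : R => s ^+ 2 * u ^+ 2 / 2).
      by apply/funext => y /=; rewrite !fctE; ring.
    by apply; rewrite /GRing.scale /= mulr0 addr0; field.
  have := is_deriveM (dphi u) (is_derive1_comp (@is_derive_expR R _) h1).
  by move/is_derive_eq; apply; rewrite /GRing.scale /=; ring.
have := is_derive_0_is_cst t 0 dH.
rewrite expr0n /= mulr0 mul0r expR0 mulr1.
have -> : phi 0 = cos b.
  rewrite /phi; under eq_Rintegral do rewrite mul0r add0r.
  rewrite RintegralZl//; last exact: integrable_normal_pdf.
  by rewrite /Rintegral integral_normal_pdf mulr1.
by move=> H; rewrite -/(phi t) expRN -H mulrC mulfK// gt_eqF ?expR_gt0.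
Qed.

Lemma normal_peak_lb : (3 * `|s|)^-1 <= normal_peak s.
Proof.
have n0 : 0 < `|s| by rewrite normr_gt0.
rewrite /normal_peak -[X in Num.sqrt X]mulr_natr lef_pV2 ?posrE ?mulr_gt0//; last first.
  by rewrite sqrtr_gt0 mulr_gt0// mulr_gt0// pi_gt0.
rewrite -[leRHS]ger0_norm ?mulr_ge0// -sqrtr_sqr ler_sqrt.
  rewrite exprMn real_normK ?num_real//.
  have := @pihalf_lt2 R; rewrite ltr_pdivrMr// => ?.
  by nra.
by rewrite sqr_ge0.
Qed.

Lemma normal_prob_itv_lb (a b c : R) : a <= b -> `|a| <= c -> `|b| <= c ->
  (((b - a) * (expR (- (c ^+ 2 / (s ^+ 2 * 2))) / (3 * `|s|)))%:E <=
    normal_prob 0 s `[a, b])%E.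
Proof.
move=> ab ac bc; rewrite /normal_prob.
pose k := expR (- (c ^+ 2 / (s ^+ 2 * 2))) / (3 * `|s|).
apply: (@le_trans _ _ (\int[mu]_(x in `[a, b]) k%:E)%E).
  rewrite integral_cst//= lebesgue_measure_itv /= lte_fin.
  case: ltP => h; first by rewrite -EFinD -EFinM mulrC.
  have -> : a = b by apply/le_anti; rewrite ab h.
  by rewrite subrr mul0r mule0.
apply: ge0_le_integral => //=.
- by move=> x _; rewrite lee_fin divr_ge0 ?expR_ge0// mulr_ge0.
- apply/measurable_EFinP/measurable_funTS; exact: measurable_normal_pdf.
- move=> x; rewrite in_itv /= => /andP[ax xb].
  rewrite lee_fin normal_pdf0E// /k mulrC ler_pM ?invr_ge0 ?mulr_ge0 ?expR_ge0 ?normal_peak_lb//.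
  rewrite ler_expR lerN2 ler_pM2r ?invr_gt0 ?(mulr_gt0 s2gt0)//.
  have xc : `|x| <= c.
    rewrite ler_norml; move: ac bc; rewrite !ler_norml => /andP[h1 _] /andP[_ h2].
    by rewrite (le_trans h1)//= (le_trans xb).
  by rewrite -(real_normK (num_real x)) ler_pXn2r// ?nnegrE// (le_trans _ xc).
Qed.

(** Half of the exponent is bounded by its value at [x]; the other half
    integrates as a normal density of twice the variance. *)
Lemma normal_prob_tail_ub x : 0 <= x ->
  (normal_prob 0 s `[x, +oo[ <= (2 * expR (- (x ^+ 2 / (s ^+ 2 * 4))))%:E)%E.
Proof.
move=> x0; rewrite /normal_prob.
have t0 : Num.sqrt 2 * s != 0 :> R by rewrite mulf_neq0// sqrtr_eq0 -ltNge.
pose k := 2 * expR (- (x ^+ 2 / (s ^+ 2 * 4))).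
have k0 : 0 <= k by rewrite mulr_ge0 ?expR_ge0.
apply: (@le_trans _ _ (\int[mu]_(y in `[x, +oo[) (k%:E * (normal_pdf 0 (Num.sqrt 2 * s) y)%:E))%E).
  apply: ge0_le_integral => //=.
  - by move=> y _; rewrite lee_fin normal_pdf_ge0.
  - apply/measurable_EFinP/measurable_funTS; exact: measurable_normal_pdf.
  - apply/measurable_EFinP/measurable_funTS; apply: measurable_funM => //.
    exact: measurable_normal_pdf.
  - move=> y; rewrite in_itv /= andbT => xy.
    rewrite lee_fin !normal_pdf0E// exprMn sqr_sqrtr// /k.
    have y0 : 0 <= y := le_trans x0 xy.
    have -> : y ^+ 2 / (s ^+ 2 * 2) = y ^+ 2 / (s ^+ 2 * 4) + y ^+ 2 / (2 * s ^+ 2 * 2) by field.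
    rewrite opprD expRD mulrA [leRHS]mulrA ler_wpM2r ?expR_ge0//.
    have e1 : expR (- (y ^+ 2 / (s ^+ 2 * 4))) <= expR (- (x ^+ 2 / (s ^+ 2 * 4))).
      rewrite ler_expR lerN2 ler_pM2r ?invr_gt0 ?(mulr_gt0 s2gt0)//.
      by rewrite ler_pXn2r ?nnegrE.
    rewrite [leRHS]mulrAC ler_pM ?expR_ge0 ?normal_peak_ge0//.
    rewrite /normal_peak.
    have -> : (Num.sqrt 2 * s) ^+ 2 * pi *+ 2 = 2 * (s ^+ 2 * pi *+ 2).
      by rewrite exprMn sqr_sqrtr//; ring.
    rewrite sqrtrM// invfM mulrA -[leLHS]mul1r ler_wpM2r ?invr_ge0 ?sqrtr_ge0//.
    rewrite ler_pdivlMr ?sqrtr_gt0// mul1r.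
    rewrite -[leRHS]ger0_norm// -sqrtr_sqr ler_sqrt; nra.
rewrite ge0_integralZl//=; first last.
  - by move=> y _; rewrite lee_fin normal_pdf_ge0.
  - apply/measurable_EFinP/measurable_funTS; exact: measurable_normal_pdf.
rewrite -[leRHS]mule1 lee_wpmul2l//.
exact: (@probability_le1 _ _ _ (normal_prob 0 (Num.sqrt 2 * s))).
Qed.

End fixed.
End normal.

(** * Real-valued expectations and centred Gaussian variables *)

Section proba.
Context d (T : measurableType d) (R : realType) (P : probability T R).
Implicit Types (f g X Y : T -> R) (A B : set T).

(** Real-valued forms of the expectation and of the probability, adequate
    because only integrable variables and measurable events occur, and because
    real inequalities can then be combined arithmetically. *)
Definition Ex f : R := \int[P]_w f w.
Definition pr A : R := fine (P A).
Definition intg f := P.-integrable setT (EFin \o f).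

Lemma intgD f g : intg f -> intg g -> intg (fun w => f w + g w).
Proof. by move=> hf hg; exact: (@integrableD _ _ _ P _ measurableT _ _ hf hg). Qed.

Lemma intgZ (k : R) f : intg f -> intg (fun w => k * f w).
Proof. by move=> hf; exact: (@integrableZl _ _ _ P _ measurableT k _ hf). Qed.

Lemma intg_cst (k : R) : intg (fun=> k).
Proof. exact: finite_measure_integrable_cst. Qed.

Lemma intg_bounded f (C : R) : measurable_fun setT f -> (forall w, `|f w| <= C) -> intg f.
Proof.
move=> mf fC; apply: (le_integrable measurableT _ _ (intg_cst C)).
  exact/measurable_EFinP.
by move=> w _ /=; rewrite lee_fin (le_trans (fC w))// ler_norm.
Qed.

Lemma intg_le f g : measurable_fun setT f -> (forall w, `|f w| <= g w) -> intg g -> intg f.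
Proof.
move=> mf fC; apply: (le_integrable measurableT); first exact/measurable_EFinP.
by move=> w _ /=; rewrite lee_fin (le_trans (fC w))// ler_norm.
Qed.

Lemma intg_sum (I : Type) (r : seq I) (F : I -> T -> R) :
  (forall i, intg (F i)) -> intg (fun w => \sum_(i <- r) F i w).
Proof.
move=> h; elim: r => [|i r IH].
  by under eq_fun do rewrite big_nil; exact: intg_cst.
by under eq_fun do rewrite big_cons; exact: intgD.
Qed.

Lemma ExD f g : intg f -> intg g -> Ex (fun w => f w + g w) = Ex f + Ex g.
Proof. by move=> hf hg; rewrite /Ex RintegralD. Qed.

Lemma ExZ (k : R) f : intg f -> Ex (fun w => k * f w) = k * Ex f.
Proof. by move=> hf; rewrite /Ex RintegralZl. Qed.

Lemma Ex_cst (k : R) : Ex (fun=> k) = k.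
Proof. by rewrite /Ex /Rintegral integral_cst//= probability_setT mule1. Qed.

Lemma Ex_sum (I : Type) (r : seq I) (F : I -> T -> R) :
  (forall i, intg (F i)) -> Ex (fun w => \sum_(i <- r) F i w) = \sum_(i <- r) Ex (F i).
Proof.
move=> h; elim: r => [|i r IH].
  by under eq_fun do rewrite big_nil; rewrite Ex_cst big_nil.
under eq_fun do rewrite big_cons.
by rewrite ExD// ?IH ?big_cons//; exact: intg_sum.
Qed.

Lemma le_Ex f g : intg f -> intg g -> (forall w, f w <= g w) -> Ex f <= Ex g.
Proof. by move=> hf hg h; apply: le_Rintegral. Qed.

Lemma Ex_ge0 f : (forall w, 0 <= f w) -> 0 <= Ex f.
Proof. by move=> h; exact: Rintegral_ge0. Qed.

Lemma intg_indic A : measurable A -> intg (\1_A).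
Proof.
move=> mA; apply: (@intg_bounded _ 1) => // w.
by rewrite indicE; case: (w \in A); rewrite ?normr1 ?normr0.
Qed.

Lemma pr_EFin A : measurable A -> (pr A)%:E = P A.
Proof. by move=> mA; rewrite fineK// fin_num_measure. Qed.

Lemma prE A : measurable A -> pr A = Ex (\1_A).
Proof. by move=> mA; rewrite /Ex /Rintegral integral_indic// setIT. Qed.

Lemma pr_ge0 A : 0 <= pr A. Proof. exact: fine_ge0. Qed.

Lemma pr_le1 A : measurable A -> pr A <= 1.
Proof. by move=> mA; rewrite -lee_fin pr_EFin// probability_le1. Qed.

Lemma le_pr A B : measurable A -> measurable B -> A `<=` B -> pr A <= pr B.
Proof. by move=> mA mB AB; rewrite -lee_fin !pr_EFin// le_measure// inE. Qed.

Lemma pr_setC A : measurable A -> pr (~` A) = 1 - pr A.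
Proof.
move=> mA; apply: EFin_inj.
rewrite pr_EFin; last exact: measurableC.
by rewrite probability_setC// EFinB pr_EFin.
Qed.

Lemma le_prU A B C : measurable A -> measurable B -> measurable C ->
  A `<=` B `|` C -> pr A <= pr B + pr C.
Proof.
move=> mA mB mC ABC; rewrite -lee_fin EFinD !pr_EFin//.
apply: (le_trans (y := P (B `|` C))).
  by apply: le_measure; rewrite ?inE//; exact: measurableU.
exact: measureU2.
Qed.

Lemma le_pr_sum (I : finType) A (B : I -> set T) : measurable A ->
  (forall i, measurable (B i)) -> (forall w, A w -> exists i, B i w) ->
  pr A <= \sum_i pr (B i).
Proof.
move=> mA mB AB; rewrite prE//.
have h i : intg (\1_(B i)) by exact: intg_indic.
under eq_bigr do rewrite prE//.
rewrite -Ex_sum//; apply: le_Ex; [exact: intg_indic|exact: intg_sum|].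
move=> w; rewrite indicE; case: (boolP (w \in A)) => [|_].
  rewrite inE => /AB[i Bi]; rewrite (bigD1 i)//= indicE mem_set// lerDl.
  by apply: sumr_ge0.
by apply: sumr_ge0.
Qed.

Lemma markov_pr A f (x : R) : 0 < x -> measurable A -> intg f -> (forall w, 0 <= f w) ->
  (forall w, A w -> x <= f w) -> pr A <= Ex f / x.
Proof.
move=> x0 mA hf f0 Af; rewrite ler_pdivlMr// mulrC prE// -ExZ; last exact: intg_indic.
apply: le_Ex => //; first by apply: intgZ; exact: intg_indic.
move=> w; rewrite indicE; case: (boolP (w \in A)); rewrite ?mulr0//.
by rewrite inE mulr1 => /Af.
Qed.

(** The Dirac mass at 0 is included, so that linear combinations of jointly
    Gaussian variables never leave the class. *)
Definition cgauss X := measurable_fun setT X /\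
  exists s : R, forall B : set R, measurable B ->
    P (X @^-1` B) = (if s == 0 then \d_(0:R) B else normal_prob 0 s B).

Lemma ge0_normal_transfer (X : T -> R) (m s : R) (f : R -> R) : measurable_fun setT X ->
  (forall B : set R, measurable B -> P (X @^-1` B) = normal_prob m s B) ->
  measurable_fun setT f -> (forall x, 0 <= f x) ->
  (\int[P]_w (f (X w))%:E = \int[lebesgue_measure]_x (f x * normal_pdf m s x)%:E)%E.
Proof.
move=> mX lawX mf f0.
pose X' : {mfun T >-> measurableTypeR R} :=
  HB.pack (X : T -> measurableTypeR R) (isMeasurableFun.Build _ _ _ (measurableTypeR R) X mX).
transitivity (\int[distribution P X']_x (f x)%:E)%E.
  rewrite ge0_integral_distribution//; first exact/measurable_EFinP.
transitivity (\int[normal_prob m s]_x (f x)%:E)%E.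
  have H (B : set (measurableTypeR R)) : measurable B -> B `<=` setT -> distribution P X' B = normal_prob m s B.
    by move=> mB _; rewrite /distribution /pushforward lawX.
  exact: (@eq_measure_integral _ _ R setT (normal_prob m s) (distribution P X') (EFin \o f) H).
by rewrite ge0_integral_normal_prob//; exact/measurable_EFinP.
Qed.

Section transfer.
Variables (X : T -> R) (s : R).
Hypothesis mX : measurable_fun setT X.
Hypothesis lawX : forall B : set R, measurable B -> P (X @^-1` B) = normal_prob 0 s B.

Lemma gauss_transfer (f : R -> R) : measurable_fun setT f ->
  lebesgue_measure.-integrable setT (EFin \o (fun x => f x * normal_pdf 0 s x)) ->
  intg (f \o X) /\ Ex (f \o X) = \int[lebesgue_measure]_x (f x * normal_pdf 0 s x).
Proof.
move=> mf intf.
have mfX : measurable_fun setT (f \o X) by exact: measurableT_comp.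
have ifX : intg (f \o X).
  apply/integrableP; split; first exact/measurable_EFinP.
  rewrite (ge0_normal_transfer mX lawX (f := fun x => `|f x|))//; last exact: measurableT_comp.
  move/integrableP : intf => [_]; under eq_integral do rewrite /= normrM (ger0_norm (normal_pdf_ge0 _ _ _)).
  by [].
split => //.
have E (x : R) : f x = Num.max (f x) 0 - Num.max (- f x) 0.
  by case: (leP (f x) 0) => h; rewrite /Num.max; do 2 case: ltP; lra.
pose fp x := Num.max (f x) 0; pose fn x := Num.max (- f x) 0.
have mfp : measurable_fun setT fp by exact: measurable_maxr.
have mfn : measurable_fun setT fn by apply: measurable_maxr => //; exact: measurableT_comp.
have fp0 x : 0 <= fp x by rewrite le_max lexx orbT.
have fn0 x : 0 <= fn x by rewrite le_max lexx orbT.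
have fpf x : `|fp x| <= `|f x|.
  by rewrite ger0_norm// /fp ge_max ler_norm normr_ge0.
have fnf x : `|fn x| <= `|f x|.
  by rewrite ger0_norm// /fn ge_max -normrN ler_norm normr_ge0.
have mpsi : measurable_fun setT (@normal_pdf R 0 s) by exact: measurable_normal_pdf.
have ip : lebesgue_measure.-integrable setT (EFin \o (fun x => fp x * normal_pdf 0 s x)).
  apply: (le_integrable measurableT _ _ intf); first exact/measurable_EFinP/measurable_funM.
  by move=> x _; rewrite lee_fin !normrM ler_wpM2r.
have in_ : lebesgue_measure.-integrable setT (EFin \o (fun x => fn x * normal_pdf 0 s x)).
  apply: (le_integrable measurableT _ _ intf); first exact/measurable_EFinP/measurable_funM.
  by move=> x _; rewrite lee_fin !normrM ler_wpM2r.
have ipX : intg (fp \o X).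
  apply: (intg_le (g := fun w => `|f (X w)|)); last exact: (integrable_norm ifX).
    exact: measurableT_comp.
  by move=> w; exact: fpf.
have inX : intg (fn \o X).
  apply: (intg_le (g := fun w => `|f (X w)|)); last exact: (integrable_norm ifX).
    exact: measurableT_comp.
  by move=> w; exact: fnf.
transitivity (Ex (fp \o X) - Ex (fn \o X)).
  by rewrite /Ex -RintegralB//; apply: eq_Rintegral => w _; exact: E.
transitivity (\int[lebesgue_measure]_x (fp x * normal_pdf 0 s x) -
   \int[lebesgue_measure]_x (fn x * normal_pdf 0 s x)).
  by rewrite /Ex /Rintegral !(ge0_normal_transfer mX lawX).
by rewrite -RintegralB//; apply: eq_Rintegral => x _; rewrite -mulrBl -E.
Qed.

End transfer.

Lemma dirac0_as X : measurable_fun setT X ->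
  (forall B : set R, measurable B -> P (X @^-1` B) = \d_(0:R) B) ->
  forall A, measurable A -> (forall w, X w = 0 -> A w) -> pr A = 1.
Proof.
move=> mX lawX A mA XA; apply/le_anti; rewrite pr_le1//=.
have h : P (X @^-1` [set 0]) = 1%E.
  by rewrite lawX// diracE mem_set.
rewrite -lee_fin pr_EFin// -h; apply: le_measure; rewrite ?inE//.
by rewrite -[X in measurable X]setTI; exact: mX.
Qed.

Lemma Ex_dirac0 X (f : R -> R) : measurable_fun setT X ->
  (forall B : set R, measurable B -> P (X @^-1` B) = \d_(0:R) B) ->
  measurable_fun setT f -> intg (f \o X) /\ Ex (f \o X) = f 0.
Proof.
move=> mX lawX mf.
have P0 : P (X @^-1` (~` [set 0])) = 0%E.
  rewrite lawX; last exact: measurableC.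
  by rewrite diracE memNset//= => h; exact: h.
have E1 : (\int[P]_w (f (X w))%:E = \int[P]_w (f 0)%:E)%E.
  apply: ae_eq_integral => //.
  - by apply/measurable_EFinP; exact: measurableT_comp.
  - exists (X @^-1` (~` [set 0])); split.
    + rewrite -[X in measurable X]setTI; apply: mX => //; exact: measurableC.
    + exact: P0.
    + by move=> w /= h Xw; apply: h => _; rewrite Xw.
split; last by rewrite /Ex /Rintegral E1 integral_cst//= probability_setT mule1.
apply/integrableP; split; first by apply/measurable_EFinP; exact: measurableT_comp.
rewrite (_ : (\int[P]_x `|(EFin \o (f \o X)) x| = \int[P]_w `|f 0|%:E)%E).
  by rewrite integral_cst//= probability_setT mule1 ltry.
apply: ae_eq_integral => //.
- by apply/measurable_EFinP; do 2 apply: measurableT_comp => //.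
- exists (X @^-1` (~` [set 0])); split.
  + rewrite -[X in measurable X]setTI; apply: mX => //; exact: measurableC.
  + exact: P0.
  + by move=> w /= h Xw; apply: h => _; rewrite Xw.
Qed.

Definition varX X := Ex (fun w => X w ^+ 2).

Lemma varX_ge0 X : 0 <= varX X.
Proof. by apply: Ex_ge0 => w; exact: sqr_ge0. Qed.

Variant cgauss_spec X : Prop :=
| CgaussDirac of varX X = 0 &
    (forall B : set R, measurable B -> P (X @^-1` B) = \d_(0:R) B)
| CgaussNormal s of s != 0 & varX X = s ^+ 2 &
    (forall B : set R, measurable B -> P (X @^-1` B) = normal_prob 0 s B).

Let msqr : measurable_fun setT (fun x : R => x ^+ 2).
Proof. exact: measurable_funX. Qed.

Lemma cgaussP X : cgauss X -> cgauss_spec X.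
Proof.
move=> [mX [s lawX]]; have [s0|s0] := eqVneq s 0.
  have lawX' (B : set R) : measurable B -> P (X @^-1` B) = \d_(0:R) B.
    by move=> mB; rewrite lawX// s0 eqxx.
  apply: CgaussDirac => //.
  have [_ H] := Ex_dirac0 mX lawX' msqr.
  by rewrite /varX H expr0n.
have lawX' (B : set R) : measurable B -> P (X @^-1` B) = normal_prob 0 s B.
  by move=> mB; rewrite lawX// (negbTE s0).
apply: (CgaussNormal s0) => //.
have [_ H] := gauss_transfer mX lawX' msqr (integrable_sqr_normal_pdf s0).
by rewrite /varX H normal_second_moment.
Qed.

Lemma cgauss_intg_sqr X : cgauss X -> intg (fun w => X w ^+ 2).
Proof.
move=> hX; have mX := hX.1; case: (cgaussP hX) => [_ lawX|s s0 _ lawX].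
  exact: (Ex_dirac0 mX lawX msqr).1.
exact: (gauss_transfer mX lawX msqr (integrable_sqr_normal_pdf s0)).1.
Qed.

Lemma measurable_set_rv X (B : set R) : measurable_fun setT X -> measurable B ->
  measurable (X @^-1` B).
Proof. by move=> mX mB; rewrite -[X in measurable X]setTI; exact: mX. Qed.

Lemma measurable_cosD X (b : R) : measurable_fun setT X ->
  measurable_fun setT (fun w => cos (X w + b)).
Proof.
move=> mX; apply: (measurableT_comp (f := cos)).
  by apply: continuous_measurable_fun; exact: continuous_cos.
exact: measurable_funD.
Qed.

Lemma cgauss_cos X (b : R) : cgauss X ->
  Ex (fun w => cos (X w + b)) = expR (- (varX X / 2)) * cos b.
Proof.
move=> hX; have mX := hX.1.
have mc : measurable_fun setT (fun x : R => cos (1 * x + b)) by exact: measurable_cosM.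
case: (cgaussP hX) => [-> lawX|s s0 -> lawX].
  rewrite mul0r oppr0 expR0 mul1r.
  have [_] := Ex_dirac0 mX lawX mc.
  rewrite /= mulr0 add0r => <-; rewrite /Ex.
  by apply: eq_Rintegral => w _ /=; rewrite mul1r.
have [_] := gauss_transfer mX lawX mc (integrable_cos_normal_pdf s0 1 b).
rewrite normal_char// expr1n mulr1 => <-; rewrite /Ex /=.
by apply: eq_Rintegral => w _ /=; rewrite mul1r.
Qed.

Lemma cgauss_tail X (v x : R) : cgauss X -> varX X <= v -> 0 < v -> 0 < x ->
  pr [set w | x <= X w] <= 2 * expR (- (x ^+ 2 / (v * 4))).
Proof.
move=> hX Xv v0 x0; have mX := hX.1.
have -> : [set w | x <= X w] = X @^-1` `[x, +oo[%classic.
  by apply/seteqP; split => w /=; rewrite in_itv/= andbT.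
case: (cgaussP hX) => [_ lawX|s s0 vX lawX].
  rewrite /pr lawX// diracE memNset/=; last by rewrite in_itv/= leNgt x0.
  by rewrite mulr_ge0 ?expR_ge0.
rewrite -lee_fin pr_EFin; last exact: measurable_set_rv.
rewrite lawX//; apply: (le_trans (normal_prob_tail_ub s0 (ltW x0))).
rewrite lee_fin ler_pM2l// ler_expR lerN2 ler_pM2l ?exprn_gt0//.
have s2 : 0 < s ^+ 2 by rewrite exprn_even_gt0.
by rewrite lef_pV2 ?posrE ?(mulr_gt0 s2) ?mulr_gt0// ler_pM2r// -vX.
Qed.

(** The density is bounded below on the interval between [b] and [b + 1]
    standard deviations. *)
Lemma cgauss_lower X (b : R) : cgauss X -> 0 < varX X -> 0 <= b ->
  expR (- ((b + 1) ^+ 2 / 2)) / 3 <= pr [set w | b * Num.sqrt (varX X) <= X w].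
Proof.
move=> hX v0 b0; have mX := hX.1.
case: (cgaussP hX) => [v00|s s0 vX lawX]; first by rewrite v00 ltxx in v0.
rewrite vX sqrtr_sqr; set a := `|s|.
have a0 : 0 < a by rewrite normr_gt0.
pose I := `[b * a, (b + 1) * a]%classic.
have mI : measurable I by exact: measurable_itv.
apply: (@le_trans _ _ (pr (X @^-1` I))); last first.
  apply: le_pr; [exact: measurable_set_rv| |by move=> w; rewrite /I /= in_itv/= => /andP[]].
  have -> : [set w | b * a <= X w] = X @^-1` `[b * a, +oo[%classic.
    by apply/seteqP; split => w /=; rewrite in_itv/= andbT.
  exact: measurable_set_rv.
rewrite -lee_fin pr_EFin; last exact: measurable_set_rv.
rewrite lawX//; apply: le_trans (normal_prob_itv_lb s0 (c := (b + 1) * a) _ _ _).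
- rewrite lee_fin -mulrBl addrAC subrr add0r mul1r.
  have -> : s ^+ 2 = a ^+ 2 by rewrite real_normK ?num_real.
  have -> : ((b + 1) * a) ^+ 2 / (a ^+ 2 * 2) = (b + 1) ^+ 2 / 2.
    by field; rewrite gt_eqF.
  have -> : a * (expR (- ((b + 1) ^+ 2 / 2)) / (3 * a)) = expR (- ((b + 1) ^+ 2 / 2)) / 3.
    by field; rewrite gt_eqF.
  by [].
- by rewrite ler_wpM2r ?ltW// ltrDl.
- by rewrite ger0_norm ?mulr_ge0 ?(ltW a0)// ler_wpM2r ?(ltW a0)// lerDl.
- by rewrite ger0_norm ?mulr_ge0 ?(ltW a0)// addr_ge0.
Qed.

Lemma cgauss_small X (b : R) : cgauss X -> 0 <= b <= 1 ->
  b / 3 <= pr [set w | `|X w| <= b * Num.sqrt (varX X)].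
Proof.
move=> hX /andP[b0 b1]; have mX := hX.1.
have E (c : R) : [set w | `|X w| <= c] = X @^-1` `[- c, c]%classic.
  by apply/seteqP; split => w /=; rewrite in_itv/= ler_norml.
have mE (c : R) : measurable [set w | `|X w| <= c] by rewrite E; exact: measurable_set_rv.
case: (cgaussP hX) => [v00 lawX|s s0 vX lawX].
  rewrite (dirac0_as mX lawX)//; first by lra.
  by move=> w /= ->; rewrite normr0 mulr_ge0 ?sqrtr_ge0.
rewrite vX sqrtr_sqr; set a := `|s|.
have a0 : 0 < a by rewrite normr_gt0.
rewrite -lee_fin pr_EFin// E lawX//.
have ba : 0 <= b * a by rewrite mulr_ge0 ?(ltW a0).
have baa : b * a <= a by rewrite ler_piMl ?(ltW a0).
apply: le_trans (normal_prob_itv_lb s0 (c := a) _ _ _).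
- rewrite lee_fin opprK.
  have -> : s ^+ 2 = a ^+ 2 by rewrite real_normK ?num_real.
  have -> : a ^+ 2 / (a ^+ 2 * 2) = 1 / 2 by field; rewrite gt_eqF.
  have -> : (b * a + b * a) * (expR (- (1 / 2)) / (3 * a)) = b / 3 * (2 * expR (- (1 / 2))).
    by field; rewrite gt_eqF.
  rewrite ler_peMr ?divr_ge0//.
  have := @expR_ge1Dx R (- (1 / 2)); lra.
- lra.
- by rewrite normrN ger0_norm.
- by rewrite ger0_norm.
Qed.

End proba.

Section measurable_events.
Context d (T : measurableType d) (R : realType).

Lemma measurable_ge_rv (X : T -> R) (c : R) : measurable_fun setT X -> measurable [set w | c <= X w].
Proof.
move=> mX; have -> : [set w | c <= X w] = X @^-1` `[c, +oo[%classic.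
  by apply/seteqP; split => w /=; rewrite in_itv /= andbT.
exact: measurable_set_rv.
Qed.

Lemma measurable_le_rv (X : T -> R) (c : R) : measurable_fun setT X -> measurable [set w | X w <= c].
Proof.
move=> mX; have -> : [set w | X w <= c] = X @^-1` `]-oo, c]%classic.
  by apply/seteqP; split => w /=; rewrite in_itv.
exact: measurable_set_rv.
Qed.

Lemma measurable_forall (I : finType) (A : I -> set T) : (forall i, measurable (A i)) ->
  measurable [set w | forall i, A i w].
Proof.
move=> mA; have -> : [set w | forall i, A i w] = \bigcap_(i in [set: I]) A i.
  by apply/seteqP; split => w /= h i; [move=> _; exact: h|exact: h].
by apply: fin_bigcap_measurable => // i _; exact: mA.
Qed.

Lemma measurable_small_sum (I : finType) (Y : I -> T -> R) (c : R) :
  (forall i, measurable_fun setT (Y i)) ->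
  measurable [set w | (forall i, 0 <= Y i w) /\ \sum_i Y i w <= c].
Proof.
move=> mY; apply: measurableI.
  by apply: measurable_forall => i; exact: measurable_ge_rv.
by apply: measurable_le_rv; exact: measurable_sum.
Qed.

End measurable_events.

(** * Independence from factorisation on cosines *)

Section sign.
Context {R : realType}.
Implicit Type s : R.

(** The map [t |-> (3 * t - t ^+ 3) / 2] fixes -1, 0 and 1 and attracts every
    other point of [[- 1, 1]] to its sign. Its iterates are polynomials that
    converge to the sign function; applied to a sine they are trigonometric
    polynomials. *)
Fixpoint sgn_iter n s : R :=
  if n is n'.+1 then let t := sgn_iter n' s in (3 * t - t ^+ 3) / 2 else s.

Lemma sgn_iterN n s : sgn_iter n (- s) = - sgn_iter n s.
Proof. by elim: n => //= n ->; field. Qed.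

Lemma sgn_iter0 n : sgn_iter n 0 = 0.
Proof. by elim: n => //= n ->; rewrite expr0n/=; field. Qed.

Lemma sgn_iter_pos n s : 0 < s <= 1 -> s <= sgn_iter n s <= 1.
Proof.
move=> /andP[s0 s1]; elim: n => [|n /=]; first by rewrite /= lexx s1.
set t := sgn_iter n s => /andP[st t1].
have t0 : 0 < t := lt_le_trans s0 st.
apply/andP; split.
  apply: (le_trans st).
  have h : 0 <= t * (1 - t) * (1 + t) by apply: mulr_ge0; [apply: mulr_ge0|]; lra.
  by nra.
have h : 0 <= (1 - t) ^+ 2 * (2 + t) by rewrite mulr_ge0 ?sqr_ge0//; lra.
by nra.
Qed.

Lemma sgn_iter_rate n s : 0 < s <= 1 -> 1 - sgn_iter n s <= (1 - s / 2) ^+ n.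
Proof.
move=> s01; have /andP[s0 s1] := s01; elim: n => [|n /=].
  by rewrite expr0 /= lerBlDr lerDl ltW.
have := sgn_iter_pos n s01.
set t := sgn_iter n s => /andP[st t1] IH.
rewrite [leRHS]exprS; apply: (@le_trans _ _ ((1 - s / 2) * (1 - t))); last first.
  by apply: ler_wpM2l => //; lra.
have := mulr_ge0 (ltac:(lra) : 0 <= 1 - t) (ltac:(nra) : 0 <= t / 2 + t ^+ 2 / 2 - s / 2).
nra.
Qed.

Lemma sgn_iter_le1 n s : `|s| <= 1 -> `|sgn_iter n s| <= 1.
Proof.
move=> s1; have [s0|s0|s0] := ltgtP 0 s.
- have /andP[a b] : s <= sgn_iter n s <= 1 by apply: sgn_iter_pos; move: s1; rewrite gtr0_norm// s0.
  by rewrite ger0_norm// (le_trans (ltW s0)).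
- have /andP[a b] : - s <= sgn_iter n (- s) <= 1.
    by apply: sgn_iter_pos; move: s1; rewrite ltr0_norm// oppr_gt0 s0.
  by rewrite -normrN -sgn_iterN ger0_norm// (le_trans _ a)// oppr_ge0 ltW.
- by rewrite -s0 sgn_iter0 normr0.
Qed.

Lemma sgn_iter_cvg s : `|s| <= 1 -> sgn_iter n s @[n --> \oo] --> Num.sg s.
Proof.
have pos r : 0 < r <= 1 -> sgn_iter n r @[n --> \oo] --> (1 : R).
  move=> r01; have /andP[r0 r1] := r01.
  apply: (@squeeze_cvgr _ _ _ _ (fun n => 1 - (1 - r / 2) ^+ n) (cst 1)); last 2 first.
  - rewrite -[X in _ --> X]subr0; apply: cvgB; first exact: cvg_cst.
    apply: cvg_expr; rewrite ger0_norm; lra.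
  - exact: cvg_cst.
  apply: nearW => n; have := sgn_iter_rate n r01; have /andP[_ ->] := sgn_iter_pos n r01.
  by rewrite andbT; lra.
move=> s1; have [s0|s0|<-] := ltgtP 0 s.
- by rewrite gtr0_sg//; apply: pos; rewrite s0 -(gtr0_norm s0).
- rewrite ltr0_sg// -[s]opprK.
  under eq_fun do rewrite sgn_iterN.
  by apply: cvgN; apply: pos; rewrite oppr_gt0 s0 -(ltr0_norm s0).
- by rewrite sgr0; under eq_fun do rewrite sgn_iter0; exact: cvg_cst.
Qed.

End sign.

Section trigclass.
Context d (T : measurableType d) (R : realType) (P : probability T R).
Implicit Types (f g X Y Z : T -> R) (A B : set T) (V : (T -> R) -> Prop).
Notation Ex := (Ex P).
Notation intg := (intg P).
Notation pr := (pr P).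

Lemma Ex_lim (f_ : nat -> T -> R) f (C : R) : (forall n, measurable_fun setT (f_ n)) ->
  (forall n w, `|f_ n w| <= C) -> (forall w, f_ n w @[n --> \oo] --> f w) ->
  [/\ measurable_fun setT f, forall w, `|f w| <= C & Ex (f_ n) @[n --> \oo] --> Ex f].
Proof.
move=> mf fC ff.
have mf' : measurable_fun setT f by exact: (measurable_fun_cvg (fun n => mf n) (fun w _ => ff w)).
have fC' w : `|f w| <= C.
  by apply: (ler_cvg_to (cvg_norm (ff w)) (cvg_cst C)); exact: nearW.
split => //.
have [|||||_ _ H] := @dominated_convergence _ _ _ P _ measurableT
    (fun n w => (f_ n w)%:E) (EFin \o f) (EFin \o (fun=> C)).
- by move=> n; exact/measurable_EFinP.
- exact/measurable_EFinP.
- by apply: aeW => w _; apply: cvg_EFin; [exact: nearW|exact: ff].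
- exact: intg_cst.
- by apply: aeW => w n _ /=; rewrite lee_fin.
- apply: fine_cvg; rewrite /Ex /Rintegral fineK; first exact: H.
  by apply: integrable_fin_num => //; exact: (@intg_bounded _ _ _ P f C mf' fC').
Qed.

(** The algebra of bounded functions generated by the cosines of the elements
    of [V] under bounded pointwise limits. It contains the indicators of
    half-spaces, and a multiplicativity property of expectations extends to it
    from the generators; it thus plays the role of a monotone class. *)
Inductive trigcl V : (T -> R) -> Prop :=
| TcCos Y b : V Y -> trigcl V (fun w => cos (Y w + b))
| TcAdd f g : trigcl V f -> trigcl V g -> trigcl V (fun w => f w + g w)
| TcScale k f : trigcl V f -> trigcl V (fun w => k * f w)
| TcLim (f_ : nat -> T -> R) f (C : R) : (forall n, trigcl V (f_ n)) ->
    (forall n w, `|f_ n w| <= C) -> (forall w, f_ n w @[n --> \oo] --> f w) ->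
    trigcl V f.

Definition linspace V := [/\ V (fun=> 0),
  forall X Y, V X -> V Y -> V (fun w => X w + Y w) & forall k X, V X -> V (fun w => k * X w)].

Section closure.
Variable V : (T -> R) -> Prop.
Hypothesis mV : forall Y, V Y -> measurable_fun setT Y.

Lemma trigcl_bdd f : trigcl V f -> measurable_fun setT f /\ exists C, forall w, `|f w| <= C.
Proof.
elim=> {f}[Y b VY|f g _ [mf [C fC]] _ [mg [D gD]]|k f _ [mf [C fC]]|f_ f C _ IH fC ff].
- by split; [exact/measurable_cosD/mV|exists 1 => w; exact: cos_max].
- split; [exact: measurable_funD|exists (C + D) => w].
  by rewrite (le_trans (ler_normD _ _))// lerD.
- split; [exact: measurable_funM|exists (`|k| * C) => w].
  by rewrite normrM ler_wpM2l.
- by have [] := Ex_lim (fun n => (IH n).1) fC ff; split => //; exists C.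
Qed.

Hypothesis linV : linspace V.

Lemma trigcl_cst (k : R) : trigcl V (fun=> k).
Proof.
have [V0 _ _] := linV.
have := TcScale k (TcCos 0 V0).
by under eq_fun do rewrite addr0 cos0 mulr1.
Qed.

(** On generators this is the formula for a product of two cosines, which uses
    that [V] is stable under sums and differences. *)
Lemma trigclM f g : trigcl V f -> trigcl V g -> trigcl V (fun w => f w * g w).
Proof.
have [V0 VD VZ] := linV.
move=> hf; elim: hf g => {f}[Y b VY|f f' _ IH _ IH'|k f _ IH|f_ f C hf_ IH fC ff] g hg.
- elim: hg => {g}[Z c VZ'|g g' _ IH _ IH'|k g _ IH|g_ g C hg IH gC gg].
  + have VNZ : V (fun w => -1 * Z w) by exact: VZ.
    have := TcScale (2^-1) (TcAdd (TcCos (b + c) (VD _ _ VY VZ')) (TcCos (b - c) (VD _ _ VY VNZ))).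
    congr trigcl; apply/funext => w.
    have -> : Y w + Z w + (b + c) = (Y w + b) + (Z w + c) by ring.
    have -> : Y w + -1 * Z w + (b - c) = (Y w + b) - (Z w + c) by ring.
    by rewrite cosD cosB; field.
  + by under eq_fun do rewrite mulrDr; exact: TcAdd.
  + by under eq_fun do rewrite mulrCA; exact: TcScale.
  + apply: (TcLim (f_ := fun n w => cos (Y w + b) * g_ n w) (C := C)) => //.
      by move=> n w; rewrite normrM (le_trans _ (gC n w))// ler_piMl// cos_max.
    by move=> w; apply: cvgMr; exact: gg.
- by under eq_fun do rewrite mulrDl; apply: TcAdd; [exact: IH|exact: IH'].
- by under eq_fun do rewrite -mulrA; apply: TcScale; exact: IH.
- have [_ [D gD]] := trigcl_bdd hg.
  apply: (TcLim (f_ := fun n w => f_ n w * g w) (C := C * D)); first by move=> n; exact: IH.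
    by move=> n w; rewrite normrM ler_pM.
  by move=> w; apply: cvgMl; exact: ff.
Qed.

Lemma trigcl_sgn_iter n f : trigcl V f -> trigcl V (fun w => sgn_iter n (f w)).
Proof.
move=> hf; elim: n => [|n IH]; first by [].
have h3 := TcScale (-1) (trigclM IH (trigclM IH IH)).
have := TcScale (2^-1) (TcAdd (TcScale 3 IH) h3).
by congr trigcl; apply/funext => w /=; field.
Qed.

(** The argument of [sin ((Y - a) / k.+1)] eventually lies in [[- 1, 1]], where the
    sine has the sign of its argument; that sign is in turn a limit of the
    [sgn_iter]. *)
Lemma trigcl_sg Y (a : R) : V Y -> trigcl V (fun w => Num.sg (Y w - a)).
Proof.
have [V0 VD VZ] := linV.
move=> VY.
apply: (TcLim (f_ := fun k w => Num.sg (sin ((Y w - a) / k.+1%:R))) (C := 1)).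
- move=> k.
  apply: (TcLim (f_ := fun n w => sgn_iter n (sin ((Y w - a) / k.+1%:R))) (C := 1)).
  + move=> n; apply: trigcl_sgn_iter.
    have := TcCos (- a / k.+1%:R - pi / 2) (VZ (k.+1%:R^-1) _ VY).
    congr trigcl; apply/funext => w.
    by rewrite addrA -cosBpihalf; congr (cos (_ - _)); field; rewrite addrC natr1 pnatr_eq0.
  + by move=> n w; apply: sgn_iter_le1; exact: sin_max.
  + by move=> w; apply: sgn_iter_cvg; exact: sin_max.
- by move=> n w; rewrite normr_sg; case: (_ != 0).
- move=> w; apply: cvg_near_cst.
  have [x0|x0|x0] := ltgtP (Y w - a) 0; last first.
  + by apply: nearW => k; rewrite x0 mul0r sin0.
  + near=> k; rewrite (gtr0_sg x0) gtr0_sg//; apply: sin_gt0_pi.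
    have kx : Y w - a <= k.+1%:R.
      rewrite -natr1 (@le_trans _ _ k%:R) ?lerDl//; near: k; exact: nbhs_infty_ger.
    rewrite divr_gt0//= (@le_lt_trans _ _ 1)// ?ler_pdivrMr ?mul1r//.
    by rewrite (lt_le_trans _ (pi_ge2 R))// ltr1n.
  + near=> k; rewrite (ltr0_sg x0) ltr0_sg//.
    rewrite -oppr_gt0 -sinN -mulNr; apply: sin_gt0_pi.
    have kx : - (Y w - a) <= k.+1%:R.
      rewrite -natr1 (@le_trans _ _ k%:R) ?lerDl//; near: k; exact: nbhs_infty_ger.
    rewrite divr_gt0 ?oppr_gt0//= (@le_lt_trans _ _ 1)// ?ler_pdivrMr ?mul1r//.
    by rewrite (lt_le_trans _ (pi_ge2 R))// ltr1n.
Unshelve. all: by end_near. Qed.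

Definition tcevent A := trigcl V (\1_A).

Lemma tcevent_ge Y (a : R) : V Y -> tcevent [set w | a <= Y w].
Proof.
move=> /(trigcl_sg a) h.
(* with [s] the sign of [Y - a], the indicator is [1 + (s - s ^+ 2) / 2] *)
have := TcAdd (trigcl_cst 1) (TcScale (2^-1) (TcAdd h (TcScale (-1) (trigclM h h)))).
congr trigcl; apply/funext => w; rewrite indicE.
have [x0|x0|x0] := ltgtP (Y w) a.
- rewrite memNset /=; last by rewrite leNgt x0.
  by rewrite ltr0_sg ?subr_lt0//; field.
- rewrite mem_set /=; last exact: ltW.
  by rewrite gtr0_sg ?subr_gt0//; field.
- by rewrite mem_set /= x0 ?subrr ?sgr0//; field.
Qed.

Lemma tceventI A B : tcevent A -> tcevent B -> tcevent (A `&` B).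
Proof.
move=> hA hB; have := trigclM hA hB.
by congr trigcl; apply/funext => w; rewrite indicI.
Qed.

Lemma tcevent_abs Y (a : R) : V Y -> tcevent [set w | `|Y w| <= a].
Proof.
have [V0 VD VZ] := linV.
move=> VY; have := tceventI (tcevent_ge (- a) VY) (tcevent_ge (- a) (VZ (-1) _ VY)).
congr tcevent; apply/seteqP; split => w /=; rewrite ler_norml mulN1r lerN2.
  by move=> [-> ->].
by move/andP => [].
Qed.

Lemma tcevent_forall (I : finType) (A : I -> set T) :
  (forall i, tcevent (A i)) -> tcevent [set w | forall i, A i w].
Proof.
move=> hA.
have h (r : seq I) : tcevent [set w | forall i, i \in r -> A i w].
  elim: r => [|i r IH].
    have := trigcl_cst 1; congr trigcl; apply/funext => w.
    by rewrite indicE mem_set.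
  have := tceventI (hA i) IH; congr tcevent; apply/seteqP; split => w /=.
    by move=> [Ai Ar] j; rewrite inE => /orP[/eqP ->//|]; exact: Ar.
  by move=> H; split => [|j jr]; apply: H; rewrite inE ?eqxx// jr orbT.
have := h (enum I); congr tcevent; apply/seteqP; split => w /= H i //.
by apply: H; rewrite mem_enum.
Qed.

Lemma tcevent_meas A : tcevent A -> measurable A.
Proof.
move=> /trigcl_bdd[mA _].
have -> : A = (\1_A : T -> R) @^-1` [set 1].
  apply/seteqP; split => w /=; rewrite indicE; first by move=> Aw; rewrite mem_set.
  by case: (boolP (w \in A)) => [/set_mem//|_ /eqP]; rewrite eq_sym oner_eq0.
exact: measurable_set_rv.
Qed.

End closure.

Section independence.
Variables V W : (T -> R) -> Prop.
Hypothesis mV : forall Y, V Y -> measurable_fun setT Y.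
Hypothesis mW : forall Y, W Y -> measurable_fun setT Y.
Hypothesis VW : forall X Y b c, V X -> W Y ->
  Ex (fun w => cos (X w + b) * cos (Y w + c)) =
  Ex (fun w => cos (X w + b)) * Ex (fun w => cos (Y w + c)).

Let ig (U : (T -> R) -> Prop) f : (forall Y, U Y -> measurable_fun setT Y) -> trigcl U f -> intg f.
Proof. by move=> mU /(trigcl_bdd mU)[mf [C fC]]; exact: (intg_bounded P mf fC). Qed.

Let igM f g : trigcl V f -> trigcl W g -> intg (fun w => f w * g w).
Proof.
move=> /(trigcl_bdd mV)[mf [C fC]] /(trigcl_bdd mW)[mg [D gD]].
apply: (@intg_bounded _ _ _ P _ (C * D)); first exact: measurable_funM.
by move=> w; rewrite normrM ler_pM.
Qed.

(** For fixed [g] both sides are linear in [f] and continuous along bounded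
    pointwise limits, and likewise in [g]: the identity propagates from
    cosines by a double induction. *)
Lemma trigcl_indep f g : trigcl V f -> trigcl W g ->
  Ex (fun w => f w * g w) = Ex f * Ex g.
Proof.
move=> hf; elim: hf g => {f}[Y b VY|f f' hf IH hf' IH'|k f hf IH|f_ f C hf_ IH fC ff] g hg.
- have hc := TcCos b VY.
  elim: hg => {g}[Z c VZ'|g g' hg IH hg' IH'|k g hg IH|g_ g C hg IH gC gg].
  + exact: VW.
  + under eq_fun do rewrite mulrDr.
    by rewrite (ExD (igM hc hg) (igM hc hg')) IH IH' (ExD (ig mW hg) (ig mW hg')) mulrDr.
  + under eq_fun do rewrite mulrCA.
    by rewrite (ExZ k (igM hc hg)) IH (ExZ k (ig mW hg)) mulrCA.
  + have [_ _ h1] := Ex_lim (fun n => (trigcl_bdd mW (hg n)).1) gC gg.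
    have [|||_ _ h2] := @Ex_lim (fun n w => cos (Y w + b) * g_ n w) (fun w => cos (Y w + b) * g w) C.
    * by move=> n; apply: measurable_funM; [exact: (trigcl_bdd mV hc).1|exact: (trigcl_bdd mW (hg n)).1].
    * by move=> n w; rewrite normrM (le_trans _ (gC n w))// ler_piMl// cos_max.
    * by move=> w; apply: cvgMr; exact: gg.
    move: h2; under eq_fun do rewrite IH; move=> h2.
    by apply: (cvg_unique (@Rhausdorff R) h2); apply: cvgMr; exact: h1.
- under eq_fun do rewrite mulrDl.
  by rewrite (ExD (igM hf hg) (igM hf' hg)) IH// IH'// (ExD (ig mV hf) (ig mV hf')) mulrDl.
- under eq_fun do rewrite -mulrA.
  by rewrite (ExZ k (igM hf hg)) IH// (ExZ k (ig mV hf)) mulrA.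
- have [_ [D gD]] := trigcl_bdd mW hg.
  have [_ _ h1] := Ex_lim (fun n => (trigcl_bdd mV (hf_ n)).1) fC ff.
  have [|||_ _ h2] := @Ex_lim (fun n w => f_ n w * g w) (fun w => f w * g w) (C * D).
  + by move=> n; apply: measurable_funM; [exact: (trigcl_bdd mV (hf_ n)).1|exact: (trigcl_bdd mW hg).1].
  + by move=> n w; rewrite normrM ler_pM.
  + by move=> w; apply: cvgMl; exact: ff.
  move: h2; under eq_fun do rewrite IH//; move=> h2.
  by apply: (cvg_unique (@Rhausdorff R) h2); apply: cvgMl; exact: h1.
Qed.

Lemma tcevent_indep A B : tcevent V A -> tcevent W B -> pr (A `&` B) = pr A * pr B.
Proof.
move=> hA hB; have mA := tcevent_meas mV hA; have mB := tcevent_meas mW hB.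
rewrite !prE//; last exact: measurableI.
by rewrite indicI; exact: trigcl_indep.
Qed.

End independence.
End trigclass.

(** * Gaussian spaces: shifts and projections *)

Section gspace.
Context d (T : measurableType d) (R : realType) (P : probability T R).
Implicit Types (f g X Y Z : T -> R) (A B : set T).
Notation Ex := (Ex P).
Notation intg := (intg P).
Notation pr := (pr P).
Notation cgauss := (cgauss P).
Notation varX := (varX P).

Record gspace (H : (T -> R) -> Prop) : Prop := GSpace {
  gspace_lin : linspace H;
  gspace_gauss : forall X, H X -> cgauss X }.

Variable H : (T -> R) -> Prop.
Hypothesis gH : gspace H.

Lemma gspace0 : H (fun=> 0). Proof. by case: gH => [[]]. Qed.
Lemma gspaceD X Y : H X -> H Y -> H (fun w => X w + Y w).
Proof. by case: gH => [[_ h _] _]; exact: h. Qed.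
Lemma gspaceZ k X : H X -> H (fun w => k * X w).
Proof. by case: gH => [[_ _ h] _]; exact: h. Qed.
Lemma gspaceB X Y : H X -> H Y -> H (fun w => X w - Y w).
Proof.
move=> hX hY; have := gspaceD hX (gspaceZ (-1) hY).
by congr H; apply/funext => w; rewrite mulN1r.
Qed.
Lemma gspace_sum (I : Type) (r : seq I) (F : I -> T -> R) :
  (forall i, H (F i)) -> H (fun w => \sum_(i <- r) F i w).
Proof.
move=> hF; elim: r => [|i r IH].
  by under eq_fun do rewrite big_nil; exact: gspace0.
by under eq_fun do rewrite big_cons; exact: gspaceD.
Qed.
Lemma gspace_lcomb (I : Type) (r : seq I) (c : I -> R) (F : I -> T -> R) :
  (forall i, H (F i)) -> H (fun w => \sum_(i <- r) c i * F i w).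
Proof. by move=> hF; apply: gspace_sum => i; exact: gspaceZ. Qed.
Lemma gspace_meas X : H X -> measurable_fun setT X.
Proof. by move=> /(gspace_gauss gH)[]. Qed.
Hint Resolve gspace0 : core.

Definition cov X Y := Ex (fun w => X w * Y w).

Lemma cov_intg X Y : H X -> H Y -> intg (fun w => X w * Y w).
Proof.
move=> hX hY.
apply: (@intg_le _ _ _ P _ (fun w => X w ^+ 2 + Y w ^+ 2)).
- by apply: measurable_funM; exact: gspace_meas.
- move=> w; rewrite ler_norml.
  by have := sqr_ge0 (X w + Y w); have := sqr_ge0 (X w - Y w);
    have := sqr_ge0 (X w); have := sqr_ge0 (Y w); nra.
- by apply: intgD; apply: cgauss_intg_sqr; exact: (gspace_gauss gH).
Qed.

Lemma covC X Y : cov X Y = cov Y X.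
Proof. by rewrite /cov; under eq_fun do rewrite mulrC. Qed.

Lemma varXE X : varX X = cov X X.
Proof. by rewrite /cov /varX; under eq_fun do rewrite expr2. Qed.

Lemma covDl X Y Z : H X -> H Y -> H Z -> cov (fun w => X w + Y w) Z = cov X Z + cov Y Z.
Proof.
move=> hX hY hZ; rewrite /cov -ExD; [|exact: cov_intg|exact: cov_intg].
by under eq_fun do rewrite mulrDl.
Qed.

Lemma covZl k X Z : H X -> H Z -> cov (fun w => k * X w) Z = k * cov X Z.
Proof.
move=> hX hZ; rewrite /cov -ExZ; last exact: cov_intg.
by under eq_fun do rewrite -mulrA.
Qed.

Lemma covDr X Y Z : H X -> H Y -> H Z -> cov Z (fun w => X w + Y w) = cov Z X + cov Z Y.
Proof. by move=> *; rewrite covC covDl// !(covC _ Z). Qed.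

Lemma covZr k X Z : H X -> H Z -> cov Z (fun w => k * X w) = k * cov Z X.
Proof. by move=> *; rewrite covC covZl// covC. Qed.

Lemma cov_suml (I : Type) (r : seq I) (c : I -> R) (F : I -> T -> R) Z :
  (forall i, H (F i)) -> H Z ->
  cov (fun w => \sum_(i <- r) c i * F i w) Z = \sum_(i <- r) c i * cov (F i) Z.
Proof.
move=> hF hZ; elim: r => [|i r IH].
  under eq_fun do rewrite big_nil; rewrite big_nil /cov.
  by under eq_fun do rewrite mul0r; rewrite Ex_cst.
under eq_fun do rewrite big_cons.
by rewrite covDl ?covZl ?IH ?big_cons//; [exact: gspaceZ|exact: gspace_lcomb].
Qed.

Lemma varX_lcomb (I : Type) (r : seq I) (c : I -> R) (F : I -> T -> R) :
  (forall i, H (F i)) ->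
  varX (fun w => \sum_(i <- r) c i * F i w) =
  \sum_(i <- r) \sum_(j <- r) c i * c j * cov (F i) (F j).
Proof.
move=> hF; rewrite varXE cov_suml//; last exact: gspace_lcomb.
apply: eq_bigr => i _; rewrite covC cov_suml// mulr_sumr; apply: eq_bigr => j _.
by rewrite mulrA covC.
Qed.

Lemma varXDZ k X Y : H X -> H Y ->
  varX (fun w => X w + k * Y w) = varX X + 2 * k * cov X Y + k ^+ 2 * varX Y.
Proof.
move=> hX hY; have hkY := gspaceZ k hY; have hS := gspaceD hX hkY.
rewrite !varXE covDl// !covDr// covZl// covZr// !covZr// covZl// (covC Y X); ring.
Qed.

Lemma varXZ k X : H X -> varX (fun w => k * X w) = k ^+ 2 * varX X.
Proof.
move=> hX; have hkX := gspaceZ k hX.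
by rewrite (varXE (fun w => k * X w)) covZl// covZr// -varXE mulrA.
Qed.

Lemma varXB_le X Y : H X -> H Y -> varX (fun w => X w - Y w) <= 2 * varX X + 2 * varX Y.
Proof.
move=> hX hY; have -> : (fun w => X w - Y w) = (fun w => X w + (-1) * Y w).
  by apply/funext => w; rewrite mulN1r.
have := varX_ge0 P (fun w => X w + 1 * Y w); rewrite !varXDZ//; lra.
Qed.

Lemma cov_sqr_le X Y : H X -> H Y -> cov X Y ^+ 2 <= varX X * varX Y.
Proof.
move=> hX hY.
have h k : 0 <= varX X + 2 * k * cov X Y + k ^+ 2 * varX Y.
  by rewrite -varXDZ// varX_ge0.
have vY := varX_ge0 P Y.
have [v0|v0] := eqVneq (varX Y) 0.
  rewrite v0 mulr0; apply: contraT; rewrite -ltNge => c0.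
  have cn0 : cov X Y != 0 by rewrite -sqrf_eq0 gt_eqF.
  have := h (- (varX X + 1) / (2 * cov X Y)); rewrite v0 mulr0 addr0.
  have -> : 2 * (- (varX X + 1) / (2 * cov X Y)) * cov X Y = - (varX X + 1) by field.
  by lra.
have vY0 : 0 < varX Y by rewrite lt_neqAle eq_sym v0.
have := h (- cov X Y / varX Y).
have -> : varX X + 2 * (- cov X Y / varX Y) * cov X Y + (- cov X Y / varX Y) ^+ 2 * varX Y
  = (varX X * varX Y - cov X Y ^+ 2) / varX Y by field.
by rewrite pmulr_lge0 ?invr_gt0// subr_ge0.
Qed.

Definition line X := fun Y : T -> R => exists k : R, Y = (fun w => k * X w).
Definition orth X := fun Z : T -> R => H Z /\ cov X Z = 0.

Lemma line_lin X : linspace (line X).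
Proof.
split; first by exists 0; apply/funext => w; rewrite mul0r.
- by move=> _ _ [k ->] [l ->]; exists (k + l); apply/funext => w; rewrite mulrDl.
- by move=> k _ [l ->]; exists (k * l); apply/funext => w; rewrite mulrA.
Qed.

Lemma line_self X : line X X.
Proof. by exists 1; apply/funext => w; rewrite mul1r. Qed.

Lemma orth_lin X : H X -> linspace (orth X).
Proof.
move=> hX; split.
- by split => //; rewrite /cov; under eq_fun do rewrite mulr0; rewrite Ex_cst.
- move=> Y Z [hY cY] [hZ cZ]; split; first exact: gspaceD.
  by rewrite covDr// cY cZ addr0.
- by move=> k Y [hY cY]; split; [exact: gspaceZ|rewrite covZr// cY mulr0].
Qed.

Lemma line_meas X : H X -> forall Y, line X Y -> measurable_fun setT Y.
Proof. by move=> hX _ [k ->]; apply: measurable_funM => //; exact: gspace_meas. Qed.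

Lemma orth_meas X : forall Y, orth X Y -> measurable_fun setT Y.
Proof. by move=> Y [hY _]; exact: gspace_meas. Qed.

(** By [tcevent_indep] only cosines matter. The product of two of them is a half
    sum of cosines of [Y + Z] and [Y - Z], which are Gaussian with variance
    [varX Y + varX Z]; so the characteristic function factors. *)
Lemma uncorrelated_indep X A B : H X ->
  tcevent (line X) A -> tcevent (orth X) B -> pr (A `&` B) = pr A * pr B.
Proof.
move=> hX; apply: tcevent_indep; [exact: line_meas|exact: orth_meas|].
move=> Y0 Z b c [k ->] [hZ cZ] {Y0}.
set Y := (fun w => k * X w).
have hY : H Y by exact: gspaceZ.
have cYZ : cov Y Z = 0 by rewrite covZl// cZ mulr0.
have gg := gspace_gauss gH.
have E1 : (fun w => cos (Y w + b) * cos (Z w + c)) =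
    (fun w => 2^-1 * (cos ((Y w + 1 * Z w) + (b + c)) + cos ((Y w + -1 * Z w) + (b - c)))).
  apply/funext => w.
  have -> : Y w + 1 * Z w + (b + c) = (Y w + b) + (Z w + c) by ring.
  have -> : Y w + -1 * Z w + (b - c) = (Y w + b) - (Z w + c) by ring.
  by rewrite (cosD (Y w + b)) (cosB (Y w + b)); field.
have hp k' : H (fun w => Y w + k' * Z w) by apply: gspaceD => //; exact: gspaceZ.
have ic k' b' : intg (fun w => cos (Y w + k' * Z w + b')).
  apply: (@intg_bounded _ _ _ P _ 1); last by move=> w; exact: cos_max.
  by apply: measurable_cosD; exact: gspace_meas.
rewrite E1 ExZ; last by apply: intgD; exact: ic.
rewrite ExD//; do 4 (rewrite cgauss_cos; last exact: gg).
rewrite !varXDZ// cYZ !mulr0 !addr0 expr1n sqrrN expr1n !mul1r mulrDl opprD expRD.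
by rewrite cosD cosB; field.
Qed.

(** A Cameron-Martin shift carried out by conditioning. Write
    [f i = fp i + h i / varX X * X] with [h i = cov X (f i)] and [fp] independent
    of [X]. Where [X <= b * s], the bound [y i - h i <= f i] forces
    [y i - (1 + b / s) * h i <= fp i]; the latter event, intersected with the
    independent event [(b + s) * s <= X], forces [y i <= f i]. *)
Lemma shift_lower (I : finType) (f : I -> T -> R) X (y : I -> R) (b : R) :
  (forall i, H (f i)) -> H X -> 0 < varX X -> (forall i, 0 <= cov X (f i)) -> 0 <= b ->
  forall s, s = Num.sqrt (varX X) ->
  (pr [set w | forall i, y i - cov X (f i) <= f i w] - pr [set w | b * s <= X w]) *
    pr [set w | (b + s) * s <= X w] <= pr [set w | forall i, y i <= f i w].
Proof.
move=> hf hX v0 h0 b0 s sE.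
have s0 : 0 < s by rewrite sE sqrtr_gt0.
have s2 : s * s = varX X by rewrite sE -expr2 sqr_sqrtr// ltW.
pose h i := cov X (f i).
pose fp i w := f i w - h i / varX X * X w.
have ofp i : orth X (fp i).
  have hk := gspaceZ (h i / varX X) hX.
  split; first exact: gspaceB.
  rewrite /fp (_ : (fun w => _) = (fun w => f i w + -1 * (h i / varX X * X w))); last first.
    by apply/funext => w; rewrite mulN1r.
  rewrite covDr//; last exact: gspaceZ.
  by rewrite !covZr// -varXE divfK ?gt_eqF// mulN1r subrr.
have olin := orth_lin hX; have oms := @orth_meas X.
have llin := line_lin X; have lms := line_meas hX.
pose E1 := [set w | forall i, y i - (1 + b / s) * h i <= fp i w].
have tE1 : tcevent (orth X) E1.
  by apply: tcevent_forall => // i; exact: tcevent_ge.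
have tX c : tcevent (line X) [set w | c <= X w].
  by apply: tcevent_ge => //; exact: line_self.
have mE1 := tcevent_meas P oms tE1.
have mX c := tcevent_meas P lms (tX c).
have mf (z : I -> R) : measurable [set w | forall i, z i <= f i w].
  have Hm Y : H Y -> measurable_fun setT Y by exact: gspace_meas.
  apply: (tcevent_meas P Hm); have := gspace_lin gH => HL.
  by apply: tcevent_forall => // i; exact: tcevent_ge.
apply: (@le_trans _ _ (pr E1 * pr [set w | (b + s) * s <= X w])).
  rewrite ler_wpM2r ?pr_ge0// lerBlDr; apply: le_prU => // w /= Hw.
  case: (leP (b * s) (X w)) => Xw; [by right|left => i].
  have := Hw i; rewrite -/(h i) /fp => Hi.
  have : h i / varX X * X w <= h i / varX X * (b * s).
    by rewrite ler_wpM2l ?(ltW Xw)// divr_ge0 ?h0// ltW.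
  have -> : h i / varX X * (b * s) = b / s * h i by rewrite -s2; field; rewrite gt_eqF.
  by move: Hi; set z := h i / varX X * X w; set z' := b / s; nra.
rewrite mulrC -(uncorrelated_indep hX (tX _) tE1); apply: le_pr => //; first exact: measurableI.
move=> w /= [Xw Ew] i.
have := Ew i; rewrite /fp => Hi.
have : h i / varX X * ((b + s) * s) <= h i / varX X * X w.
  by rewrite ler_wpM2l// divr_ge0 ?h0// ltW.
have -> : h i / varX X * ((b + s) * s) = (1 + b / s) * h i.
  by rewrite -s2; field; rewrite gt_eqF.
by move: Hi; set z := h i / varX X * X w; lra.
Qed.

(** When [varX Y = 0] the coefficient is 0 since inverses of 0 are 0, and
    [perp Y Z = Z] is still orthogonal to [Y]. *)
Definition perp Y Z := fun w => Z w - cov Z Y / varX Y * Y w.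

Lemma perp_in Y Z : H Y -> H Z -> H (perp Y Z).
Proof. by move=> hY hZ; apply: gspaceB => //; exact: gspaceZ. Qed.

Lemma perpE Y Z : perp Y Z = (fun w => Z w + (- (cov Z Y / varX Y)) * Y w).
Proof. by apply/funext => w; rewrite mulNr. Qed.

Lemma cov0_var0 Y Z : H Y -> H Z -> varX Y = 0 -> cov Z Y = 0.
Proof.
move=> hY hZ v0; apply/eqP; rewrite -sqrf_eq0 eq_le sqr_ge0 andbT.
by have := cov_sqr_le hZ hY; rewrite v0 mulr0.
Qed.

Lemma perp_orth Y Z : H Y -> H Z -> orth Y (perp Y Z).
Proof.
move=> hY hZ; split; first exact: perp_in.
rewrite perpE covDr//; last exact: gspaceZ.
rewrite covZr// -varXE; have [v0|v0] := eqVneq (varX Y) 0.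
  by rewrite v0 mulr0 addr0 covC cov0_var0.
by rewrite mulNr divfK// covC subrr.
Qed.

Lemma varX_perp_le Y Z b : H Y -> H Z ->
  varX (perp Y Z) <= varX (fun w => Z w + b * Y w).
Proof.
move=> hY hZ; rewrite perpE !varXDZ//.
have [v0|v0] := eqVneq (varX Y) 0; first by rewrite v0 cov0_var0// !mulr0.
have vY : 0 < varX Y by rewrite lt_neqAle eq_sym v0 varX_ge0.
have : 0 <= (b * varX Y + cov Z Y) ^+ 2 / varX Y by rewrite divr_ge0 ?sqr_ge0// ltW.
have -> : (b * varX Y + cov Z Y) ^+ 2 / varX Y =
  b ^+ 2 * varX Y + 2 * b * cov Z Y + cov Z Y ^+ 2 / varX Y by field.
have -> : 2 * - (cov Z Y / varX Y) * cov Z Y = - (2 * (cov Z Y ^+ 2 / varX Y)) by field.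
have -> : (- (cov Z Y / varX Y)) ^+ 2 * varX Y = cov Z Y ^+ 2 / varX Y by field.
by lra.
Qed.

Fixpoint inspan (ys : seq (T -> R)) Z : Prop :=
  if ys is Y :: ys' then exists b Z', inspan ys' Z' /\ Z = (fun w => b * Y w + Z' w)
  else Z = (fun=> 0).

Lemma inspan0 (ys : seq (T -> R)) : inspan ys (fun=> 0).
Proof.
elim: ys => [//|Y ys IH] /=; exists 0, (fun=> 0); split=> //.
by apply/funext => w; rewrite mul0r addr0.
Qed.

Lemma inspanB (ys : seq (T -> R)) Z1 Z2 : inspan ys Z1 -> inspan ys Z2 ->
  inspan ys (fun w => Z1 w - Z2 w).
Proof.
elim: ys Z1 Z2 => [|Y ys IH] Z1 Z2 /=.
  by move=> -> ->; apply/funext => w; rewrite subrr.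
move=> [b1 [Y1 [h1 ->]]] [b2 [Y2 [h2 ->]]].
exists (b1 - b2), (fun w => Y1 w - Y2 w); split; first exact: IH.
by apply/funext => w; ring.
Qed.

Lemma perp_lin Y Z Z' k : H Y -> H Z -> H Z' ->
  perp Y (fun w => k * Z w + Z' w) = (fun w => k * perp Y Z w + perp Y Z' w).
Proof.
move=> hY hZ hZ'; apply/funext => w; rewrite /perp covDl//; last exact: gspaceZ.
by rewrite covZl//; ring.
Qed.

Lemma perp0 Y : H Y -> perp Y (fun=> 0) = (fun=> 0).
Proof.
move=> hY; apply/funext => w; rewrite /perp /cov.
by under eq_fun do rewrite mul0r; rewrite Ex_cst !mul0r subr0.
Qed.

Lemma inspan_H ys Z : (forall Y, List.In Y ys -> H Y) -> inspan ys Z -> H Z.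
Proof.
elim: ys Z => [|Y ys IH] Z hys /=; first by move=> ->.
move=> [b [Z' [hZ' ->]]]; apply: gspaceD; first by apply: gspaceZ; apply: hys; left.
by apply: IH hZ' => Y' hY'; apply: hys; right.
Qed.

Lemma inspan_perp Y ys Z : H Y -> (forall Y, List.In Y ys -> H Y) ->
  inspan ys Z -> inspan (map (perp Y) ys) (perp Y Z).
Proof.
move=> hY; elim: ys Z => [|Y' ys IH] Z hys /=; first by move=> ->; exact: perp0.
move=> [b [Z' [hZ' ->]]]; exists b, (perp Y Z'); split.
  by apply: IH => // Y'' h; apply: hys; right.
apply: perp_lin => //; first by apply: hys; left.
by apply: inspan_H hZ' => Y'' h; apply: hys; right.
Qed.

Lemma perp_lcomb (I : Type) (r : seq I) Y (c : I -> R) (g : I -> T -> R) : H Y -> (forall i, H (g i)) ->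
  perp Y (fun w => \sum_(i <- r) c i * g i w) = (fun w => \sum_(i <- r) c i * perp Y (g i) w).
Proof.
move=> hY hg; elim: r => [|i r IH].
  by under eq_fun do rewrite big_nil; rewrite perp0//; under [RHS]eq_fun do rewrite big_nil.
under eq_fun do rewrite big_cons.
rewrite perp_lin//; last exact: gspace_lcomb.
by apply/funext => w; rewrite big_cons IH.
Qed.

(** The elements of [ys] are projected out one after the other. When [Y] is
    within [x] standard deviations of 0, an event of probability at least
    [x / 3], its contribution to each [g i] is at most [x] because the
    correlation is at most 1; that event is independent of the residuals.
    The residuals [g'] have variances at most those of the distances to the
    span of [ys], which is how they are bounded afterwards. *)
Lemma small_ball_peel (I : finType) (ys : seq (T -> R)) (g : I -> T -> R) (x y : R) :
  (forall Y, List.In Y ys -> H Y) -> (forall i, H (g i)) -> (forall i, varX (g i) <= 1) ->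
  0 <= x <= 1 ->
  exists g' : I -> T -> R, [/\ forall i, H (g' i),
    forall (c : I -> R) Z, inspan ys Z ->
      varX (fun w => \sum_i c i * g' i w) <= varX (fun w => \sum_i c i * g i w + Z w) &
    (x / 3) ^+ size ys * pr [set w | forall i, `|g' i w| <= y] <=
      pr [set w | forall i, `|g i w| <= (size ys)%:R * x + y]].
Proof.
move=> + + + x01; have /andP[x0 x1] := x01.
move: {2}(size ys) (erefl (size ys)) => n; elim: n ys g => [|n IH] [|Y ys] g //= sz hys hg vg.
  exists g; split => //.
    by move=> c Z ->; under [in leRHS]eq_fun do rewrite addr0.
  by rewrite expr0 mul1r mul0r add0r.
have hY : H Y by apply: hys; left.
have hys' Y' : List.In Y' ys -> H Y' by move=> h; apply: hys; right.
have [||i||g' [hg' vg' pg']] := IH (map (perp Y) ys) (fun i => perp Y (g i)).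
- by rewrite size_map; case: sz.
- by move=> Y' /List.in_map_iff[Y'' [<- /hys' hY'']]; exact: perp_in.
- exact: perp_in.
- move=> i; apply: (le_trans _ (vg i)); have := varX_perp_le 0 hY (hg i).
  by under [in leRHS]eq_fun do rewrite mul0r addr0.
exists g'; split => //.
  move=> c Z [b [Z' [hZ' ->]]].
  apply: (le_trans (vg' c _ (inspan_perp hY hys' hZ'))).
  have hZH := inspan_H hys' hZ'.
  have hS : H (fun w => \sum_i c i * g i w) by exact: gspace_lcomb.
  have := varX_perp_le b hY (gspaceD (gspaceZ 1 hS) hZH).
  rewrite perp_lin// perp_lcomb//.
  under [in leLHS]eq_fun do rewrite mul1r.
  have -> : (fun w => \sum_i c i * g i w + (b * Y w + Z' w)) =
      (fun w => 1 * (\sum_i c i * g i w) + Z' w + b * Y w).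
    by apply/funext => w; ring.
  by [].
have olin := orth_lin hY; have oms := @orth_meas Y.
have llin := line_lin Y; have lms := line_meas hY.
pose A := [set w | `|Y w| <= x * Num.sqrt (varX Y)].
pose B := [set w | forall i, `|perp Y (g i) w| <= (size ys)%:R * x + y].
have tA : tcevent (line Y) A by apply: tcevent_abs => //; exact: line_self.
have tB : tcevent (orth Y) B.
  by apply: tcevent_forall => // i; apply: tcevent_abs => //; exact: perp_orth.
rewrite size_map in pg'.
apply: (@le_trans _ _ (pr A * pr B)).
  rewrite exprS -mulrA ler_pM// ?mulr_ge0 ?exprn_ge0 ?divr_ge0 ?pr_ge0//.
  by apply: cgauss_small => //; exact: (gspace_gauss gH).
rewrite -(uncorrelated_indep hY tA tB); apply: le_pr.
- by apply: measurableI; [exact: (tcevent_meas P lms tA)|exact: (tcevent_meas P oms tB)].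
- have Hm Y' : H Y' -> measurable_fun setT Y' by exact: gspace_meas.
  apply: (tcevent_meas P Hm); have := gspace_lin gH => HL.
  by apply: tcevent_forall => // i; exact: tcevent_abs.
move=> w /= [Aw Bw] i.
have -> : g i w = perp Y (g i) w + cov (g i) Y / varX Y * Y w by rewrite /perp; ring.
apply: (le_trans (ler_normD _ _)).
have -> : (size ys).+1%:R * x + y = ((size ys)%:R * x + y) + x by rewrite -natr1; ring.
apply: lerD; first exact: Bw.
rewrite normrM; have [v0|v0] := eqVneq (varX Y) 0.
  by rewrite v0 invr0 mulr0 normr0 mul0r.
have vY : 0 < varX Y by rewrite lt_neqAle eq_sym v0 varX_ge0.
set s := Num.sqrt (varX Y); have s0 : 0 < s by rewrite sqrtr_gt0.
have s2 : varX Y = s ^+ 2 by rewrite sqr_sqrtr// ltW.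
apply: (le_trans (ler_wpM2l (normr_ge0 _) Aw)).
rewrite normrM (gtr0_norm (_ : 0 < (varX Y)^-1)) ?invr_gt0// -/s s2.
have -> : `|cov (g i) Y| / s ^+ 2 * (x * s) = x * (`|cov (g i) Y| / s) by field; rewrite gt_eqF.
rewrite ler_piMr// ler_pdivrMr// mul1r -(@ler_pXn2r _ 2)// ?nnegrE// ?(ltW s0)//.
rewrite real_normK ?num_real// -s2.
by apply: (le_trans (cov_sqr_le (hg i) hY)); rewrite ler_piMl// ltW.
Qed.

End gspace.

(** * Elementary inequalities, quadratic duality and chaining *)

Section trig_bounds.
Context {R : realType}.
Implicit Types x y : R.

Lemma sin_lip x y : `|sin x - sin y| <= `|x - y|.
Proof.
wlog xy : x y / y <= x.
  by move=> h; case: (leP y x) => [/h//|/ltW/h]; rewrite distrC (distrC y).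
have [|c _ ->] := @MVT_segment R sin cos y x xy.
  by apply: continuous_subspaceT; exact: continuous_sin.
by rewrite normrM ler_piMl// cos_max.
Qed.

Lemma norm_sin_le x : `|sin x| <= `|x|.
Proof. by have := sin_lip x 0; rewrite sin0 !subr0. Qed.

Lemma cos_half x : cos x = 1 - 2 * sin (x / 2) ^+ 2.
Proof.
have {1}-> : x = x / 2 + x / 2 by field.
by rewrite cosD -!expr2; have := cos2Dsin2 (x / 2); lra.
Qed.

Lemma cos_lb x : 1 - x ^+ 2 / 2 <= cos x.
Proof.
have := norm_sin_le (x / 2); rewrite -(@ler_pXn2r _ 2)// ?nnegrE//.
rewrite !real_normK ?num_real// cos_half.
have -> : (x / 2) ^+ 2 = x ^+ 2 / 4 by field.
lra.
Qed.

Lemma cos_ge_half x : `|x| <= 1 -> 1 / 2 <= cos x.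
Proof.
move=> x1; apply: le_trans (cos_lb x).
have : x ^+ 2 <= 1 by rewrite -(real_normK (num_real x)) expr_le1.
lra.
Qed.

Lemma chord_le x y : (cos x - cos y) ^+ 2 + (sin x - sin y) ^+ 2 <= (x - y) ^+ 2.
Proof.
have := cos_lb (x - y); rewrite cosB.
have := cos2Dsin2 x; have := cos2Dsin2 y; nra.
Qed.

End trig_bounds.

Section exponential_bounds.
Context {R : realType}.

Lemma natr_le_expR (n : nat) : n%:R <= expR n%:R :> R.
Proof. by apply: le_trans (expR_ge1Dx _); rewrite lerDr. Qed.

Lemma expR_ge_sqr (x : R) : 0 <= x -> (x / 2) ^+ 2 <= expR x.
Proof.
move=> x0; have -> : x = x / 2 + x / 2 by field.
rewrite expRD -expr2 (_ : (x / 2 + x / 2) / 2 = x / 2); last by field.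
have h := @expR_ge1Dx R (x / 2).
by rewrite ler_pXn2r// ?nnegrE ?expR_ge0 ?divr_ge0//; lra.
Qed.

Lemma expR1_bounds : 2 <= expR 1 :> R /\ expR 1 <= 4 :> R.
Proof.
split; first by have := @expR_ge1Dx R 1; lra.
have -> : expR 1 = (expR (2^-1) : R) ^+ 2 by rewrite -expRM_natl; congr expR; field.
have h : expR (2^-1) <= 2 :> R.
  rewrite -[expR _]invrK -expRN -[2 in leRHS]invrK lef_pV2 ?posrE ?expR_gt0 ?invr_gt0//.
  by have := @expR_ge1Dx R (- 2^-1); lra.
have -> : 4 = 2 ^+ 2 :> R by ring.
by rewrite ler_pXn2r// ?nnegrE ?expR_ge0.
Qed.

Lemma pow2_le_expR (k : nat) : 2 ^+ k <= expR k%:R :> R.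
Proof.
have [e2 _] := expR1_bounds.
have -> : expR k%:R = expR 1 ^+ k :> R by rewrite -expRM_natl mulr1.
by rewrite lerXn2r ?nnegrE ?expR_ge0.
Qed.

End exponential_bounds.

Section duality.
Context {R : realType}.

(** The first order condition at a minimum of a quadratic function. *)
Lemma slope_ge0 (a b t0 : R) : 0 < t0 ->
  (forall t, 0 < t <= t0 -> 0 <= t * a + t ^+ 2 * b) -> 0 <= a.
Proof.
move=> t00 h; rewrite leNgt; apply/negP => a0.
pose t := Num.min t0 (- a / (2 * (`|b| + 1))).
have b0 : 0 < 2 * (`|b| + 1) by rewrite mulr_gt0// ltr_wpDl.
have tp : 0 < t by rewrite lt_min t00 divr_gt0// oppr_gt0.
have tt : t <= t0 by rewrite ge_min lexx.
have := h t; rewrite tp tt => /(_ isT).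
have : t * (2 * (`|b| + 1)) <= - a by rewrite -ler_pdivlMr// ge_min lexx orbT.
have := ler_norm b; have := normr_ge0 b; set c := `|b|.
have -> : t * a + t ^+ 2 * b = t * (a + t * b) by ring.
rewrite pmulr_rge0//; nra.
Qed.

Variables (n : nat) (C : 'I_n -> 'I_n -> R) (K : 'I_n -> R) (V : R).
Hypothesis Csym : forall i j, C i j = C j i.
Hypothesis K1 : forall i, 1 <= K i.
Let q (m : 'I_n -> R) := \sum_i \sum_j m i * m j * C i j.
Hypothesis qge : forall m : 'I_n -> R, (forall i, 0 <= m i) -> (\sum_i m i * K i) ^+ 2 <= V * q m.
Hypothesis V0 : 0 < V.

(** [m] minimises [q m / 2 - \sum_i m i * K i] over the box [[0, V + 1]].
    Shrinking [m] gives [q m <= \sum_i m i * K i], and then the hypothesis on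
    [q] bounds both by [V]. Hence no coordinate of [m] reaches [V + 1], each can
    be increased, and the first order condition for doing so is
    [K i <= \sum_j m j * C j i]. *)
Lemma quadratic_duality : exists m : 'I_n -> R,
  [/\ forall i, 0 <= m i, forall i, K i <= \sum_j m j * C j i & q m <= V].
Proof.
pose B := V + 1.
pose A := [set v : 'rV[R]_n | forall i, `[0, B]%classic (v ord0 i)].
pose J (v : 'rV[R]_n) := q (v ord0) / 2 - \sum_i v ord0 i * K i.
have cA : compact A := @rV_compact _ n (fun=> `[0, B]%classic) (fun=> @segment_compact R 0 B).
have B0 : 0 <= B by rewrite addr_ge0// ltW.
have A0 : A !=set0.
  by exists 0 => i /=; rewrite mxE in_itv /= lexx.
have cc (i : 'I_n) : continuous (fun v : 'rV[R]_n => v ord0 i) by exact: coord_continuous.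
have csum (I : Type) (r : seq I) (F : I -> 'rV[R]_n -> R) : (forall i, continuous (F i)) ->
    continuous (fun v => \sum_(i <- r) F i v).
  move=> h; elim: r => [|i r IH].
    rewrite (_ : (fun v => _) = cst 0); first exact: cst_continuous.
    by apply/funext => v; rewrite big_nil.
  rewrite (_ : (fun v => _) = (fun v => F i v + \sum_(i <- r) F i v)).
    by move=> v; have hi := h i v; have IHv := IH v; exact: (cvgD hi IHv).
  by apply/funext => v; rewrite big_cons.
have cq : continuous (fun v : 'rV[R]_n => q (v ord0)).
  apply: (csum _ _ _) => i; apply: (csum _ _ _) => j w.
  exact: (cvgM (cvgM (cc i w) (cc j w)) (cvg_cst (C i j))).
have cs : continuous (fun v : 'rV[R]_n => \sum_i v ord0 i * K i).
  by apply: (csum _ _ _) => i w; exact: (cvgM (cc i w) (cvg_cst (K i))).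
have cJ : continuous J.
  move=> v; have h1 := cq v; have h2 := cs v.
  have h3 : continuous_at v (fun v : 'rV[R]_n => q (v ord0) / 2).
    exact: (cvgM h1 (cvg_cst (2^-1 : R))).
  exact: (cvgB h3 h2).
have [c cAin cmin] := EVT_min_rV A0 cA (continuous_subspaceT cJ).
pose m := c ord0.
have mA i : 0 <= m i <= B by have := set_mem cAin i; rewrite /= in_itv.
have m0 i : 0 <= m i by case/andP: (mA i).
have Jmin (v : 'I_n -> R) : (forall i, 0 <= v i <= B) ->
    q m / 2 - \sum_i m i * K i <= q v / 2 - \sum_i v i * K i.
  move=> vA; have := cmin (\row_i v i).
  have -> : J (\row_i v i) = q v / 2 - \sum_i v i * K i.
    rewrite /J /q; congr (_ / 2 - _); last by apply: eq_bigr => i _; rewrite mxE.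
    by apply: eq_bigr => i _; apply: eq_bigr => j _; rewrite !mxE.
  by apply; apply: mem_set => i; rewrite /= mxE in_itv /= vA.
have qZ (k : R) : q (fun i => k * m i) = k ^+ 2 * q m.
  rewrite /q mulr_sumr; apply: eq_bigr => i _; rewrite mulr_sumr; apply: eq_bigr => j _; ring.
have qm : q m <= \sum_i m i * K i.
  rewrite -subr_ge0; apply: (@slope_ge0 _ (q m / 2) 1) => // t /andP[t0 t1].
  have := Jmin (fun i => (1 - t) * m i).
  have -> : \sum_i (1 - t) * m i * K i = (1 - t) * \sum_i m i * K i.
    by rewrite mulr_sumr; apply: eq_bigr => i _; rewrite mulrA.
  rewrite qZ => h.
  have : forall i, 0 <= (1 - t) * m i <= B.
    move=> i; have /andP[a b] := mA i.
    rewrite mulr_ge0 ?subr_ge0//= (le_trans _ b)// ler_piMl//; lra.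
  by move=> /h; nra.
have mK : \sum_i m i * K i <= V.
  have := qge m0; set s := \sum_i _ => h.
  have s0 : 0 <= s by apply: sumr_ge0 => i _; rewrite mulr_ge0// (le_trans _ (K1 i)).
  have : s * s <= V * s by rewrite -expr2 (le_trans h)// ler_wpM2l// ltW.
  by have [->|sn0] := eqVneq s 0; [move=> _; exact: ltW|rewrite ler_pM2r// lt_neqAle eq_sym sn0].
have mi i : m i < B.
  apply: (@le_lt_trans _ _ V); last by rewrite ltrDl.
  apply: le_trans mK; rewrite (bigD1 i)//=.
  apply: (@le_trans _ _ (m i * K i)); first by rewrite ler_peMr.
  by rewrite lerDl sumr_ge0// => j _; rewrite mulr_ge0// (le_trans _ (K1 j)).
exists m; split => //; last exact: le_trans qm mK.
move=> i; rewrite -subr_ge0.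
apply: (@slope_ge0 _ (C i i / 2) (B - m i)); first by rewrite subr_gt0.
move=> t /andP[t0 tB].
pose v j := m j + (j == i)%:R * t.
have := Jmin v.
have -> : \sum_j v j * K j = \sum_j m j * K j + t * K i.
  rewrite /v; under eq_bigr do rewrite mulrDl.
  rewrite big_split /=; congr (_ + _).
  rewrite (bigD1 i)//= eqxx mul1r big1 ?addr0// => j ji.
  by rewrite (negbTE ji) !mul0r.
have -> : q v = q m + 2 * t * (\sum_j m j * C j i) + t ^+ 2 * C i i.
  rewrite /q /v.
  have E j k : (m j + (j == i)%:R * t) * (m k + (k == i)%:R * t) * C j k =
     m j * m k * C j k + (k == i)%:R * (t * (m j * C j k)) + (j == i)%:R * (t * (m k * C k j))
     + (j == i)%:R * ((k == i)%:R * (t ^+ 2 * C j k)).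
    by rewrite (Csym k j); ring.
  have pick (F : 'I_n -> R) : \sum_k (k == i)%:R * F k = F i.
    rewrite (bigD1 i)//= eqxx mul1r big1 ?addr0// => k ki.
    by rewrite (negbTE ki) mul0r.
  under eq_bigr do (under eq_bigr do rewrite E).
  under eq_bigr do rewrite !big_split /= !pick -!mulr_sumr pick.
  rewrite !big_split /= !pick -!mulr_sumr; ring.
move=> h; have : forall j, 0 <= v j <= B.
  move=> j; rewrite /v; case: (eqVneq j i) => [->|_]; rewrite ?mul1r ?mul0r ?addr0.
    by rewrite addr_ge0 ?(ltW t0)//= -lerBrDl.
  by rewrite m0 /= ltW.
by move/h; lra.
Qed.

End duality.

Section chaining.
Context {R : realType}.

Lemma sqrD_weighted (u v S U r : R) : 0 <= S -> 0 <= U -> 0 < r -> u ^+ 2 <= S * U ->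
  (u + v) ^+ 2 <= (S + r) * (U + v ^+ 2 / r).
Proof.
move=> S0 U0 r0 uSU.
have -> : (S + r) * (U + v ^+ 2 / r) = S * U + (S * v ^+ 2 / r + r * U) + v ^+ 2.
  by field; rewrite gt_eqF.
set W := S * v ^+ 2 / r + r * U.
have W0 : 0 <= W.
  apply: addr_ge0; last by rewrite mulr_ge0 ?(ltW r0).
  by rewrite divr_ge0 ?(ltW r0)// mulr_ge0 ?sqr_ge0.
suff : 2 * (u * v) <= W by rewrite sqrrD -mulr_natl; lra.
apply: (le_trans (ler_norm _)); rewrite -(@ler_pXn2r _ 2)// ?nnegrE// real_normK ?num_real//.
have -> : W ^+ 2 = (S * v ^+ 2 / r - r * U) ^+ 2 + 4 * (S * U * v ^+ 2).
  by rewrite /W; field; rewrite gt_eqF.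
have -> : (2 * (u * v)) ^+ 2 = 4 * (u ^+ 2 * v ^+ 2) by ring.
apply: (@le_trans _ _ (4 * (S * U * v ^+ 2))); last by rewrite lerDr sqr_ge0.
by rewrite ler_pM2l// ler_wpM2r ?sqr_ge0.
Qed.

Definition dyadic_incr (g : nat -> R) (a m k : nat) : R :=
  g (k.+1 * 2 ^ (a - m))%N - g (k * 2 ^ (a - m))%N.

Definition dyadic_energy (g : nat -> R) (a m : nat) : R :=
  \sum_(k < 2 ^ m) dyadic_incr g a m k ^+ 2.

(** A dyadic point is reached from 0 by at most one increment at each scale;
    the Cauchy-Schwarz inequality with weights [r ^+ j] is applied one scale at
    a time through [sqrD_weighted]. *)
Lemma dyadic_chain (g : nat -> R) (a : nat) (r : R) m k : 0 < r -> (m <= a)%N -> (k <= 2 ^ m)%N ->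
  g (k * 2 ^ (a - m))%N ^+ 2 <=
  (1 + \sum_(j < m.+1) r ^+ j) * (g 0%N ^+ 2 + \sum_(j < m.+1) dyadic_energy g a j / r ^+ j).
Proof.
move=> r0; elim: m k => [|m IH] k ma km.
  rewrite !big_ord1 expr0 divr1 /dyadic_energy expn0 big_ord1 subn0.
  case: k km => [|[|//]] _; rewrite ?mul0n ?mul1n.
    by have := sqr_ge0 (g 0%N); have := sqr_ge0 (dyadic_incr g a 0 (@ord0 0)); nra.
  rewrite /dyadic_incr /= !subn0 mul0n mul1n.
  by have := sqr_ge0 (g 0%N + - (g (2 ^ a)%N - g 0%N)); nra.
have E0 j : 0 <= dyadic_energy g a j by apply: sumr_ge0 => i _; exact: sqr_ge0.
set S := 1 + \sum_(j < m.+1) r ^+ j; set U := g 0%N ^+ 2 + \sum_(j < m.+1) dyadic_energy g a j / r ^+ j.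
have S0 : 0 <= S by rewrite addr_ge0// sumr_ge0// => j _; rewrite exprn_ge0// ltW.
have U0 : 0 <= U.
  by rewrite addr_ge0 ?sqr_ge0// sumr_ge0// => j _; rewrite divr_ge0// exprn_ge0// ltW.
have rm : 0 < r ^+ m.+1 by rewrite exprn_gt0.
have E2 : (2 ^ (a - m) = 2 * 2 ^ (a - m.+1))%N by rewrite -expnS subnSK.
rewrite big_ord_recr /= [X in _ <= _ * (_ + X)]big_ord_recr /= !addrA -/S -/U.
have kE := odd_double_half k.
set k' := k./2 in kE.
have k'm : (k' <= 2 ^ m)%N by move: km; rewrite expnS; lia.
have IHk := IH k' (ltnW ma) k'm.
case: (boolP (odd k)) kE => kodd kE; last first.
  have -> : (k * 2 ^ (a - m.+1) = k' * 2 ^ (a - m))%N by rewrite E2 -kE; lia.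
  apply: (le_trans IHk); apply: ler_pM => //; first by rewrite lerDl ltW.
  by rewrite lerDl divr_ge0 ?E0// ltW.
have kl : ((2 * k') < 2 ^ m.+1)%N by move: km; rewrite expnS; lia.
have -> : g (k * 2 ^ (a - m.+1))%N = g (k' * 2 ^ (a - m))%N + dyadic_incr g a m.+1 (2 * k').
  rewrite /dyadic_incr (_ : (2 * k').+1 = k); last by lia.
  rewrite (_ : (2 * k' * 2 ^ (a - m.+1) = k' * 2 ^ (a - m))%N); last by rewrite E2; lia.
  by rewrite addrC subrK.
apply: (le_trans (sqrD_weighted _ S0 U0 rm IHk)).
apply: ler_wpM2l; first by rewrite addr_ge0// ltW.
rewrite lerD2l ler_wpM2r ?invr_ge0 ?(ltW rm)//.
rewrite /dyadic_energy (bigD1 (Ordinal kl))//= lerDl sumr_ge0// => j _; exact: sqr_ge0.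
Qed.

Lemma geom_sum_le (r : R) n : 0 <= r < 1 -> \sum_(j < n) r ^+ j <= (1 - r)^-1.
Proof.
move=> /andP[r0 r1]; have h : 0 < 1 - r by rewrite subr_gt0.
rewrite -(ler_pM2l h) divff ?gt_eqF//.
have -> : (1 - r) * \sum_(j < n) r ^+ j = 1 - r ^+ n.
  by rewrite -opprB mulNr -subrX1 opprB.
by rewrite lerBlDr lerDl exprn_ge0.
Qed.

End chaining.

Section chaining_rv.
Context d (T : measurableType d) (R : realType) (P : probability T R).
Variable H : (T -> R) -> Prop.
Hypothesis gH : gspace P H.

(** One integrable variable dominates the squares of all values on the grid,
    with a bound independent of the depth [a]: this uniformity lets the
    estimates on grids survive refinement. The ratio [r = 7 / 8] makes the
    weights summable while [3 / 4 / r = 6 / 7] is still less than 1. *)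
Lemma chaining (g : nat -> T -> R) (a : nat) (A : R) :
  (forall p, H (g p)) -> varX P (g 0%N) <= A ->
  (forall m k, (m <= a)%N -> (k < 2 ^ m)%N ->
    2 ^+ m * varX P (fun w => dyadic_incr (g ^~ w) a m k) <= A * (3 / 4) ^+ m) ->
  exists V : T -> R, [/\ intg P V, forall w, 0 <= V w,
    forall p w, (p <= 2 ^ a)%N -> g p w ^+ 2 <= V w & Ex P V <= 72 * A].
Proof.
move=> hg v0 vD; pose r : R := 7 / 8.
have r0 : 0 < r by rewrite divr_gt0.
have hD m k : H (fun w => dyadic_incr (g ^~ w) a m k) by exact: (gspaceB gH).
have isq X : H X -> intg P (fun w => X w ^+ 2).
  by move=> hX; apply: cgauss_intg_sqr; exact: (gspace_gauss gH).
have iE m : intg P (fun w => dyadic_energy (g ^~ w) a m).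
  by apply: intg_sum => k; exact: isq.
have iEr m : intg P (fun w => dyadic_energy (g ^~ w) a m / r ^+ m).
  by under eq_fun do rewrite mulrC; exact: intgZ.
pose U w := g 0%N w ^+ 2 + \sum_(j < a.+1) dyadic_energy (g ^~ w) a j / r ^+ j.
have iU : intg P U by apply: intgD; [exact: isq|apply: intg_sum => j; exact: iEr].
have U0 w : 0 <= U w.
  rewrite addr_ge0 ?sqr_ge0// sumr_ge0// => j _; rewrite divr_ge0 ?exprn_ge0 ?(ltW r0)//.
  by apply: sumr_ge0 => k _; exact: sqr_ge0.
have A0 : 0 <= A := le_trans (varX_ge0 P _) v0.
exists (fun w => 9 * U w); split.
- exact: intgZ.
- by move=> w; rewrite mulr_ge0.
- move=> p w pa; have := @dyadic_chain R (g ^~ w) a r a p r0 (leqnn a) pa.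
  rewrite subnn expn0 muln1 => h; apply: (le_trans h); rewrite ler_wpM2r ?U0//.
  have := @geom_sum_le R r a.+1; rewrite (ltW r0) /= /r => /(_ ltac:(lra)) h2.
  apply: (@le_trans _ _ (1 + (1 - 7 / 8)^-1)); first by rewrite lerD2l.
  by have -> : (1 - 7 / 8 : R)^-1 = 8 by field; lra.
rewrite ExZ// ExD; [|exact: isq|by apply: intg_sum => j; exact: iEr].
rewrite Ex_sum//.
have EE (j : 'I_a.+1) : Ex P (fun w => dyadic_energy (g ^~ w) a j / r ^+ j) <= A * (6 / 7) ^+ j.
  have -> : (fun w => dyadic_energy (g ^~ w) a j / r ^+ j) =
      (fun w => (r ^+ j)^-1 * dyadic_energy (g ^~ w) a j) by apply/funext => w; rewrite mulrC.
  rewrite ExZ// mulrC ler_pdivrMr ?exprn_gt0// -mulrA -exprMn.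
  rewrite (_ : 6 / 7 * r = 3 / 4); last by rewrite /r; field.
  rewrite /dyadic_energy Ex_sum; last by move=> k; exact: isq.
  have p2 : 0 < 2 ^+ j :> R by rewrite exprn_gt0.
  apply: (@le_trans _ _ (\sum_(k < 2 ^ j) (A * (3 / 4) ^+ j / 2 ^+ j))).
    apply: ler_sum => k _; rewrite ler_pdivlMr// mulrC; apply: vD => //.
    by rewrite -ltnS.
  rewrite sumr_const card_ord -[X in X <= _]mulr_natr natrX divfK// gt_eqF//.
apply: (@le_trans _ _ (9 * (A + A * 7))); last by lra.
rewrite ler_pM2l// lerD//.
apply: (le_trans (ler_sum _ (fun j _ => EE j))).
rewrite -mulr_sumr ler_wpM2l//.
have := @geom_sum_le R (6 / 7) a.+1 => /(_ ltac:(lra)) h.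
by apply: (le_trans h); have -> : (1 - 6 / 7 : R)^-1 = 7 by field; lra.
Qed.

End chaining_rv.

(** * A small ball estimate for nonnegative Gaussian vectors *)

Section expi_lemmas.
Context {R : realType}.
Implicit Types x y : R.

Lemma expiD x y : expi (x + y) = expi x * expi y.
Proof.
rewrite /expi cosD sinD; apply/eqP; rewrite eq_complex /=.
by apply/andP; split; apply/eqP; ring.
Qed.

Lemma expi0 : expi (0 : R) = 1.
Proof. by rewrite /expi cos0 sin0. Qed.

Lemma expi_sum (I : Type) (r : seq I) (F : I -> R) :
  expi (\sum_(i <- r) F i) = \prod_(i <- r) expi (F i).
Proof.
elim: r => [|i r IH]; first by rewrite !big_nil expi0.
by rewrite !big_cons expiD IH.
Qed.

Lemma complex_sum (I : Type) (r : seq I) (F : I -> R[i]) :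
  \sum_(i <- r) F i = ((\sum_(i <- r) complex.Re (F i)) +i* (\sum_(i <- r) complex.Im (F i)))%C.
Proof.
elim: r => [|i r IH]; first by rewrite !big_nil.
rewrite !big_cons IH; case: (F i) => a b /=.
by apply/eqP; rewrite eq_complex /= !eqxx.
Qed.

Lemma ReZ (k : R) (z : R[i]) : complex.Re (k%:C%C * z) = k * complex.Re z.
Proof. by case: z => a b /=; rewrite mul0r subr0. Qed.

(** Since the sine sums vanish, each factor equals the same sum of complex
    exponentials, for which the product can be expanded. *)
Lemma prod_trig_poly (N : nat) (I : finType) (c th : I -> R) (y : 'I_N -> R) :
  (forall y, \sum_p c p * sin (th p * y) = 0) ->
  \prod_j \sum_p c p * cos (th p * y j) =
  \sum_(f : {ffun 'I_N -> I}) (\prod_j c (f j)) * cos (\sum_j th (f j) * y j).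
Proof.
move=> s0.
have E j : (\sum_p c p * cos (th p * y j))%:C%C = \sum_p (c p)%:C%C * expi (th p * y j).
  rewrite complex_sum; apply/eqP; rewrite eq_complex /=; apply/andP; split; apply/eqP.
    by apply: eq_bigr => p _; rewrite mul0r subr0.
  by rewrite -[LHS](s0 (y j)); apply: eq_bigr => p _; rewrite mul0r addr0.
have -> : \prod_j \sum_p c p * cos (th p * y j) =
    complex.Re (\prod_j (\sum_p c p * cos (th p * y j))%:C%C) by rewrite -rmorph_prod.
under eq_bigr do rewrite E.
rewrite bigA_distr_bigA /= complex_sum /=; apply: eq_bigr => f _.
by rewrite big_split /= -rmorph_prod -expi_sum ReZ.
Qed.

End expi_lemmas.

Section small_ball.
Context d (T : measurableType d) (R : realType) (P : probability T R).
Variable H : (T -> R) -> Prop.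
Hypothesis gH : gspace P H.

Lemma gaussian_sum_le3 (k M : nat) (b : R) : (k < M)%N -> 1 <= b ->
  \sum_(l < M) expR (- (b * (k%:R - l%:R) ^+ 2)) <= 3.
Proof.
move=> kM b1.
have e2 (n : nat) : expR (- (b * n%:R ^+ 2)) <= (1 / 2 : R) ^+ n.
  apply: (@le_trans _ _ (expR (- n%:R))).
    rewrite ler_expR lerN2; case: n => [|n]; first by rewrite expr0n mulr0.
    have n1 : 1 <= n.+1%:R :> R by rewrite ler1n.
    have := ler_pM ler01 ler01 b1 n1; nra.
  have -> : expR (- n%:R) = (expR (-1)) ^+ n :> R.
    by rewrite -expRM_natl mulrN1.
  rewrite lerXn2r ?nnegrE ?expR_ge0//.
  rewrite expRN ler_pdivlMr// mulrC ler_pdivrMr ?expR_gt0// mul1r.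
  have := @expR_ge1Dx R 1; lra.
have g2 n : \sum_(j < n) (1 / 2 : R) ^+ j <= 2.
  by apply: (le_trans (geom_sum_le _ _)); [lra|have -> : (1 - 1 / 2 : R)^-1 = 2 by field; lra].
rewrite -(big_mkord xpredT (fun l => expR (- (b * (k%:R - l%:R) ^+ 2)))).
rewrite (@big_cat_nat _ _ _ k.+1)//=.
have -> : 3 = 2 + 1 :> R by lra.
apply: lerD.
  rewrite big_nat_rev /= big_mkord; apply: le_trans (g2 k.+1); apply: ler_sum => j _.
  rewrite add0n subSS natrB; last by rewrite -ltnS.
  by have := e2 j; rewrite opprB addrC subrK.
rewrite -{1}(add0n k.+1) big_addn big_mkord.
apply: (@le_trans _ _ (\sum_(j < M - k.+1) (1 / 2) * (1 / 2 : R) ^+ j)).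
  apply: ler_sum => j _; rewrite -exprS; have := e2 j.+1.
  congr (expR (- (b * _)) <= _).
  by rewrite natrD -!natr1; ring.
by rewrite -mulr_sumr; have := g2 (M - k.+1)%N; lra.
Qed.

(** A Chernoff bound with a periodic test function. Let [h] be 1 plus the Fejer
    kernel [M^-1 * `|\sum_(k < M) expi (al * k * y)| ^+ 2]. Expanding the product
    of the [h (Y j)] into cosines, the lower bound on the variances dominates
    every characteristic function by a product of Gaussian factors, as if the
    [Y j] were independent; so the expectation of the product is at most
    [4 ^+ N]. On the other hand [h] is at least 1 everywhere and at least
    [1 + M / 4] on [[0, 2 * eta]], whence
    [expR (ln (1 + M / 4) * (1 - y / (2 * eta))) <= h y] for [0 <= y], which makes the
    product large on the event. *)
Lemma small_ball_sum (N M : nat) (Y : 'I_N -> T -> R) (c al eta : R) :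
  (0 < M)%N -> (forall j, H (Y j)) ->
  (forall x : 'I_N -> R, c * \sum_j x j ^+ 2 <= varX P (fun w => \sum_j x j * Y j w)) ->
  0 < al -> 2 <= al ^+ 2 * c -> 0 < eta -> al * M%:R * (2 * eta) <= 1 ->
  pr P [set w | (forall j, 0 <= Y j w) /\ \sum_j Y j w <= eta * N%:R] *
    expR (N%:R * (ln (1 + M%:R / 4) / 2)) <= 4 ^+ N.
Proof.
move=> M0 hY vY al0 alc eta0 alM.
have Mp : 0 < M%:R :> R by rewrite ltr0n.
have Mn0 : M%:R != 0 :> R by rewrite gt_eqF.
(* [h] as a sum of cosines: the pairs [(true, (k, l))] carry the kernel, and the
   pairs [(false, (k, l))] share the constant 1 *)
pose I : finType := (bool * ('I_M * 'I_M))%type.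
pose cf (p : I) : R := if p.1 then M%:R^-1 else M%:R^-1 * M%:R^-1.
pose th (p : I) : R := if p.1 then al * (p.2.1%:R - p.2.2%:R) else 0.
have cf0 p : 0 <= cf p by rewrite /cf; case: ifP => _; rewrite ?mulr_ge0 ?invr_ge0 ?ltW.
have sumI (F : I -> R) : \sum_p F p = \sum_k \sum_l F (true, (k, l)) + \sum_k \sum_l F (false, (k, l)).
  rewrite (eq_bigr (fun p : I => F (p.1, p.2))); last by case.
  rewrite -(pair_bigA _ (fun b kl => F (b, kl))) /= big_bool.
  have G b : \sum_kl F (b, kl) = \sum_k \sum_l F (b, (k, l)).
    rewrite (eq_bigr (fun kl => F (b, (kl.1, kl.2)))); last by case.
    by rewrite -(pair_bigA _ (fun k l => F (b, (k, l)))).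
  by rewrite !G.
have sumff : \sum_(k < M) \sum_(l < M) M%:R^-1 * M%:R^-1 = 1 :> R.
  have sumc (x : R) : \sum_(l < M) x = x * M%:R by rewrite sumr_const card_ord mulr_natr.
  under eq_bigr do rewrite sumc divfK//.
  by rewrite sumc mulVf.
pose Cs (y : R) := \sum_(k < M) cos (al * k%:R * y).
pose Sn (y : R) := \sum_(k < M) sin (al * k%:R * y).
pose h (y : R) := \sum_p cf p * cos (th p * y).
have hE y : h y = 1 + M%:R^-1 * (Cs y ^+ 2 + Sn y ^+ 2).
  rewrite /h sumI /cf /th /= addrC; congr (_ + _).
    by under eq_bigr do under eq_bigr do rewrite mul0r cos0 mulr1.
  under eq_bigr do rewrite -mulr_sumr.
  rewrite -mulr_sumr; congr (_ * _).
  rewrite !expr2 {1}/Cs {1}/Sn !mulr_suml -big_split /=; apply: eq_bigr => k _.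
  rewrite /Cs /Sn !mulr_sumr -big_split /=; apply: eq_bigr => l _.
  by rewrite mulrBr mulrBl cosB.
have s0 y : \sum_p cf p * sin (th p * y) = 0.
  rewrite sumI /cf /th /= [X in _ + X]big1 ?addr0; last first.
    by move=> k _; rewrite big1// => l _; rewrite mul0r sin0 mulr0.
  under eq_bigr do rewrite -mulr_sumr.
  rewrite -mulr_sumr.
  transitivity (M%:R^-1 * (Sn y * Cs y - Cs y * Sn y)); last by rewrite [Sn y * _]mulrC subrr mulr0.
  congr (_ * _); rewrite {1}/Sn {2}/Cs !mulr_suml -sumrB; apply: eq_bigr => k _.
  rewrite /Cs /Sn !mulr_sumr -sumrB; apply: eq_bigr => l _.
  by rewrite mulrBr mulrBl sinB.
have Ysum x : H (fun w => \sum_j x j * Y j w) by exact: (gspace_lcomb gH).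
have mY j : measurable_fun setT (Y j) by exact: (gspace_meas gH).
have prodE w : \prod_j h (Y j w) =
    \sum_(f : {ffun 'I_N -> I}) (\prod_j cf (f j)) * cos (\sum_j th (f j) * Y j w + 0).
  by rewrite /h prod_trig_poly//; apply: eq_bigr => f _; rewrite addr0.
have icos (f : {ffun 'I_N -> I}) : intg P (fun w => cos (\sum_j th (f j) * Y j w + 0)).
  apply: (@intg_bounded _ _ _ P _ 1); last by move=> w; exact: cos_max.
  by apply: measurable_cosD; exact: (gspace_meas gH).
have ih : intg P (fun w => \prod_j h (Y j w)).
  by under eq_fun do rewrite prodE; apply: intg_sum => f; exact: intgZ.
have Eh : Ex P (fun w => \prod_j h (Y j w)) <= 4 ^+ N.
  under eq_fun do rewrite prodE.
  rewrite Ex_sum; last by move=> f; exact: intgZ.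
  apply: (@le_trans _ _ (\sum_(f : {ffun 'I_N -> I}) \prod_j (cf (f j) * expR (- (c * th (f j) ^+ 2 / 2))))).
    apply: ler_sum => f _; rewrite ExZ// big_split /= ler_wpM2l ?prodr_ge0//.
    rewrite cgauss_cos; last exact: (gspace_gauss gH).
    rewrite cos0 mulr1 -expR_sum ler_expR sumrN lerN2 -mulr_suml ler_pM2r//.
    by rewrite -mulr_sumr.
  rewrite -(bigA_distr_bigA (fun j p => cf p * expR (- (c * th p ^+ 2 / 2)))) /=.
  rewrite prodr_const card_ord lerXn2r ?nnegrE//.
    by apply: sumr_ge0 => p _; rewrite mulr_ge0 ?expR_ge0.
  rewrite sumI /cf /th /=.
  under [X in _ + X <= _]eq_bigr do under eq_bigr do rewrite expr0n mulr0 mul0r oppr0 expR0 mulr1.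
  rewrite sumff.
  under eq_bigr do rewrite -mulr_sumr.
  rewrite -mulr_sumr.
  have hs : \sum_(k < M) \sum_(l < M) expR (- (c * (al * (k%:R - l%:R)) ^+ 2 / 2)) <= M%:R * 3.
    apply: (@le_trans _ _ (\sum_(k < M) 3)); last by rewrite sumr_const card_ord mulr_natl.
    apply: ler_sum => k _; apply: le_trans (gaussian_sum_le3 (b := al ^+ 2 * c / 2) (ltn_ord k) _).
      by apply: ler_sum => l _; rewrite ler_expR le_eqVlt; apply/orP; left; apply/eqP; field.
    by lra.
  apply: (@le_trans _ _ (M%:R^-1 * (M%:R * 3) + 1)); first by rewrite lerD2r ler_pM2l ?invr_gt0.
  by rewrite mulKf//; lra.
pose Lg : R := ln (1 + M%:R / 4).
have M4 : 1 < 1 + M%:R / 4 :> R by rewrite ltrDl divr_gt0.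
have Lg0 : 0 < Lg by rewrite ln_gt0.
have h1 y : 1 <= h y.
  by rewrite hE lerDl; apply: mulr_ge0; rewrite ?invr_ge0 ?(ltW Mp)// addr_ge0 ?sqr_ge0.
have hM y : 0 <= y <= 2 * eta -> 1 + M%:R / 4 <= h y.
  move=> /andP[y0 y1]; rewrite hE lerD2l.
  have Cy : M%:R / 2 <= Cs y.
    apply: (@le_trans _ _ (\sum_(k < M) (1 / 2))).
      by rewrite sumr_const card_ord -[leRHS]mulr_natl mul1r.
    apply: ler_sum => k _; apply: cos_ge_half.
    rewrite ger0_norm ?mulr_ge0 ?(ltW al0)//; apply: le_trans alM.
    by rewrite ler_pM ?mulr_ge0 ?(ltW al0)// ler_wpM2l ?(ltW al0)// ler_nat ltnW.
  rewrite ler_pdivlMl//; apply: (@le_trans _ _ ((M%:R / 2) ^+ 2)).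
    by rewrite le_eqVlt; apply/orP; left; apply/eqP; field.
  apply: (@le_trans _ _ (Cs y ^+ 2)); last by rewrite lerDl sqr_ge0.
  by rewrite ler_pXn2r// nnegrE ?divr_ge0// (le_trans _ Cy)// divr_ge0.
have hexp y : 0 <= y -> expR (Lg * (1 - y / (2 * eta))) <= h y.
  have e2 : 0 < 2 * eta by rewrite mulr_gt0.
  move=> y0; case: (leP y (2 * eta)) => ye.
    apply: (le_trans _ (hM _ _)); last by rewrite y0.
    rewrite -[leRHS](@lnK R) ?posrE ?(lt_trans _ M4)// ler_expR -/Lg.
    by rewrite ler_piMr ?(ltW Lg0)// lerBlDr lerDl divr_ge0// ltW.
  apply: le_trans (h1 y); rewrite -[leRHS]expR0 ler_expR.
  rewrite pmulr_rle0// subr_le0 ler_pdivlMr// mul1r; exact: ltW.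
have mA := measurable_small_sum (eta * N%:R) mY.
rewrite -ler_pdivlMr ?expR_gt0//.
apply: (le_trans (@markov_pr _ _ _ P _ (fun w => \prod_j h (Y j w)) _ (expR_gt0 (N%:R * (ln (1 + M%:R / 4) / 2))) mA ih _ _)).
- by move=> w; apply: prodr_ge0 => j _; rewrite (le_trans _ (h1 _)).
- move=> w /= [Y0 Ys].
  apply: (@le_trans _ _ (\prod_j expR (Lg * (1 - Y j w / (2 * eta))))); last first.
    by apply: ler_prod => j _; rewrite expR_ge0 hexp.
  rewrite -expR_sum ler_expR -mulr_sumr sumrB sumr_const card_ord -mulr_suml.
  have hs : (\sum_j Y j w) / (2 * eta) <= N%:R / 2.
    rewrite ler_pdivrMr ?mulr_gt0//; apply: (le_trans Ys).
    by rewrite le_eqVlt; apply/orP; left; apply/eqP; field.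
  have -> : N%:R * (ln (1 + M%:R / 4) / 2) = Lg * (N%:R / 2).
    by rewrite -/Lg; field.
  by rewrite ler_pM2l//; lra.
by rewrite ler_pM2r ?invr_gt0 ?expR_gt0.
Qed.

End small_ball.

(** * Integrals over the four arcs *)

Section mean.
Context d (T : measurableType d) (R : realType) (P : probability T R).
Notation mu := (@lebesgue_measure R).

Lemma ge0_integral_shift (G : R -> R) (m : R) : continuous G -> (forall x, 0 <= G x) ->
  (\int[mu]_x (G x)%:E = \int[mu]_x (G (x + m))%:E)%E.
Proof.
move=> cG G0.
have dF (x : R) : is_derive x (1:R) (fun x : R => x + m) 1.
  by have := is_deriveD (@is_derive_id R R x 1) (@is_derive_cst R R R m x 1); rewrite addr0.
have F' : derive1 (fun x : R => x + m) = cst 1 by apply/funext => x; rewrite derive1E derive_val.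
rewrite (@increasing_ge0_integration_by_substitutionT R (fun x => x + m))//.
- by apply: eq_integral => x _; rewrite F' !fctE mulr1.
- by move=> x y xy; rewrite ltrD2r.
- by rewrite F' => x; exact: cvg_cst.
- by rewrite F'; exact: is_cvg_cst.
- by rewrite F'; exact: is_cvg_cst.
- exact: cvg_addrr_Ny.
- exact: cvg_addrr.
Qed.

(** Identifies the location parameter of a normal law with the expectation;
    for a centred variable it is therefore 0. *)
Lemma gaussian_mean (X : T -> R) (m s : R) : s != 0 -> measurable_fun setT X ->
  (forall B : set R, measurable B -> P (X @^-1` B) = normal_prob m s B) ->
  intg P X /\ Ex P X = m.
Proof.
move=> s0 mX lawX.
have transf (f : R -> R) : continuous f -> (forall x, 0 <= f x) ->
    (forall x, f x <= 1 + x ^+ 2) ->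
    intg P (fun w => f (X w - m)) /\
    Ex P (fun w => f (X w - m)) = \int[mu]_x (f x * normal_pdf 0 s x).
  move=> cf f0 f1.
  have cfm : continuous (fun x : R => f (x - m)).
    by move=> x; apply: continuous_comp; [apply: cvgB; [exact: cvg_id|exact: cvg_cst]|exact: cf].
  have mf : measurable_fun setT f by exact: continuous_measurable_fun.
  have mfm : measurable_fun setT (fun x : R => f (x - m)) by exact: continuous_measurable_fun.
  have E : (\int[P]_w (f (X w - m))%:E = \int[mu]_x (f x * normal_pdf 0 s x)%:E)%E.
    rewrite (@ge0_normal_transfer _ _ _ P X m s (fun x : R => f (x - m)) mX lawX mfm (fun=> f0 _)).
    rewrite (@ge0_integral_shift (fun x : R => f (x - m) * normal_pdf m s x) m).
    - by apply: eq_integral => x _; rewrite addrK !normal_pdfE// (@normal_fun_center _ m) /= addrK.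
    - by move=> x; apply: cvgM; [exact: cfm|exact: continuous_normal_pdf].
    - by move=> x; rewrite mulr_ge0 ?normal_pdf_ge0.
  have ipsi : mu.-integrable setT (EFin \o (fun x => f x * normal_pdf 0 s x)).
    apply: (@integrable_lin_normal_pdf _ _ s0 _ 1) => // x.
    by rewrite mul1r ger0_norm.
  split; last by rewrite /Ex /Rintegral E.
  apply/integrableP; split.
    by apply/measurable_EFinP; apply: (measurableT_comp mfm mX).
  under eq_integral do rewrite /= ger0_norm//.
  rewrite E; move/integrableP: ipsi => [_].
  by under eq_integral do rewrite /= ger0_norm ?mulr_ge0 ?normal_pdf_ge0//.
pose fp (x : R) := Num.max x 0; pose fn (x : R) := Num.max (- x) 0.
have cfp : continuous fp by move=> x; apply: continuous_max; [exact: cvg_id|exact: cvg_cst].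
have cfn : continuous fn by move=> x; apply: continuous_max; [apply: cvgN; exact: cvg_id|exact: cvg_cst].
have fpn x : fp x - fn x = x by rewrite /fp /fn; case: (leP x 0) => h; rewrite /Num.max; do 2 case: ltP; lra.
have fp0 x : 0 <= fp x by rewrite le_max lexx orbT.
have fn0 x : 0 <= fn x by rewrite le_max lexx orbT.
have fp1 x : fp x <= 1 + x ^+ 2 by rewrite ge_max; apply/andP; split; nra.
have fn1 x : fn x <= 1 + x ^+ 2 by rewrite ge_max; apply/andP; split; nra.
have [ip Ep] := transf _ cfp fp0 fp1; have [in_ En] := transf _ cfn fn0 fn1.
have XE : X = (fun w => fp (X w - m) + (-1) * fn (X w - m) + m).
  by apply/funext => w; rewrite mulN1r fpn subrK.
have inn := intgZ (-1) in_.
split; first by rewrite XE; apply: intgD; [exact: intgD|exact: intg_cst].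
rewrite {1}XE ExD//; [|exact: intgD|exact: intg_cst].
rewrite ExD// ExZ// Ex_cst Ep En mulN1r.
suff -> : \int[mu]_x (fp x * normal_pdf 0 s x) - \int[mu]_x (fn x * normal_pdf 0 s x) = 0 by rewrite add0r.
have iL (f : R -> R) : continuous f -> (forall x, `|f x| <= 1 + x ^+ 2) ->
    mu.-integrable setT (EFin \o (fun x => f x * normal_pdf 0 s x)).
  move=> cf f1; apply: (@integrable_lin_normal_pdf _ _ s0 _ 1).
    exact: continuous_measurable_fun.
  by move=> x; rewrite mul1r.
rewrite -RintegralB//; last 2 first.
- by apply: iL => // x; rewrite ger0_norm.
- by apply: iL => // x; rewrite ger0_norm.
have St : \int[mu]_x (x * cst 1 x * normal_pdf 0 s x) = s ^+ 2 * \int[mu]_x (cst 0 x * normal_pdf 0 s x).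
  apply: (@normal_Stein _ _ s0 (cst 1) (cst 0) 1 0).
  - by move=> x; exact: cvg_cst.
  - by move=> x; rewrite normr1 mul1r lerDl.
  - by move=> x; rewrite normr0 mul0r.
transitivity (\int[mu]_x (x * cst 1 x * normal_pdf 0 s x)).
  by apply: eq_Rintegral => x _; rewrite -mulrBl fpn mulr1.
rewrite St; under eq_Rintegral do rewrite mul0r.
by rewrite /Rintegral integral0 mulr0.
Qed.
End mean.

Section arc_measure.
Context {R : realType} (theta : R).
Hypothesis theta0 : 0 < theta.
Notation A := (arc_angles theta).
Notation leb := (@lebesgue_measure R).
Notation mu := (@arc_angles_uniform R theta).

Definition arc_density : R := (fine (leb A))^-1.

Lemma arc_density_gt0 : 0 < arc_density.
Proof.
rewrite invr_gt0 fine_gt0// arc_angles_length_gt0//=; exact: arc_angles_length_lty.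
Qed.

Lemma arc_measureE (B : set (measurableTypeR R)) :
  mu B = (arc_density%:E * leb (B `&` A))%E.
Proof.
have -> : mu B = mnormalize (mrestr leb (measurable_arc_angles theta)) \d_(0 : measurableTypeR R) B by [].
have hT : (mrestr leb (measurable_arc_angles theta) : {measure set _ -> \bar R}) setT = leb A.
  by rewrite /= /mrestr setTI.
rewrite /mnormalize hT ifF; first by rewrite muleC.
apply/negbTE; rewrite negb_or; apply/andP; split.
  by rewrite gt_eqF// arc_angles_length_gt0.
by rewrite lt_eqF// arc_angles_length_lty.
Qed.

Lemma arc_integral_sub (D : set R) (g : R -> \bar R) : measurable D -> D `<=` A ->
  measurable_fun setT g -> (forall x, 0 <= g x)%E ->
  (\int[mu]_(x in D) g x = arc_density%:E * \int[leb]_(x in D) g x)%E.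
Proof.
move=> mD DA mg g0.
have k0 := ltW arc_density_gt0.
rewrite -(ge0_integral_mscale leb mD (NngNum k0))//; last exact: measurable_funTS.
apply: eq_measure_integral => B mB BD.
by apply: (etrans (arc_measureE B)); rewrite (setIidl (subset_trans BD DA)).
Qed.

Lemma arc_integral_all (g : R -> \bar R) :
  measurable_fun setT g -> (forall x, 0 <= g x)%E ->
  (\int[mu]_x g x = \int[mu]_(x in A) g x)%E.
Proof.
move=> mg g0; have mA := measurable_arc_angles theta.
rewrite (@ge0_negligible_integral _ _ _ mu setT (~` A))//.
- by rewrite setTD setCK.
- exact: measurableC.
- by apply: (etrans (arc_measureE _)); rewrite setICl measure0 mule0.
Qed.

Lemma fine_le_EFin (x : \bar R) (B : R) : (0 <= x)%E -> (x <= B%:E)%E -> fine x <= B.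
Proof. by case: x => //= r _; rewrite lee_fin. Qed.

Lemma arc_mean_le (g : R -> R) (B : R) : measurable_fun setT g -> (forall x, 0 <= g x) ->
  0 <= B -> (forall x, A x -> g x <= B) -> Ex mu g <= B.
Proof.
move=> mg g0 B0 gB; rewrite /Ex /Rintegral.
have h : (\int[mu]_x (g x)%:E <= B%:E)%E.
  rewrite arc_integral_all//; last exact/measurable_EFinP.
  apply: (@le_trans _ _ (\int[mu]_(x in A) B%:E)%E).
    apply: ge0_le_integral => //.
    - exact: measurable_arc_angles.
    - by move=> x _; rewrite lee_fin.
    - by apply/measurable_EFinP; exact: measurable_funTS.
  rewrite integral_cst; last exact: measurable_arc_angles.
  by rewrite -[leRHS]mule1 lee_wpmul2l ?lee_fin// probability_le1//; exact: measurable_arc_angles.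
by apply: fine_le_EFin h; apply: integral_ge0 => x _; rewrite lee_fin.
Qed.

Lemma FTC_is_derive (F f : R -> R) (a b : R) : a <= b -> continuous f ->
  (forall x : R, is_derive x 1 F (f x)) ->
  (\int[leb]_(x in `[a, b]) (f x)%:E = (F b - F a)%:E)%E.
Proof.
move=> ab cf dF; move: ab; rewrite le_eqVlt => /predU1P[->|ab].
  by rewrite subrr set_itv1 integral_set1.
have cF : continuous F.
  by move=> x; apply: differentiable_continuous; apply/derivable1_diffP; case: (dF x).
rewrite EFinB; apply: continuous_FTC2 => //.
- exact: continuous_subspaceT.
- split => [x _||]; first by case: (dF x).
    by apply: cvg_at_right_filter; exact: cF.
  by apply: cvg_at_left_filter; exact: cF.
- by move=> x _; rewrite derive1E derive_val.
Qed.

(** Comparison with a function that has an explicit antiderivative turns the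
    changes of variables needed later into chain rules. *)
Lemma arc_mean_ge (g F f : R -> R) (a b : R) : a <= b -> `[a, b] `<=` A ->
  intg mu g -> measurable_fun setT g -> (forall x, 0 <= g x) ->
  continuous f -> (forall x : R, is_derive x 1 F (f x)) ->
  (forall x, a <= x <= b -> 0 <= f x <= g x) ->
  arc_density * (F b - F a) <= Ex mu g.
Proof.
move=> ab abA ig mg g0 cf dF fg.
have mE : measurable_fun setT (EFin \o g) by exact/measurable_EFinP.
rewrite -lee_fin /Ex /Rintegral fineK; last exact: integrable_fin_num.
rewrite EFinM -(FTC_is_derive ab cf dF).
apply: (@le_trans _ _ (\int[mu]_(x in `[a, b]) (g x)%:E)%E); last first.
  apply: ge0_subset_integral => //.
  by move=> x _; rewrite lee_fin.
rewrite (arc_integral_sub _ abA)//.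
rewrite lee_pmul2l//; last by rewrite lte_fin arc_density_gt0.
apply: ge0_le_integral => //.
- by move=> x; rewrite /= in_itv /= => /fg/andP[].
- by apply/measurable_EFinP/measurable_funTS; exact: continuous_measurable_fun.
- exact: measurable_funTS.
- by move=> x; rewrite /= in_itv /= => /fg/andP[_]; rewrite lee_fin.
Qed.

Lemma ge0_integral_setU_le (B C : set R) (g : R -> \bar R) : measurable B -> measurable C ->
  measurable_fun setT g -> (forall x, 0 <= g x)%E ->
  (\int[leb]_(x in B `|` C) g x <= \int[leb]_(x in B) g x + \int[leb]_(x in C) g x)%E.
Proof.
move=> mB mC mg g0.
have -> : B `|` C = B `|` (C `\` B).
  apply/seteqP; split => x /=; last by case=> [|[]]; [left|right].
  by case: (pselect (B x)) => Bx; [left|case=> // Cx; right].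
rewrite ge0_integral_setU//; last 3 first.
- exact: measurableD.
- exact: measurable_funTS.
- by rewrite disj_set2E setDIK.
by rewrite leeD2l// ge0_subset_integral//; [exact: measurableD|exact: measurable_funTS].
Qed.

Lemma arc_mean_le_cover (n : nat) (g : R -> R) (F f : nat -> R -> R) (a b : nat -> R) :
  measurable_fun setT g -> (forall x, 0 <= g x) ->
  (forall x, A x -> exists2 i, (i < n)%N & a i <= x <= b i) ->
  (forall i, a i <= b i) -> (forall i, continuous (f i)) ->
  (forall i (x : R), is_derive x 1 (F i) (f i x)) ->
  (forall i x, a i <= x <= b i -> g x <= f i x) ->
  Ex mu g <= arc_density * \sum_(i < n) (F i (b i) - F i (a i)).
Proof.
move=> mg g0 Aab ab cf dF gf.
have mE : measurable_fun setT (EFin \o g) by exact/measurable_EFinP.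
have g0E x : (0 <= (EFin \o g) x)%E by rewrite lee_fin.
have piece i : (\int[leb]_(x in `[a i, b i]) (g x)%:E <= (F i (b i) - F i (a i))%:E)%E.
  rewrite -(FTC_is_derive (ab i) (cf i) (dF i)); apply: ge0_le_integral => //.
  - by move=> x _; rewrite lee_fin.
  - exact: measurable_funTS.
  - by apply/measurable_EFinP/measurable_funTS; exact: continuous_measurable_fun.
  - by move=> x; rewrite /= in_itv /= => /gf; rewrite lee_fin.
pose U k := \bigcup_(i in `I_k) `[a i, b i]%classic.
have mU k : measurable (U k) by apply: bigcup_measurable => i _; exact: measurable_itv.
have cover k : (\int[leb]_(x in U k) (g x)%:E <= (\sum_(i < k) (F i (b i) - F i (a i)))%:E)%E.
  elim: k => [|k IH].
    by rewrite /U II0 bigcup_set0 integral_set0 big_ord0.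
  have -> : U k.+1 = U k `|` `[a k, b k]%classic.
    by rewrite /U IIS bigcup_setU bigcup_set1.
  apply: (le_trans (ge0_integral_setU_le _ _ mE g0E)) => //.
  by rewrite big_ord_recr /= EFinD; apply: leeD.
have h : (\int[mu]_x (g x)%:E <= (arc_density * \sum_(i < n) (F i (b i) - F i (a i)))%:E)%E.
  rewrite arc_integral_all// arc_integral_sub//; last exact: measurable_arc_angles.
  rewrite EFinM lee_pmul2l//; last by rewrite lte_fin arc_density_gt0.
  apply: le_trans (cover n); apply: ge0_subset_integral => //.
  - exact: measurable_arc_angles.
  - exact: mU.
  - exact: measurable_funTS.
  - by move=> x _; rewrite lee_fin.
by apply: fine_le_EFin h; apply: integral_ge0 => x _; rewrite lee_fin.
Qed.

End arc_measure.

(** * The spectral representation along the segment *)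

Section monotonicity.
Context {R : realType}.

Lemma is_derive_continuous (F f : R -> R) : (forall x : R, is_derive x 1 F (f x)) -> continuous F.
Proof.
by move=> dF x; apply: differentiable_continuous; apply/derivable1_diffP; case: (dF x).
Qed.

Lemma is_derive_ge0_le_in (F f : R -> R) (a b : R) : (forall x : R, is_derive x 1 F (f x)) ->
  (forall x, a <= x <= b -> 0 <= f x) -> a <= b -> F a <= F b.
Proof.
move=> dF f0 ab.
apply: (@ger0_derive1_ndecr R F a b) => //.
- move=> x; rewrite in_itv /= => /andP[/ltW ax /ltW xb].
  by rewrite derive1E derive_val f0// ax.
- by apply: continuous_subspaceT; exact: (is_derive_continuous dF).
Qed.

Lemma is_derive_ge0_le (F f : R -> R) (x y : R) : (forall x : R, is_derive x 1 F (f x)) ->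
  (forall x, 0 <= f x) -> x <= y -> F x <= F y.
Proof. by move=> dF f0; apply: (is_derive_ge0_le_in dF). Qed.

End monotonicity.

Section spectral_symbol.
Context {R : realType} (I : finType).
Implicit Types (a t : I -> R) (l : R).

(** The squared modulus at [l] of the Fourier transform of the point masses
    [a i] at [t i]; its mean over the spectral measure is a variance. *)
Definition symb a t l : R :=
  (\sum_i a i * cos (2 * pi * t i * l)) ^+ 2 + (\sum_i a i * sin (2 * pi * t i * l)) ^+ 2.

Lemma symb_ge0 a t l : 0 <= symb a t l.
Proof. by rewrite addr_ge0 ?sqr_ge0. Qed.

Lemma symbE a t l :
  symb a t l = \sum_i \sum_j a i * a j * cos (2 * pi * (t i - t j) * l).
Proof.
rewrite /symb !expr2 !mulr_suml -big_split /=; apply: eq_bigr => i _.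
rewrite !mulr_sumr -big_split /=; apply: eq_bigr => j _.
by rewrite mulrBr mulrBl cosB; ring.
Qed.

Lemma symb_le_sqr a t l : symb a t l <= (\sum_i `|a i|) ^+ 2.
Proof.
rewrite symbE expr2 mulr_suml; apply: ler_sum => i _; rewrite mulr_sumr.
apply: ler_sum => j _; apply: le_trans (ler_norm _) _.
by rewrite !normrM ler_piMr ?mulr_ge0// cos_max.
Qed.

Lemma continuous_symb a t : continuous (symb a t).
Proof.
have cc (g : R -> R) : continuous g -> continuous (fun l => (\sum_i a i * g (2 * pi * t i * l)) ^+ 2).
  move=> cg x; have h : (fun l => \sum_i a i * g (2 * pi * t i * l)) y @[y --> x] -->
      \sum_i a i * g (2 * pi * t i * x).
    apply: (@cvg_big _ _ +%R); first by move=> z; exact: add_continuous.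
    move=> i _; apply: cvgMr.
    apply: continuous_comp; last exact: cg.
    by apply: cvgMr; exact: cvg_id.
  by rewrite /continuous_at expr2; under eq_fun do rewrite expr2; exact: (cvgM h h).
by move=> x; apply: cvgD; [apply: (cc cos)|apply: (cc sin)]; [exact: continuous_cos|exact: continuous_sin].
Qed.

(** An antiderivative of [cos (w * l)] in [l]. *)
Definition icos (w l : R) : R := if w == 0 then l else sin (w * l) / w.

Lemma is_derive_linear (w l : R) : is_derive l (1:R) (fun l : R => w * l) w.
Proof.
have := is_deriveM (@is_derive_cst R R R w l 1) (@is_derive_id R R l 1).
by move/is_derive_eq; apply; rewrite /GRing.scale /= mulr0 addr0 mulr1.
Qed.

Lemma is_derive_icos w l : is_derive l 1 (icos w) (cos (w * l)).
Proof.
have [->|w0] := eqVneq w 0.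
  rewrite mul0r cos0 (_ : icos 0 = id); first exact: is_derive_id.
  by apply/funext => x; rewrite /icos eqxx.
rewrite (_ : icos w = fun l => w^-1 * sin (w * l)); last first.
  by apply/funext => x; rewrite /icos (negbTE w0) mulrC.
have h := @is_derive1_comp R sin (fun l => w * l) l _ _ (@is_derive_sin R (w * l)) (is_derive_linear w l).
have := is_deriveM (@is_derive_cst R R R (w^-1) l 1) h.
by move/is_derive_eq; apply; rewrite /GRing.scale /= mulr0 addr0; field.
Qed.

Lemma is_derive_bigsum (J : Type) (r : seq J) (F f : J -> R -> R) (l : R) :
  (forall j, is_derive l 1 (F j) (f j l)) ->
  is_derive l 1 (fun l => \sum_(j <- r) F j l) (\sum_(j <- r) f j l).
Proof.
move=> h; elim: r => [|j r IH].
  by under eq_fun do rewrite big_nil; rewrite big_nil; exact: is_derive_cst.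
under eq_fun do rewrite big_cons; rewrite big_cons; exact: is_deriveD.
Qed.

Lemma is_derive_scale (k : R) (F : R -> R) (f l : R) :
  is_derive l 1 F f -> is_derive l 1 (fun l => k * F l) (k * f).
Proof.
move=> h; have := is_deriveM (@is_derive_cst R R R k l 1) h.
by move/is_derive_eq; apply; rewrite /GRing.scale /= mulr0 addr0.
Qed.

Definition asymb a t l : R :=
  \sum_i \sum_j a i * a j * icos (2 * pi * (t i - t j)) l.

Lemma is_derive_asymb a t l : is_derive l 1 (asymb a t) (symb a t l).
Proof.
rewrite symbE; apply: (is_derive_bigsum _ (f := fun i l => \sum_j a i * a j * cos (2 * pi * (t i - t j) * l))) => i.
apply: (is_derive_bigsum _ (f := fun j l => a i * a j * cos (2 * pi * (t i - t j) * l))) => j.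
by apply: is_derive_scale; exact: is_derive_icos.
Qed.

Lemma asymb_le a t (x y : R) : x <= y -> asymb a t x <= asymb a t y.
Proof. by apply: is_derive_ge0_le => z; [exact: is_derive_asymb|exact: symb_ge0]. Qed.

End spectral_symbol.

Section gaussian_rv.
Context d (T : measurableType d) (R : realType) (P : probability T R).

Lemma gaussian_rv_centred (X : T -> R) : measurable_fun setT X -> gaussian_rv P X ->
  intg P X /\ (Ex P X = 0 -> cgauss P X).
Proof.
move=> mX [m [s lawX]].
have [s0|s0] := eqVneq s 0; last first.
  have lawX' (B : set R) : measurable B -> P (X @^-1` B) = normal_prob m s B.
    by move=> mB; rewrite lawX// (negbTE s0).
  have [iX EX] := gaussian_mean s0 mX lawX'.
  split=> // E0; split=> //; exists s => B mB.
  by rewrite (negbTE s0) (lawX' _ mB) -EX E0.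
have lawX' (B : set R) : measurable B -> P (X @^-1` B) = \d_m B.
  by move=> mB; rewrite lawX// s0 eqxx.
pose Y w := X w - m.
have mY : measurable_fun setT Y by exact: measurable_funB.
have lawY (B : set R) : measurable B -> P (Y @^-1` B) = \d_(0:R) B.
  move=> mB; have mB' : measurable [set x | B (x - m)].
    have : measurable_fun setT (fun x : R => x - m) by exact: measurable_funB.
    by move=> /(_ measurableT _ mB); rewrite setTI.
  have -> : Y @^-1` B = X @^-1` [set x | B (x - m)] by [].
  rewrite lawX'// !diracE; have -> // : (m \in [set x | B (x - m)]) = (0 \in B).
  by apply/idP/idP; rewrite !in_setE /= subrr.
have [iY EY] := Ex_dirac0 mY lawY (@measurable_id _ _ setT).
have XE : X = (fun w => Y w + m) by apply/funext => w; rewrite subrK.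
have iX : intg P X by rewrite XE; apply: intgD => //; exact: intg_cst.
split=> // E0; split=> //; exists 0 => B mB; rewrite eqxx.
have m0 : m = 0.
  by move: E0; rewrite XE ExD//; [rewrite EY Ex_cst add0r|exact: intg_cst].
by rewrite lawX' // m0.
Qed.

End gaussian_rv.

Section segment_field.
Context d (T : measurableType d) (R : realType) (P : probability T R).
Context (u theta : R) (Psi : R * R -> {RV P >-> R}).
Hypothesis (hu : 0 <= u <= pi / 4) (htheta : 0 < theta <= pi / 4).
Hypothesis hPsi : gaussian_field_with_spectral_measure (sigma_arcs theta) Psi.
Notation mu := (@arc_angles_uniform R theta).

Definition ray (t : R) : T -> R := Psi (t * cos u, t * sin u).

Definition rayspan (X : T -> R) : Prop :=
  exists s : seq (R * R), X = (fun w => \sum_(p <- s) p.1 * ray p.2 w).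

Let theta0 : 0 < theta. Proof. by case/andP: htheta. Qed.

Lemma measurable_ray t : measurable_fun setT (ray t).
Proof. exact: measurable_funPT. Qed.

Lemma gaussian_lcomb (s : seq (R * R)) : gaussian_rv P (fun w => \sum_(p <- s) p.1 * ray p.2 w).
Proof.
have := field_gaussian hPsi (n := size s)
  (fun i => let t := (nth (0, 0) s i).2 in (t * cos u, t * sin u)) (fun i => (nth (0, 0) s i).1).
by under eq_fun do rewrite -(big_mkord xpredT (fun i => (nth (0, 0) s i).1 * ray (nth (0, 0) s i).2 _))
  -(big_nth (0, 0) xpredT (fun p => p.1 * ray p.2 _)).
Qed.

Lemma ray_intg t : intg P (ray t).
Proof.
have mt := measurable_ray t.
have := gaussian_lcomb [:: (1, t)]; under eq_fun do rewrite big_seq1 mul1r.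
by move/(gaussian_rv_centred mt) => [].
Qed.

Lemma ray_centred t : Ex P (ray t) = 0.
Proof.
have := field_centred hPsi (t * cos u, t * sin u).
by rewrite unlock /Ex /Rintegral => ->.
Qed.

Lemma gspace_rayspan : gspace P rayspan.
Proof.
split.
  split.
  - by exists [::]; apply/funext => w; rewrite big_nil.
  - by move=> X Y [s ->] [r ->]; exists (s ++ r); apply/funext => w; rewrite big_cat.
  - move=> k X [s ->]; exists [seq (k * p.1, p.2) | p <- s]; apply/funext => w.
    by rewrite big_map mulr_sumr; apply: eq_bigr => p _; rewrite mulrA.
move=> X [s ->].
have ms : measurable_fun setT (fun w => \sum_(p <- s) p.1 * ray p.2 w).
  by apply: measurable_sum => p; apply: measurable_funM => //; exact: measurable_ray.
have [_] := gaussian_rv_centred ms (gaussian_lcomb s); apply.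
rewrite Ex_sum; last by move=> p; apply: intgZ; exact: ray_intg.
by rewrite big1// => p _; rewrite ExZ ?ray_centred ?mulr0//; exact: ray_intg.
Qed.

Lemma rayspan_ray t : rayspan (ray t).
Proof. by exists [:: (1, t)]; apply/funext => w; rewrite big_seq1 mul1r. Qed.

Lemma continuous_cos_dir (k : R) : continuous (fun x : R => cos (k * cos (x - u))).
Proof.
move=> x; apply: continuous_comp; last exact: continuous_cos.
apply: cvgMr; apply: continuous_comp; last exact: continuous_cos.
by apply: cvgB; [exact: cvg_id|exact: cvg_cst].
Qed.

(** A point of the arcs at angle [x] contributes, along the segment, the
    frequency [cos (x - u)]. *)
Lemma ray_cov s t :
  cov P (ray s) (ray t) = Ex mu (fun x => cos (2 * pi * (s - t) * cos (x - u))).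
Proof.
have := field_cov hPsi (s * cos u, s * sin u) (t * cos u, t * sin u).
move=> /(congr1 (@complex.Re R)); rewrite unlock /= => H.
rewrite /cov /Ex /Rintegral; rewrite [LHS]H /fourier /Cintegral /=.
rewrite /Rintegral /sigma_arcs /distribution.
pose v := 2 * pi * (s - t).
have E (x : R) : cos (2 * pi * dotp ((s * cos u, s * sin u) - (t * cos u, t * sin u)) (cis x)) =
    cos (2 * pi * (s - t) * cos (x - u)).
  by congr cos; rewrite /dotp /cis /= cosB; ring.
have mc : measurable_fun setT (fun z : R * R => cos (2 * pi * dotp ((s * cos u, s * sin u) - (t * cos u, t * sin u)) z)).
  apply: (measurableT_comp (f := cos)).
    by apply: continuous_measurable_fun; exact: continuous_cos.
  by apply: measurable_funM => //; apply: measurable_funD; apply: measurable_funM.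
congr fine; rewrite (@integral_pushforward _ _ _ _ R cis) //.
- by rewrite preimage_setT; apply: eq_integral => x _ /=; rewrite E.
- exact/measurable_EFinP.
- rewrite preimage_setT.
  apply: (@intg_bounded _ _ _ mu _ 1); last by move=> x; exact: cos_max.
  under eq_fun do rewrite E.
  by apply: continuous_measurable_fun; exact: continuous_cos_dir.
Qed.

Section symbol_bounds.
Variables (I : finType) (a t : I -> R).
Notation X := (fun w => \sum_i a i * ray (t i) w).

Lemma measurable_symb_dir : measurable_fun setT (fun x : R => symb a t (cos (x - u))).
Proof.
apply: continuous_measurable_fun => x.
apply: continuous_comp; last exact: continuous_symb.
apply: continuous_comp; last exact: continuous_cos.
by apply: cvgB; [exact: cvg_id|exact: cvg_cst].
Qed.

Lemma intg_symb_dir : intg mu (fun x => symb a t (cos (x - u))).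
Proof.
apply: (@intg_bounded _ _ _ mu _ ((\sum_i `|a i|) ^+ 2)); first exact: measurable_symb_dir.
by move=> x; rewrite ger0_norm ?symb_ge0 ?symb_le_sqr.
Qed.

Lemma ray_varX : varX P X = Ex mu (fun x => symb a t (cos (x - u))).
Proof.
rewrite (varX_lcomb gspace_rayspan); last by move=> i; exact: rayspan_ray.
under [in RHS]eq_fun do rewrite symbE.
have ic i j : intg mu (fun x => cos (2 * pi * (t i - t j) * cos (x - u))).
  apply: (@intg_bounded _ _ _ mu _ 1); last by move=> x; exact: cos_max.
  by apply: continuous_measurable_fun; exact: continuous_cos_dir.
rewrite Ex_sum; last by move=> i; apply: intg_sum => j; exact: intgZ.
apply: eq_bigr => i _; rewrite Ex_sum; last by move=> j; exact: intgZ.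
by apply: eq_bigr => j _; rewrite ExZ// ray_cov.
Qed.

Lemma ray_varX_le (B : R) : 0 <= B ->
  (forall x, arc_angles theta x -> symb a t (cos (x - u)) <= B) -> varX P X <= B.
Proof.
move=> B0 h; rewrite ray_varX; apply: arc_mean_le => //.
- exact: measurable_symb_dir.
- by move=> x; exact: symb_ge0.
Qed.

Lemma ray_varX_sup (B : R) : (forall l, -1 <= l <= 1 -> symb a t l <= B) -> varX P X <= B.
Proof.
move=> h; apply: ray_varX_le.
  by apply: le_trans (symb_ge0 a t 0) (h _ _); lra.
by move=> x _; apply: h; rewrite cos_geN1 cos_le1.
Qed.

Lemma is_derive_cos_dir (x : R) : is_derive x (1:R) (fun x : R => cos (x - u)) (- sin (x - u)).
Proof.
have h : is_derive x (1:R) (fun x : R => x - u) 1.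
  by have := is_deriveB (@is_derive_id R R x 1) (@is_derive_cst R R R u x 1); rewrite subr0.
have := @is_derive1_comp R cos (fun x => x - u) x _ _ (@is_derive_cos R (x - u)) h.
by rewrite mulr1.
Qed.

Lemma continuous_cosB : continuous (fun x : R => cos (x - u)).
Proof. exact: (is_derive_continuous is_derive_cos_dir). Qed.

Lemma continuous_sinB : continuous (fun x : R => sin (x - u)).
Proof.
move=> x; apply: continuous_comp; last exact: continuous_sin.
by apply: cvgB; [exact: cvg_id|exact: cvg_cst].
Qed.

Lemma is_derive_comp_dir (G g : R -> R) (x : R) : (forall l : R, is_derive l 1 G (g l)) ->
  is_derive x 1 (fun x : R => G (cos (x - u))) (- (g (cos (x - u)) * sin (x - u))).
Proof.
move=> dG.
have := @is_derive1_comp R G (fun x => cos (x - u)) x _ _ (dG _) (is_derive_cos_dir x).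
by rewrite mulrN.
Qed.

(** The arc centred at [pi / 2] is seen along the segment at the frequencies
    [l = sin y] with [y = pi / 2 + u - x], which fill the interval from
    [sin (u - theta)] to [sin (u + theta)]. The change of variables has Jacobian
    [sin (x - u) <= 1], so the density of [l] is at least that of [x]. *)
Lemma ray_varX_ge (G g : R -> R) (l0 l1 : R) :
  sin (u - theta) <= l0 -> l0 <= l1 -> l1 <= sin (u + theta) ->
  continuous g -> (forall l : R, is_derive l 1 G (g l)) ->
  (forall l, l0 <= l <= l1 -> 0 <= g l <= symb a t l) ->
  arc_density theta * (G l1 - G l0) <= varX P X.
Proof.
move=> hl0 l01 hl1 cg dG gs.
have [u0 u1] := andP hu; have [t0 t1] := andP htheta.
have L0 : -1 <= l0 <= 1.
  by rewrite (le_trans (sin_geN1 _) hl0) (le_trans l01 (le_trans hl1 (sin_le1 _))).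
have L1 : -1 <= l1 <= 1.
  by rewrite (le_trans (sin_geN1 _) (le_trans hl0 l01)) (le_trans hl1 (sin_le1 _)).
have [/andP[a0 b0] s0] := asin_def L0; have [/andP[a1 b1] s1] := asin_def L1.
set y0 := asin l0 in a0 b0 s0; set y1 := asin l1 in a1 b1 s1.
have sinW (x y : R) : - (pi / 2) <= x -> x <= pi / 2 -> - (pi / 2) <= y -> y <= pi / 2 ->
    (sin x <= sin y) = (x <= y).
  by move=> h1 h2 h3 h4; rewrite !leNgt ltr_sin// in_itv /= ?h1 ?h2 ?h3 ?h4.
have mono (x y : R) : - (pi / 2) <= x -> x <= pi / 2 -> - (pi / 2) <= y -> y <= pi / 2 ->
    sin x <= sin y -> x <= y.
  by move=> h1 h2 h3 h4; rewrite sinW.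
have p0 := pi_gt0 R.
have y01 : y0 <= y1 by apply: mono => //; rewrite s0 s1.
have uy0 : u - theta <= y0 by apply: mono => //; rewrite ?s0//; lra.
have uy1 : y1 <= u + theta by apply: mono => //; rewrite ?s1//; lra.
have cE y : cos (pi / 2 + u - y - u) = sin y.
  by rewrite -[in RHS](opprK y) sinN -cosDpihalf; congr cos; ring.
have := @arc_mean_ge R theta theta0 (fun x => symb a t (cos (x - u)))
  (fun x => - G (cos (x - u))) (fun x => g (cos (x - u)) * sin (x - u))
  (pi / 2 + u - y1) (pi / 2 + u - y0).
rewrite !cE s0 s1 -ray_varX (_ : - G l0 - - G l1 = G l1 - G l0); last by ring.
apply.
- by lra.
- move=> x; rewrite /= in_itv /= => /andP[x0 x1]; exists 1%N => //=.
  by rewrite in_itv /= mul1r; apply/andP; split; lra.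
- exact: intg_symb_dir.
- exact: measurable_symb_dir.
- by move=> x; exact: symb_ge0.
- move=> x; apply: cvgM; last exact: continuous_sinB.
  by apply: (continuous_comp (g := g)); [exact: continuous_cosB|exact: cg].
- move=> x; have := is_deriveN (is_derive_comp_dir x dG); by rewrite opprK.
- move=> x /andP[x0 x1].
  pose y := pi / 2 + u - x.
  have xE : x = pi / 2 + u - y by rewrite /y; ring.
  have y0y : y0 <= y by rewrite /y; lra.
  have yy1 : y <= y1 by rewrite /y; lra.
  have sl : l0 <= cos (x - u) <= l1.
    rewrite xE cE -s0 -s1; apply/andP; split.
      by rewrite sinW//; lra.
    by rewrite sinW//; lra.
  have /andP[g0 gS] := gs _ sl.
  have sx : 0 <= sin (x - u) by apply: sin_ge0_pi; apply/andP; split; lra.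
  by rewrite mulr_ge0//= (le_trans _ gS)// ler_piMr// sin_le1.
Qed.

Lemma cosDnpi (x : R) (n : nat) : cos (x + n%:R * pi) = (-1) ^+ n * cos x.
Proof.
elim: n => [|n IH]; first by rewrite mul0r addr0 expr0 mul1r.
by rewrite -natr1 mulrDl mul1r addrA cosDpi IH exprS mulN1r mulNr.
Qed.

Lemma sinDnpi (x : R) (n : nat) : sin (x + n%:R * pi) = (-1) ^+ n * sin x.
Proof.
elim: n => [|n IH]; first by rewrite mul0r addr0 expr0 mul1r.
by rewrite -natr1 mulrDl mul1r addrA sinDpi IH exprS mulN1r mulNr.
Qed.

(** With [l = cos (x - u)], the bound [1 <= `|sin (x - u)| + l ^+ 2] splits the mean of the
    symbol into an integral with respect to [l], computed by [asymb], and a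
    term controlled by [B]. Three half-turns on which [sin (x - u)] keeps its
    sign cover the arcs. *)
Lemma ray_varX_density (B : R) :
  (forall l, -1 <= l <= 1 -> l ^+ 2 * symb a t l <= B) ->
  varX P X <= 3 * arc_density theta * (asymb a t 1 - asymb a t (-1) + B * pi).
Proof.
move=> hB; have p0 := pi_gt0 R.
have [u0 u1] := andP hu; have [t0 t1] := andP htheta.
pose D := asymb a t 1 - asymb a t (-1) + B * pi.
rewrite ray_varX -[leRHS]mulrA [3 * _]mulrC -mulrA.
pose F i x := (-1) ^+ i * asymb a t (cos (x - u)) + B * x.
pose f i x := - (-1) ^+ i * sin (x - u) * symb a t (cos (x - u)) + B.
pose b i := u + i%:R * pi : R.
pose c i := u + i%:R * pi - pi : R.
have FD i : F i (b i) - F i (c i) = D.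
  have cb : cos (b i - u) = (-1) ^+ i.
    by rewrite /b (_ : _ - u = 0 + i%:R * pi) ?cosDnpi ?cos0 ?mulr1//; ring.
  have cc : cos (c i - u) = - (-1) ^+ i.
    by rewrite -[LHS]opprK -cosDpi /c (_ : _ + pi = 0 + i%:R * pi) ?cosDnpi ?cos0 ?mulr1//; ring.
  rewrite /F cb cc /D /b /c -signr_odd; case: (odd i); rewrite ?expr1 ?expr0 ?opprK; ring.
have -> : (asymb a t 1 - asymb a t (-1) + B * pi) * 3 = \sum_(i < 3) (F i (b i) - F i (c i)).
  by under eq_bigr do rewrite FD; rewrite sumr_const card_ord mulr_natr.
apply: (@arc_mean_le_cover R theta theta0 3 _ F f).
- exact: measurable_symb_dir.
- by move=> x; exact: symb_ge0.
- move=> x [j /= j4]; rewrite in_itv /= => /andP[x0 x1].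
  have j3 : j%:R <= 3 :> R by rewrite ler_nat -ltnS.
  have j0 : 0 <= j%:R :> R by [].
  have y0 : - (pi / 2) <= x - u by nra.
  have y1 : x - u <= 7 / 4 * pi by nra.
  case: (leP (x - u) 0) => h0; first by exists 0%N => //; rewrite /b /c; apply/andP; split; lra.
  case: (leP (x - u) pi) => h1; first by exists 1%N => //; rewrite /b /c; apply/andP; split; lra.
  by exists 2%N => //; rewrite /b /c; apply/andP; split; lra.
- by move=> i; rewrite /b /c; lra.
- move=> i x; apply: cvgD; last exact: cvg_cst.
  apply: cvgM; last first.
    by apply: continuous_comp; [exact: continuous_cosB|exact: continuous_symb].
  by apply: cvgMr; exact: continuous_sinB.
- move=> i x; apply: is_deriveD; last exact: is_derive_linear.
  have := is_derive_scale ((-1) ^+ i) (is_derive_comp_dir x (is_derive_asymb a t)).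
  by rewrite mulrN mulNr mulrA mulrAC mulNr.
- move=> i x; rewrite /b /c => /andP[x0 x1].
  pose y := x - u - i%:R * pi + pi.
  have sxy : - (-1) ^+ i * sin (x - u) = sin y.
    rewrite /y sinDpi mulNr (_ : x - u = x - u - i%:R * pi + i%:R * pi); last by ring.
    by rewrite sinDnpi mulrA -expr2 sqrr_sign mul1r addrK.
  have y0 : 0 <= sin y by apply: sin_ge0_pi; rewrite /y; apply/andP; split; lra.
  have y1 : sin y ^+ 2 = sin (x - u) ^+ 2 by rewrite -sxy exprMn sqrrN sqrr_sign mul1r.
  rewrite /f sxy; set S := symb _ _ _.
  have S0 : 0 <= S by exact: symb_ge0.
  have := hB (cos (x - u)); rewrite cos_geN1 cos_le1 -/S => /(_ isT) hS.
  have e : S = cos (x - u) ^+ 2 * S + sin y ^+ 2 * S by rewrite y1 -mulrDl cos2Dsin2 mul1r.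
  have h : sin y ^+ 2 * S <= sin y * S by rewrite ler_wpM2r// expr2 ler_piMr// sin_le1.
  by lra.
Qed.

End symbol_bounds.

End segment_field.

(** * Variance bounds for particular combinations *)

Section exponential_sums.
Context {R : realType}.

Lemma sin_period (x : R) (i j : nat) : sin (x + 2 * pi * (i%:R - j%:R)) = sin x.
Proof.
have per (y : R) (k : nat) : sin (y + 2 * pi * k%:R) = sin y.
  have -> : y + 2 * pi * k%:R = y + (k * 2)%:R * pi by rewrite natrM; ring.
  by rewrite sinDnpi exprM sqrr_sign mul1r.
by rewrite -(per _ j) -[RHS](per _ i); congr sin; ring.
Qed.

Lemma sinB_npi (i j : nat) : sin (pi * (i%:R - j%:R)) = 0 :> R.
Proof.
have -> : pi * (i%:R - j%:R) = pi * i%:R - pi * j%:R :> R by ring.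
have s0 (k : nat) : sin (pi * k%:R) = 0 :> R.
  by have := sinDnpi (0 : R) k; rewrite add0r mulrC sin0 mulr0.
by rewrite sinB !s0 mul0r mulr0 subrr.
Qed.

Lemma sin_sqr_lb (y : R) : `|y| <= pi / 2 -> y ^+ 2 <= (1 + y ^+ 2) * sin y ^+ 2.
Proof.
wlog y0 : y / 0 <= y.
  move=> H; case: (leP 0 y) => [/H//|y0 yp].
  have := H (- y); rewrite sinN !sqrrN normrN; apply=> //; lra.
rewrite ger0_norm// => yp.
have h : y * cos y <= sin y.
  rewrite -subr_ge0.
  have dF (x : R) : is_derive x 1 (fun x => sin x - x * cos x) (x * sin x).
    have := is_deriveB (is_derive_sin x) (is_deriveM (@is_derive_id R R x 1) (is_derive_cos x)).
    by move/is_derive_eq; apply; rewrite /GRing.scale /=; ring.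
  have := @is_derive_ge0_le_in R _ _ 0 y dF; rewrite sin0 mul0r subrr; apply => //.
  by move=> x /andP[x0 xy]; rewrite mulr_ge0// sin_ge0_pi// x0; have := pi_gt0 R; lra.
have s0 : 0 <= sin y by apply: sin_ge0_pi; rewrite y0 /=; lra.
have c2 := cos2Dsin2 y; have p0 := pi_gt0 R.
have c0 : 0 <= cos y by apply: cos_ge0_pihalf; rewrite yp andbT; lra.
have : y ^+ 2 * cos y ^+ 2 <= sin y ^+ 2 by rewrite -exprMn ler_pXn2r// nnegrE mulr_ge0.
have -> : cos y ^+ 2 = 1 - sin y ^+ 2 by lra.
by lra.
Qed.

(** The geometric sum of the [expi (k * x)], cleared of its denominator. *)
Lemma dirichlet_le (n : nat) (x : R) :
  sin (x / 2) ^+ 2 * ((\sum_(k < n) cos (k%:R * x)) ^+ 2 + (\sum_(k < n) sin (k%:R * x)) ^+ 2) <= 1.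
Proof.
pose A := n%:R * x - x / 2; pose B := x / 2.
have hC : 2 * sin B * \sum_(k < n) cos (k%:R * x) = sin A + sin B.
  rewrite /A; elim: n {A} => [|n IH].
    by rewrite big_ord0 mulr0 mul0r sub0r sinN addNr.
  rewrite big_ord_recr /= mulrDr IH (_ : n.+1%:R = n%:R + 1); last by rewrite natr1.
  have -> : (n%:R + 1) * x - x / 2 = n%:R * x + B by rewrite /B; field.
  by rewrite -/B sinB sinD; ring.
have hS : 2 * sin B * \sum_(k < n) sin (k%:R * x) = cos B - cos A.
  rewrite /A; elim: n {A hC} => [|n IH].
    by rewrite big_ord0 mulr0 mul0r sub0r cosN subrr.
  rewrite big_ord_recr /= mulrDr IH (_ : n.+1%:R = n%:R + 1); last by rewrite natr1.
  have -> : (n%:R + 1) * x - x / 2 = n%:R * x + B by rewrite /B; field.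
  by rewrite -/B cosB cosD; ring.
have : 4 * (sin B ^+ 2 * ((\sum_(k < n) cos (k%:R * x)) ^+ 2 + (\sum_(k < n) sin (k%:R * x)) ^+ 2))
   = 2 - 2 * cos (A + B).
  transitivity ((sin A + sin B) ^+ 2 + (cos B - cos A) ^+ 2).
    by rewrite -hC -hS; ring.
  rewrite (cosD A B); have := cos2Dsin2 A; have := cos2Dsin2 B => h1 h2.
  transitivity ((cos A ^+ 2 + sin A ^+ 2) + (cos B ^+ 2 + sin B ^+ 2) + 2 * (sin A * sin B - cos A * cos B)).
    by ring.
  by rewrite h1 h2; ring.
by have := cos_geN1 (A + B); lra.
Qed.

(** Exponentials with frequencies in [D * Z] are orthogonal on any interval of
    length [1 / D]. *)
Lemma icos_full_period (l0 : R) (D i j : nat) : (0 < D)%N ->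
  let w := 2 * pi * (D%:R * (i%:R - j%:R)) in
  icos w (l0 + D%:R^-1) - icos w l0 = if i == j then D%:R^-1 else 0.
Proof.
move=> D0 w; have Dn : D%:R != 0 :> R by rewrite pnatr_eq0 -lt0n.
case: eqP => ij; first by rewrite /icos /w ij subrr !mulr0 eqxx addrAC subrr add0r.
have w0 : w != 0.
  have ne : i%:R - j%:R != 0 :> R by rewrite subr_eq0 eqr_nat; apply/eqP.
  by rewrite /w !mulf_neq0// gt_eqF// pi_gt0.
rewrite /icos (negbTE w0) (_ : w * (l0 + D%:R^-1) = w * l0 + 2 * pi * (i%:R - j%:R)).
  by rewrite sin_period subrr.
by rewrite /w; field.
Qed.

End exponential_sums.

Section triangle_weight.
Context {R : realType}.

(** An antiderivative of [(1 - l / a) * cos (w * l)] in [l]. *)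
Definition wcos (a w l : R) : R :=
  if w == 0 then l - l ^+ 2 / (2 * a)
  else (1 - l / a) * (sin (w * l) / w) - cos (w * l) / (a * w ^+ 2).

Lemma is_derive_wcos (a w l : R) : 0 < a -> is_derive l 1 (wcos a w) ((1 - l / a) * cos (w * l)).
Proof.
move=> a0; have an : a != 0 by rewrite gt_eqF.
have dw (x : R) : is_derive x (1:R) (fun x : R => 1 - x / a) (- a^-1).
  have h := is_derive_scale a^-1 (@is_derive_id R R x 1).
  under eq_fun do rewrite mulrC.
  have := is_deriveB (@is_derive_cst R R R 1 x 1) h.
  by rewrite sub0r mulr1.
have [->|w0] := eqVneq w 0.
  rewrite mul0r cos0 mulr1 (_ : wcos a 0 = fun x => x - (2 * a)^-1 * (x * x)); last first.
    by apply/funext => x; rewrite /wcos eqxx mulrC expr2.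
  have := is_deriveB (@is_derive_id R R l 1) (is_derive_scale (2 * a)^-1 (is_deriveM (@is_derive_id R R l 1) (@is_derive_id R R l 1))).
  by move/is_derive_eq; apply; rewrite /GRing.scale /=; field.
rewrite (_ : wcos a w = fun x => (1 - x / a) * (icos w x) - (a * w ^+ 2)^-1 * cos (w * x)); last first.
  by apply/funext => x; rewrite /wcos /icos (negbTE w0) [_ * cos _]mulrC.
have h1 := is_deriveM (dw l) (is_derive_icos w l).
have h2 := @is_derive1_comp R cos (fun l => w * l) l _ _ (@is_derive_cos R (w * l)) (is_derive_linear w l).
have := is_deriveB h1 (is_derive_scale (a * w ^+ 2)^-1 h2).
move/is_derive_eq; apply; rewrite /GRing.scale /= /icos (negbTE w0); field.
by rewrite an w0.
Qed.

(** The Fourier transform of a triangular weight is a Fejer kernel: it is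
    nonnegative, and comparable to its maximum at low frequencies. *)
Lemma wcos_diff (a w : R) : 0 < a -> 0 <= wcos a w a - wcos a w 0 /\
  (`|a * w| <= 2 -> a / 4 <= wcos a w a - wcos a w 0).
Proof.
move=> a0; have an : a != 0 by rewrite gt_eqF.
rewrite /wcos; case: eqP => [_|/eqP w0].
  have -> : a - a ^+ 2 / (2 * a) - (0 - 0 ^+ 2 / (2 * a)) = a / 2 by field.
  by split=> *; lra.
have -> : (1 - a / a) * (sin (w * a) / w) - cos (w * a) / (a * w ^+ 2) -
  ((1 - 0 / a) * (sin (w * 0) / w) - cos (w * 0) / (a * w ^+ 2)) = (1 - cos (w * a)) / (a * w ^+ 2).
  by rewrite mulr0 sin0 cos0; field; rewrite an w0.
have d0 : 0 < a * w ^+ 2 by rewrite mulr_gt0// exprn_even_gt0.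
split; first by rewrite divr_ge0 ?(ltW d0)// subr_ge0 cos_le1.
move=> aw; rewrite ler_pdivlMr// (cos_half (w * a)) opprB addrC subrK.
have h : `|w * a / 2| <= pi / 2.
  have := pi_ge2 R; rewrite normrM (ger0_norm (_ : 0 <= 2^-1))// mulrC -[w * a]mulrC; lra.
have := sin_sqr_lb h; set s := sin _; set y := w * a / 2.
have y1 : y ^+ 2 <= 1.
  rewrite -real_normK ?num_real// exprn_ile1// /y normrM (ger0_norm (_ : 0 <= 2^-1))// -[w * a]mulrC; lra.
have -> : a / 4 * (a * w ^+ 2) = y ^+ 2 by rewrite /y; field.
by have := ler_wpM2r (sqr_ge0 s) y1; lra.
Qed.

End triangle_weight.

Section complex_modulus.
Context {R : realType}.

Definition cpx_nsq (z : R[i]) : R := complex.Re z ^+ 2 + complex.Im z ^+ 2.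

Lemma cpx_nsq_ge0 z : 0 <= cpx_nsq z. Proof. by rewrite addr_ge0 ?sqr_ge0. Qed.

Lemma cpx_nsqM z y : cpx_nsq (z * y) = cpx_nsq z * cpx_nsq y.
Proof. by case: z y => a b [c e]; rewrite /cpx_nsq /=; ring. Qed.

Lemma cpx_nsqX z n : cpx_nsq (z ^+ n) = cpx_nsq z ^+ n.
Proof.
elim: n => [|n IH]; first by rewrite !expr0 /cpx_nsq /=; ring.
by rewrite !exprS cpx_nsqM IH.
Qed.

Lemma expiX (x : R) n : expi x ^+ n = expi (n%:R * x).
Proof.
elim: n => [|n IH]; first by rewrite expr0 mul0r expi0.
by rewrite exprS IH -expiD; congr expi; rewrite -natr1; ring.
Qed.

Lemma symb_nsq (I : finType) (a t : I -> R) (l : R) :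
  symb a t l = cpx_nsq (\sum_i (a i)%:C%C * expi (2 * pi * t i * l)).
Proof.
rewrite /cpx_nsq complex_sum /=; congr (_ ^+ 2 + _ ^+ 2); apply: eq_bigr => i _.
  by rewrite /= mul0r subr0.
by rewrite /= mul0r addr0.
Qed.

Definition cabs (z : R[i]) : R := Num.sqrt (cpx_nsq z).

Lemma cabs_ge0 z : 0 <= cabs z. Proof. exact: sqrtr_ge0. Qed.

Lemma cabs_sqr z : cabs z ^+ 2 = cpx_nsq z.
Proof. by rewrite sqr_sqrtr ?cpx_nsq_ge0. Qed.

Lemma cabsN z : cabs (- z) = cabs z.
Proof. by case: z => a b; rewrite /cabs /cpx_nsq /= !sqrrN. Qed.

Lemma cabsM z y : cabs (z * y) = cabs z * cabs y.
Proof. by rewrite /cabs cpx_nsqM sqrtrM ?cpx_nsq_ge0. Qed.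

Lemma cabs_real (k : R) : cabs k%:C%C = `|k|.
Proof. by rewrite /cabs /cpx_nsq /= expr0n addr0 sqrtr_sqr. Qed.

Lemma cabsX z n : cabs (z ^+ n) = cabs z ^+ n.
Proof.
elim: n => [|n IH]; first by rewrite !expr0 -[1 in LHS](rmorph1 (real_complex R)) cabs_real normr1.
by rewrite !exprS cabsM IH.
Qed.

Lemma cabs_expi x : cabs (expi x) = 1.
Proof. by rewrite /cabs /cpx_nsq /= cos2Dsin2 sqrtr1. Qed.

Lemma cabsD z y : cabs (z + y) <= cabs z + cabs y.
Proof.
have E (v : R[i]) : cabs v = Normc.normc v by case: v.
by rewrite !E; exact: le_normcD.
Qed.

Lemma cabs_sum (J : Type) (r : seq J) (Q : pred J) (F : J -> R[i]) :
  cabs (\sum_(j <- r | Q j) F j) <= \sum_(j <- r | Q j) cabs (F j).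
Proof.
elim: r => [|j r IH]; first by rewrite !big_nil -(rmorph0 (real_complex R)) cabs_real normr0.
rewrite !big_cons; case: ifP => // _; apply: le_trans (cabsD _ _) _.
by rewrite lerD2l.
Qed.

Lemma Re_le_cabs z : `|complex.Re z| <= cabs z.
Proof. by rewrite -sqrtr_sqr ler_wsqrtr// lerDl sqr_ge0. Qed.

Lemma cabs_expi_sub1 x : cabs (1 - expi x) <= `|x|.
Proof.
rewrite -sqrtr_sqr ler_wsqrtr//; have := chord_le 0 x.
rewrite cos0 sin0 !sub0r !sqrrN => h.
by apply: le_trans h; rewrite /cpx_nsq /= sub0r sqrrN.
Qed.

Lemma expr1D_wide (A : comNzRingType) (x : A) (n N : nat) : (n <= N)%N ->
  (1 + x) ^+ n = \sum_(i < N.+1) x ^+ i *+ 'C(n, i).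
Proof.
move=> nN; rewrite exprDn; under eq_bigr do rewrite expr1n mul1r.
rewrite (big_ord_widen N.+1 (fun i => x ^+ i *+ 'C(n, i))) ?ltnS// big_mkcond /=.
by apply: eq_bigr => i _; case: ifPn => //; rewrite -ltnNge ltnS => h; rewrite bin_small.
Qed.

End complex_modulus.

Lemma monomial_regroup (A : comNzRingType) (x y s : A) (a b : nat) :
  x * (s * y *+ b) *+ a = s * a%:R * b%:R * (x * y).
Proof. by rewrite -[_ *+ a]mulr_natr -[_ *+ b]mulr_natr; ring. Qed.

Section extrapolation.
Context {R : realType} (M k0 : nat).

(** Coefficients of [\sum_(k0 <= j) 'C(M, j) z ^ j (1 - z) ^ (M - j)], the
    degree [M] polynomial divisible by [z ^ k0] which is close to 1 near
    [z = 1], expanded in monomials. *)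
Definition cutoff_coef (p : 'I_M.+1 * 'I_M.+1) : R :=
  if (k0 <= p.1)%N then (-1) ^+ p.2 * 'C(M, p.1)%:R * 'C(M - p.1, p.2)%:R else 0.

Lemma cutoff_coef_range p : cutoff_coef p != 0 -> (k0 <= p.1 + p.2 <= M)%N.
Proof.
rewrite /cutoff_coef; case: ifP => [k1|]; last by rewrite eqxx.
case: (leqP p.2 (M - p.1)) => h; last by rewrite (bin_small h) mulr0 eqxx.
move=> _; have := ltn_ord p.1; lia.
Qed.

Lemma cutoff_coef_sum : \sum_p `|cutoff_coef p| <= 3 ^+ M.
Proof.
rewrite -(pair_bigA _ (fun j i => `|cutoff_coef (j, i)|)) /=.
have -> : 3 ^+ M = \sum_(j < M.+1) \sum_(i < M.+1) 'C(M, j)%:R * 'C(M - j, i)%:R :> R.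
  have -> : 3 = 2 + 1 :> R by ring.
  rewrite exprDn; apply: eq_bigr => j _; rewrite expr1n mulr1 -mulr_sumr mulrC mulr_natr; congr (_ *+ _).
  have := @expr1D_wide R 1 (M - j) M (leq_subr _ _); rewrite -[1 + 1]/2 => ->.
  by apply: eq_bigr => i _; rewrite expr1n.
apply: ler_sum => j _; apply: ler_sum => i _; rewrite /cutoff_coef /=.
by case: ifP => _; rewrite ?normr0 ?mulr_ge0// !normrM normrX normrN1 expr1n mul1r !ger0_norm.
Qed.

(** At [z = expi psi] the whole binomial sum is [(z + (1 - z)) ^+ M = 1], and the terms
    with [j < k0] are small because [`|1 - z| <= q]. *)
Lemma cutoff_lb (phi psi q : R) : `|phi| <= q -> `|psi| <= q -> q <= 1 / 4 ->
  (k0 <= M)%N -> 2 ^+ M * q ^+ (M - k0).+1 <= 1 / 4 ->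
  1 / 2 <= \sum_p cutoff_coef p * cos (phi + (p.1 + p.2)%:R * psi).
Proof.
move=> hphi hpsi q4 kM hM.
have q0 : 0 <= q := le_trans (normr_ge0 _) hphi.
pose z := expi psi.
pose Tj (j : nat) : R[i] := z ^+ j * (1 - z) ^+ (M - j) *+ 'C(M, j).
have tot : \sum_(j < M.+1) Tj j = 1.
  have := @exprDn _ (1 - z) z M; rewrite subrK expr1n => ->.
  by apply: eq_bigr => j _; rewrite /Tj mulrC.
pose Tlow := \sum_(j < M.+1 | (j < k0)%N) Tj j.
have low : cabs Tlow <= 1 / 4.
  apply: le_trans (cabs_sum _ _ _) _; apply: le_trans hM.
  apply: (@le_trans _ _ (\sum_(j < M.+1 | (j < k0)%N) 'C(M, j)%:R * q ^+ (M - k0).+1)).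
    apply: ler_sum => j jk; rewrite /Tj -mulr_natr -[_%:R](rmorph_nat (real_complex R)) !cabsM cabs_real.
    rewrite !cabsX cabs_expi expr1n mul1r ger0_norm// mulrC ler_wpM2l//.
    have h1 : cabs (1 - z) <= q := le_trans (cabs_expi_sub1 _) hpsi.
    apply: (@le_trans _ _ (q ^+ (M - j))); first by rewrite lerXn2r ?nnegrE ?cabs_ge0.
    by apply: ler_wiXn2l => //; [lra|lia].
  rewrite -mulr_suml ler_wpM2r ?exprn_ge0// big_mkcond.
  rewrite (_ : 2 ^+ M = \sum_(j < M.+1) 'C(M, j)%:R); first by apply: ler_sum => j _; case: ifP.
  have := @expr1D_wide R 1 M M (leqnn _); rewrite -[1 + 1]/2 => ->.
  by apply: eq_bigr => i _; rewrite expr1n.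
have E : \sum_p cutoff_coef p * cos (phi + (p.1 + p.2)%:R * psi) =
    complex.Re (expi phi * (1 - Tlow)).
  have -> : 1 - Tlow = \sum_p (cutoff_coef p)%:C%C * expi ((p.1 + p.2)%:R * psi).
    rewrite -tot (bigID (fun j : 'I_M.+1 => (j < k0)%N)) /= -/Tlow addrAC subrr add0r.
    rewrite -(pair_bigA _ (fun (j i : 'I_M.+1) => (cutoff_coef (j, i))%:C%C * expi ((j + i)%:R * psi))) /=.
    rewrite big_mkcond; apply: eq_bigr => j _; rewrite -leqNgt; case: ifP => kj; last first.
      by rewrite big1// => i _; rewrite /cutoff_coef /= kj mul0r.
    rewrite /Tj (@expr1D_wide _ (- z) (M - j) M (leq_subr _ _)) mulr_sumr -sumrMnl; apply: eq_bigr => i _.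
    rewrite /cutoff_coef /= kj -expiX exprD -/z [(- z) ^+ i]exprNn !rmorphM /= !rmorph_nat rmorphXn /= rmorphN1.
    exact: monomial_regroup.
  rewrite mulr_sumr complex_sum /=; apply: eq_bigr => p _.
  by rewrite cosD; ring.
rewrite E mulrBr mulr1.
have -> : complex.Re (expi phi - expi phi * Tlow) = cos phi - complex.Re (expi phi * Tlow).
  by case: (expi phi * Tlow).
have h1 : complex.Re (expi phi * Tlow) <= 1 / 4.
  apply: le_trans (ler_norm _) (le_trans (Re_le_cabs _) _).
  by rewrite cabsM cabs_expi mul1r.
have h2 := cos_lb phi.
have h3 : phi ^+ 2 <= 1 / 4.
  rewrite -real_normK ?num_real//; have := normr_ge0 phi; set x := `|_| in hphi *; nra.
lra.
Qed.

End extrapolation.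

Section symbol_extrapolation.
Context {R : realType}.

Lemma Cauchy_sum (J : finType) (a b : J -> R) :
  (\sum_j a j * b j) ^+ 2 <= (\sum_j a j ^+ 2) * \sum_j b j ^+ 2.
Proof.
have E : (\sum_j a j ^+ 2) * (\sum_j b j ^+ 2) =
   \sum_i \sum_j (a i ^+ 2 * b j ^+ 2 + a j ^+ 2 * b i ^+ 2) / 2.
  have h : \sum_i \sum_j a i ^+ 2 * b j ^+ 2 = \sum_i \sum_j a j ^+ 2 * b i ^+ 2 by rewrite exchange_big.
  have -> : \sum_i \sum_j (a i ^+ 2 * b j ^+ 2 + a j ^+ 2 * b i ^+ 2) / 2 =
      (\sum_i \sum_j a i ^+ 2 * b j ^+ 2 + \sum_i \sum_j a j ^+ 2 * b i ^+ 2) / 2.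
    rewrite -big_split mulr_suml; apply: eq_bigr => i _; rewrite -big_split mulr_suml.
    by apply: eq_bigr.
  rewrite -h mulr_suml; under eq_bigr do rewrite mulr_sumr.
  by set X := \sum_i _; lra.
rewrite E expr2 mulr_suml; apply: ler_sum => i _; rewrite mulr_sumr; apply: ler_sum => j _.
by have := sqr_ge0 (a i * b j - a j * b i); rewrite sqrrB !exprMn; lra.
Qed.

Lemma weighted_Cauchy (J : finType) (c x : J -> R) :
  (\sum_j c j * x j) ^+ 2 <= (\sum_j `|c j|) * \sum_j `|c j| * x j ^+ 2.
Proof.
have s j : Num.sqrt `|c j| ^+ 2 = `|c j| by rewrite sqr_sqrtr.
apply: (@le_trans _ _ ((\sum_j Num.sqrt `|c j| * (Num.sqrt `|c j| * `|x j|)) ^+ 2)).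
  rewrite -[leLHS]real_normK ?num_real// ler_pXn2r ?nnegrE//; last first.
    by apply: sumr_ge0 => j _; rewrite !mulr_ge0 ?sqrtr_ge0.
  apply: le_trans (ler_norm_sum _ _ _) _; apply: ler_sum => j _.
  by rewrite mulrA -expr2 s normrM.
apply: le_trans (Cauchy_sum _ _) _.
under eq_bigr do rewrite s.
by under [X in _ * X]eq_bigr do rewrite exprMn s real_normK ?num_real//.
Qed.

(** For nonnegative amplitudes the symbol at 0 is [(\sum_i m i) ^+ 2]. By
    [cutoff_lb] the sum is controlled by its values at frequencies
    [y + k * eta] with [k0 <= k <= M]; averaging over [y] in [[0, eta]] turns these values
    into the integral of the symbol over [[eta * k0, eta * M.+1]]. *)
Lemma asymb_extrapolation (I : finType) (m t : I -> R) (M k0 : nat) (eta q : R) :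
  0 < eta -> (forall i, 0 <= m i) -> (forall i, 0 <= t i) -> (forall i, 2 * pi * eta * t i <= q) ->
  q <= 1 / 4 -> (k0 <= M)%N -> 2 ^+ M * q ^+ (M - k0).+1 <= 1 / 4 ->
  eta * (\sum_i m i) ^+ 2 / 4 <= 9 ^+ M * (asymb m t (eta * M.+1%:R) - asymb m t (eta * k0%:R)).
Proof.
move=> eta0 m0 t0 tq q4 kM hM.
have p0 := pi_gt0 R.
pose c p := @cutoff_coef R M k0 p.
pose k (p : 'I_M.+1 * 'I_M.+1) : R := (p.1 + p.2)%:R * eta.
have lbd y : 0 <= y <= eta ->
    (\sum_i m i) ^+ 2 / 4 <= 3 ^+ M * \sum_p `|c p| * symb m t (y + k p).
  move=> /andP[y0 y1].
  pose C p := \sum_i m i * cos (2 * pi * t i * (y + k p)).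
  have h1 : (\sum_i m i) / 2 <= \sum_p c p * C p.
    rewrite (eq_bigr (fun p => \sum_i c p * (m i * cos (2 * pi * t i * (y + k p))))); last first.
      by move=> p _; rewrite mulr_sumr.
    rewrite exchange_big /= mulr_suml; apply: ler_sum => i _.
    rewrite (eq_bigr (fun p => m i * (c p * cos (2 * pi * t i * y + (p.1 + p.2)%:R * (2 * pi * eta * t i))))); last first.
      by move=> p _; rewrite mulrCA /k; congr (_ * (_ * cos _)); ring.
    rewrite -mulr_sumr ler_wpM2l// -div1r.
    apply: (@cutoff_lb R M k0 _ _ q) => //.
      rewrite ger0_norm ?mulr_ge0 ?(ltW p0)//; apply: le_trans (tq i).
      by rewrite -2!mulrA -2![leRHS]mulrA !ler_pM2l// mulrC ler_wpM2r.
    by rewrite ger0_norm// !mulr_ge0 ?(ltW p0) ?(ltW eta0).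
  have S0 : 0 <= \sum_i m i by exact: sumr_ge0.
  have h2 : (\sum_i m i) ^+ 2 / 4 <= (\sum_p c p * C p) ^+ 2.
    have -> : (\sum_i m i) ^+ 2 / 4 = ((\sum_i m i) / 2) ^+ 2 by field.
    by rewrite ler_pXn2r// nnegrE ?divr_ge0// (le_trans _ h1)// divr_ge0.
  apply: (le_trans h2); apply: (le_trans (weighted_Cauchy _ _)).
  apply: ler_pM => //; [exact: sumr_ge0| |exact: cutoff_coef_sum|].
    by apply: sumr_ge0 => p _; rewrite mulr_ge0 ?sqr_ge0.
  by apply: ler_sum => p _; rewrite ler_wpM2l// /symb -/(C p) lerDl sqr_ge0.
pose Phi y := 3 ^+ M * \sum_p `|c p| * asymb m t (y + k p) - (\sum_i m i) ^+ 2 / 4 * y.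
have dPhi (y : R) : is_derive y 1 Phi (3 ^+ M * (\sum_p `|c p| * symb m t (y + k p)) - (\sum_i m i) ^+ 2 / 4).
  apply: is_deriveB; last exact: is_derive_linear.
  apply: is_derive_scale.
  apply: (is_derive_bigsum _ (f := fun p y => `|c p| * symb m t (y + k p))) => p.
  apply: is_derive_scale.
  have h : is_derive y (1:R) (fun y : R => y + k p) 1.
    by have := is_deriveD (@is_derive_id R R y 1) (@is_derive_cst R R R (k p) y 1); rewrite addr0.
  by have := @is_derive1_comp R (asymb m t) (fun y => y + k p) y _ _ (is_derive_asymb m t _) h; rewrite mulr1.
have := is_derive_ge0_le_in dPhi (a := 0) (b := eta) _ (ltW eta0).
have h0 : forall x, 0 <= x <= eta -> 0 <= 3 ^+ M * (\sum_p `|c p| * symb m t (x + k p)) - (\sum_i m i) ^+ 2 / 4.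
  by move=> x /lbd h; rewrite subr_ge0.
move=> /(_ h0); rewrite /Phi mulr0 subr0.
set D := asymb m t (eta * _) - _.
have D0 : 0 <= D by rewrite subr_ge0; apply: asymb_le; rewrite ler_pM2l// ler_nat; lia.
have hs : \sum_p `|c p| * asymb m t (eta + k p) - \sum_p `|c p| * asymb m t (0 + k p) <= 3 ^+ M * D.
  rewrite -sumrB; apply: le_trans (ler_wpM2r D0 (@cutoff_coef_sum R M k0)).
  rewrite mulr_suml; apply: ler_sum => p _; rewrite -mulrBr -/(c p).
  have [->|cp] := eqVneq (c p) 0; first by rewrite normr0 !mul0r.
  have /andP[h1 h2] := cutoff_coef_range cp.
  rewrite ler_wpM2l//; apply: lerB; apply: asymb_le; rewrite /k.
    have -> : eta + (p.1 + p.2)%:R * eta = eta * (p.1 + p.2).+1%:R by rewrite -[in RHS]natr1; ring.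
    by rewrite ler_pM2l// ler_nat ltnS.
  by rewrite add0r mulrC ler_pM2r// ler_nat.
have e9 : 9 ^+ M = 3 ^+ M * 3 ^+ M :> R by rewrite -exprMn; congr (_ ^+ _); ring.
move=> hh; have := ler_wpM2l (exprn_ge0 M (ler0n R 3)) hs.
rewrite mulrBr e9 -mulrA; lra.
Qed.

End symbol_extrapolation.

Section variance_bounds.
Context d (T : measurableType d) (R : realType) (P : probability T R).
Context (u theta : R) (Psi : R * R -> {RV P >-> R}).
Hypothesis (hu : 0 <= u <= pi / 4) (htheta : 0 < theta <= pi / 4).
Hypothesis hPsi : gaussian_field_with_spectral_measure (sigma_arcs theta) Psi.
Notation ray := (ray u Psi).

Let theta0 : 0 < theta. Proof. by case/andP: htheta. Qed.
Let kap0 := arc_density_gt0 theta0.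
Let p0 := pi_gt0 R.

Lemma sin_band : sin (u - theta) < sin (u + theta).
Proof.
have [u0 u1] := andP hu; have [t0 t1] := andP htheta.
by rewrite ltr_sin ?in_itv /=; [lra|apply/andP; split; lra|apply/andP; split; lra].
Qed.

(** The spectral measure on the line dominates a multiple of the Lebesgue
    measure on an interval of length [1 / D], on which the exponentials of
    samples spaced by [D] are orthogonal. *)
Lemma ray_spaced_lb : exists (D : nat) (c : R), [/\ (0 < D)%N, 0 < c &
  forall (N : nat) (tau : R) (x : 'I_N -> R), c * \sum_j x j ^+ 2 <=
    varX P (fun w => \sum_j x j * ray (tau + D%:R * j%:R) w)].
Proof.
pose e := sin (u + theta) - sin (u - theta).
have e0 : 0 < e by rewrite subr_gt0 sin_band.
pose D := Num.bound e^-1.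
have De : e^-1 < D%:R by apply: archi_boundP; rewrite invr_ge0 ltW.
have Dp : 0 < D%:R :> R by apply: lt_trans De; rewrite invr_gt0.
have D0 : (0 < D)%N by rewrite -(ltr0n R).
exists D, (arc_density theta / D%:R); split=> //; first by rewrite divr_gt0.
move=> N tau x; set t := fun j : 'I_N => tau + D%:R * j%:R.
have tE i j : t i - t j = D%:R * (i%:R - j%:R) by rewrite /t; ring.
have De' : D%:R^-1 <= e by rewrite invf_ple ?posrE ?ltW.
have := @ray_varX_ge _ _ _ P u theta Psi hu htheta hPsi _ x t (asymb x t) (symb x t)
  (sin (u - theta)) (sin (u - theta) + D%:R^-1).
set V := varX _ _; have -> : asymb x t (sin (u - theta) + D%:R^-1) - asymb x t (sin (u - theta)) =
    D%:R^-1 * \sum_j x j ^+ 2.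
  rewrite /asymb -sumrB mulr_sumr; apply: eq_bigr => i _.
  rewrite -sumrB (bigD1 i)//= big1 => [|j ji].
    by rewrite -mulrBr tE icos_full_period// eqxx addr0; ring.
  rewrite -mulrBr tE icos_full_period// ifF ?mulr0//.
  by apply/negbTE; move: ji; rewrite -val_eqE eq_sym.
rewrite mulrA; apply.
- exact: lexx.
- by rewrite lerDl invr_ge0 ltW.
- by move: De'; rewrite /e; lra.
- exact: continuous_symb.
- by move=> l; exact: is_derive_asymb.
- by move=> l _; rewrite symb_ge0 lexx.
Qed.

(** With spacing [1 / 2], the frequencies in [[- 1, 1]] form one full period, over which the
    exponential sum has mean square [n]; away from frequency 0 the sum is
    bounded by [dirichlet_le], which compensates the unbounded density of the
    spectral measure at -1 and 1. *)
Lemma ray_sum_var (n : nat) :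
  varX P (fun w => \sum_(k < n) 1 * ray (k%:R / 2) w) <=
  3 * arc_density theta * (2 * n%:R + 2 * pi).
Proof.
pose t (k : 'I_n) : R := k%:R / 2; pose a := fun _ : 'I_n => 1 : R.
have hB l : -1 <= l <= 1 -> l ^+ 2 * symb a t l <= 2.
  move=> /andP[l0 l1].
  have := dirichlet_le n (pi * l).
  set S := (X in _ * X <= _ -> _); have -> : symb a t l = S.
    by congr (_ ^+ 2 + _ ^+ 2); apply: eq_bigr => k _; rewrite mul1r /t; congr (_ _); field.
  have S0 : 0 <= S by rewrite addr_ge0 ?sqr_ge0.
  pose y := pi * l / 2; rewrite -/y => h.
  have yp : `|y| <= pi / 2.
    have -> : y = pi / 2 * l by rewrite /y; field.
    have l1' : `|l| <= 1 by rewrite ler_norml l0.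
    by rewrite normrM ger0_norm ?ler_piMr// divr_ge0// ltW.
  have hy := sin_sqr_lb yp.
  have p2 : 2 <= pi :> R by exact: pi_ge2.
  have yl : l ^+ 2 <= y ^+ 2.
    have -> : y ^+ 2 = (pi / 2) ^+ 2 * l ^+ 2 by rewrite /y; field.
    by rewrite ler_peMl ?sqr_ge0// expr_ge1//; lra.
  have s1 : sin y ^+ 2 <= 1 by have := cos2Dsin2 y; have := sqr_ge0 (cos y); lra.
  have l2 : l ^+ 2 <= 1 by rewrite expr2; nra.
  have hl : l ^+ 2 * (1 - sin y ^+ 2) <= y ^+ 2 * (1 - sin y ^+ 2) by rewrite ler_wpM2r// subr_ge0.
  have ls : l ^+ 2 <= 2 * sin y ^+ 2.
    have := ler_wpM2r (sqr_ge0 (sin y)) l2; lra.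
  apply: (le_trans (ler_wpM2r S0 ls)); rewrite -mulrA; lra.
have := @ray_varX_density _ _ _ P u theta Psi hu htheta hPsi _ a t 2 hB.
suff -> : asymb a t 1 - asymb a t (-1) = 2 * n%:R by [].
rewrite /asymb -sumrB.
have tE i j : 2 * pi * (t i - t j) = pi * (i%:R - j%:R) by rewrite /t; field.
rewrite (eq_bigr (fun=> 2)); first by rewrite sumr_const card_ord mulr_natr.
move=> i _; rewrite -sumrB (bigD1 i)//= big1 => [|j ji].
  by rewrite tE subrr mulr0 /icos eqxx /a; ring.
rewrite tE /icos; have ne : i%:R - j%:R != 0 :> R.
  by rewrite subr_eq0 eqr_nat; move: ji; rewrite -val_eqE eq_sym.
by rewrite mulf_eq0 (negbTE ne) gt_eqF//= mulr1 mulrN1 sinN sinB_npi oppr0 mul0r mulr0 subrr.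
Qed.

(** When [theta < u] no direction in the arcs is orthogonal to the segment: the
    spectral measure on the line has a gap around 0. *)
Lemma dir_away (x : R) : theta < u -> arc_angles theta x ->
  Num.min (cos (u + theta)) (sin (u - theta)) <= `|cos (x - u)|.
Proof.
move=> tu [j /= j4]; rewrite in_itv /= => /andP[x0 x1].
have [u0 u1] := andP hu; have [t0 t1] := andP htheta.
pose v := u - (x - j%:R * (pi / 2)).
have v0 : u - theta <= v by rewrite /v; lra.
have v1 : v <= u + theta by rewrite /v; lra.
have xE : x - u = j%:R * (pi / 2) - v by rewrite /v; ring.
have cv : cos (u + theta) <= cos v.
  by rewrite leNgt ltr_cos ?in_itv /=; [rewrite -leNgt|apply/andP; split; lra|apply/andP; split; lra].
have sv : sin (u - theta) <= sin v.
  by rewrite leNgt ltr_sin ?in_itv /=; [rewrite -leNgt|apply/andP; split; lra|apply/andP; split; lra].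
rewrite ge_min xE.
move: (v) cv sv => {x0 x1 xE v0 v1 v} v cv sv.
case: j j4 => [|[|[|[|//]]]] _; apply/orP.
- by left; rewrite mul0r sub0r cosN (le_trans cv)// ler_norm.
- right; rewrite mul1r -[_ - v]addrC cosDpihalf sinN opprK; exact: le_trans (ler_norm _).
- left; rewrite (_ : _ - v = - v + pi) ?cosDpi ?cosN ?normrN; last by field.
  exact: le_trans (ler_norm _).
- right; rewrite (_ : _ - v = (- v + pi / 2) + pi) ?cosDpi ?cosDpihalf ?sinN ?opprK ?normrN; last by field.
  exact: le_trans (ler_norm _).
Qed.

(** The symbol of a binomial average of order [n] is
    [`|(1 + expi (pi * l)) / 2| ^+ (2 * n) = ((1 + cos (pi * l)) / 2) ^+ n], exponentially small
    outside the spectral gap. *)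
Lemma ray_binomial_var : theta < u -> exists2 rho : R, 0 < rho < 1 &
  forall N n D : nat, varX P (fun w => \sum_(p : 'I_N * 'I_n.+1)
    (2 ^- n * 'C(n, p.2)%:R) * ray (p.2%:R / 2 + D%:R * p.1%:R) w) <= N%:R ^+ 2 * rho ^+ n.
Proof.
move=> tu; have [u0 u1] := andP hu; have [t0 t1] := andP htheta.
pose g := Num.min (cos (u + theta)) (sin (u - theta)).
have g0 : 0 < g.
  by rewrite lt_min cos_gt0_pihalf ?sin_gt0_pi//; apply/andP; split; lra.
have g1 : g <= 1 by rewrite ge_min cos_le1.
have gp : pi * g <= pi by rewrite ler_piMr// ltW.
have c1 : cos (pi * g) < 1.
  by rewrite -cos0 ltr_cos ?in_itv /= ?lexx ?(ltW p0) ?gp ?mulr_gt0 ?mulr_ge0 ?(ltW g0) ?(ltW p0).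
exists (Num.max (1 / 2) ((1 + cos (pi * g)) / 2)).
  by rewrite lt_max gt_max; apply/andP; split; [apply/orP; left; lra|apply/andP; split; lra].
move=> N n D; set rho := Num.max _ _.
have rho0 : 0 <= rho by rewrite le_max; apply/orP; left; lra.
apply: (ray_varX_le htheta hPsi); first by rewrite mulr_ge0 ?exprn_ge0.
move=> x /(dir_away tu); rewrite -/g; set l := cos (x - u) => gl.
have l1 : `|l| <= 1 := cos_max _.
have cl : (1 + cos (pi * l)) / 2 <= rho.
  rewrite le_max; apply/orP; right; rewrite ler_pM2r ?invr_gt0// lerD2l.
  have -> : cos (pi * l) = cos (pi * `|l|).
    by case: (lerP 0 l) => h; rewrite ?(ger0_norm h)// ltr0_norm// mulrN cosN.
  rewrite leNgt ltr_cos ?in_itv /=.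
  - by rewrite -leNgt ler_pM2l.
  - by rewrite mulr_ge0 ?(ltW p0)//= ler_piMr// ltW.
  - by rewrite mulr_ge0 ?(ltW p0) ?(ltW g0).
rewrite symb_nsq.
pose z1 := \sum_(i < N) 1%:C%C * expi (2 * pi * (D%:R * i%:R) * l).
pose h : R[i] := 2^-1%:C%C * (1 + expi (pi * l)).
have -> : \sum_(p : 'I_N * 'I_n.+1) (2 ^- n * 'C(n, p.2)%:R)%:C%C *
   expi (2 * pi * (p.2%:R / 2 + D%:R * p.1%:R) * l) = z1 * h ^+ n.
  rewrite /z1 /h exprMn (exprDn 1 (expi (pi * l))) mulr_suml.
  rewrite -(pair_bigA _ (fun (i : 'I_N) (k : 'I_n.+1) => (2 ^- n * 'C(n, k)%:R)%:C%C *
   expi (2 * pi * (k%:R / 2 + D%:R * i%:R) * l))) /=; apply: eq_bigr => i _.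
  rewrite !mulr_sumr; apply: eq_bigr => k _.
  rewrite expr1n mul1r expiX -mulr_natr rmorphM /= rmorph_nat -exprVn rmorphXn /= rmorph1 mul1r.
  have -> : expi (2 * pi * (k%:R / 2 + D%:R * i%:R) * l) =
     expi (2 * pi * (D%:R * i%:R) * l) * expi (k%:R * (pi * l)).
    by rewrite -expiD; congr expi; field.
  ring.
rewrite cpx_nsqM cpx_nsqX; apply: ler_pM => //.
- exact: cpx_nsq_ge0.
- by rewrite exprn_ge0// cpx_nsq_ge0.
- rewrite -symb_nsq; apply: le_trans (symb_le_sqr _ _ _) _.
  by rewrite (eq_bigr (fun=> 1)) ?sumr_const ?card_ord// => i _; rewrite normr1.
- rewrite lerXn2r ?nnegrE ?cpx_nsq_ge0//; apply: le_trans cl.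
  rewrite le_eqVlt; apply/orP; left; apply/eqP.
  rewrite /h /cpx_nsq /expi /=; have := cos2Dsin2 (pi * l); set C := cos _; set S := sin _ => cs.
  transitivity ((1 + 2 * C + (C ^+ 2 + S ^+ 2)) / 4); first by field.
  by rewrite cs; field.
Qed.

(** When [u <= theta] the spectral measure dominates a triangular weight on
    [[0, a]], the Fourier transform of which is nonnegative. So for nonnegative
    amplitudes the contributions of pairs in different cells can be dropped,
    while pairs in a common cell contribute a fixed proportion. *)
Lemma ray_local_lb : u <= theta -> exists2 c : R, 0 < c &
  forall (I : finType) (l : nat) (t : I -> R) (cell : I -> 'I_l) (m : I -> R),
  (forall i j, cell i = cell j -> `|t i - t j| <= 1) -> (forall i, 0 <= m i) ->
  c * \sum_k (\sum_(i | cell i == k) m i) ^+ 2 <= varX P (fun w => \sum_i m i * ray (t i) w).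
Proof.
move=> ut; have [u0 u1] := andP hu; have [t0 t1] := andP htheta.
pose a := Num.min (1 / 4) (sin (u + theta)).
have a0 : 0 < a by rewrite lt_min sin_gt0_pi; [lra|apply/andP; split; lra].
have a4 : a <= 1 / 4 by rewrite ge_min lexx.
have au : a <= sin (u + theta) by rewrite ge_min lexx orbT.
exists (arc_density theta * (a / 4)); first by rewrite mulr_gt0 ?divr_gt0.
move=> I l t cell m tcell m0.
pose G (x : R) := \sum_i \sum_j m i * m j * wcos a (2 * pi * (t i - t j)) x.
have dG (x : R) : is_derive x 1 G ((1 - x / a) * symb m t x).
  rewrite symbE mulr_sumr.
  apply: (is_derive_bigsum _ (f := fun i x => (1 - x / a) * \sum_j m i * m j * cos (2 * pi * (t i - t j) * x))) => i.
  rewrite mulr_sumr.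
  apply: (is_derive_bigsum _ (f := fun j x => (1 - x / a) * (m i * m j * cos (2 * pi * (t i - t j) * x)))) => j.
  rewrite mulrCA; apply: is_derive_scale; exact: is_derive_wcos.
have cg : continuous (fun x : R => (1 - x / a) * symb m t x).
  move=> x; apply: cvgM; last exact: continuous_symb.
  by apply: cvgB; [exact: cvg_cst|apply: cvgMl; exact: cvg_id].
have s0 : sin (u - theta) <= 0.
  by rewrite -oppr_ge0 -sinN sin_ge0_pi//; apply/andP; split; lra.
have := @ray_varX_ge _ _ _ P u theta Psi hu htheta hPsi _ m t G (fun x => (1 - x / a) * symb m t x)
  0 a s0 (ltW a0) au cg dG.
have h0 : forall x, 0 <= x <= a -> 0 <= (1 - x / a) * symb m t x <= symb m t x.
  move=> x /andP[x0 xa].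
  have w0 : 0 <= 1 - x / a by rewrite subr_ge0 ler_pdivrMr// mul1r.
  by rewrite mulr_ge0 ?symb_ge0//= ler_piMl ?symb_ge0// gerBl divr_ge0// ltW.
move=> /(_ h0); apply: le_trans.
rewrite -mulrA ler_pM2l// /G -sumrB.
rewrite (eq_bigr (fun i => \sum_j m i * m j * (wcos a (2 * pi * (t i - t j)) a - wcos a (2 * pi * (t i - t j)) 0))); last first.
  by move=> i _; rewrite -sumrB; apply: eq_bigr => j _; rewrite -mulrBr.
rewrite mulr_sumr.
apply: (@le_trans _ _ (\sum_i \sum_(j | cell j == cell i) m i * m j * (a / 4))).
  rewrite (partition_big cell xpredT)//=; apply: ler_sum => k _.
  rewrite le_eqVlt; apply/orP; left; apply/eqP.
  rewrite expr2 mulr_suml mulr_sumr; apply: eq_bigr => i /eqP ik.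
  rewrite ik !mulr_sumr; apply: eq_bigr => j _; ring.
apply: ler_sum => i _; rewrite big_mkcond; apply: ler_sum => j _.
have [k0 k4] := @wcos_diff R a (2 * pi * (t i - t j)) a0.
case: ifP => [/eqP ij|_]; last by rewrite !mulr_ge0.
rewrite ler_wpM2l ?mulr_ge0// k4//.
have tij : `|t i - t j| <= 1 by exact: tcell.
rewrite !normrM (ger0_norm (ltW a0)) (ger0_norm (ltW p0)) ger0_norm//.
have p4 : pi <= 4 :> R by have [/andP[_ h] _] := pihalf_02_cos_pihalf R; lra.
have := normr_ge0 (t i - t j); set z := `|_| in tij * => z0.
have h1 : 2 * pi * z <= 8 by nra.
by have := ler_pM (ltW a0) (_ : 0 <= 2 * pi * z) a4 h1; rewrite !mulr_ge0 ?(ltW p0)// => /(_ isT); lra.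
Qed.

End variance_bounds.

Lemma monomial_regroup_left (A : comNzRingType) (s r x : A) (a b : nat) :
  s * (r * x *+ b) *+ a = s * r * a%:R * b%:R * x.
Proof. by rewrite -[_ *+ a]mulr_natr -[_ *+ b]mulr_natr; ring. Qed.

(** * Nonnegative combinations and predictability *)

Section extrapolated_variances.
Context d (T : measurableType d) (R : realType) (P : probability T R).
Context (u theta : R) (Psi : R * R -> {RV P >-> R}).
Hypothesis (hu : 0 <= u <= pi / 4) (htheta : 0 < theta <= pi / 4).
Hypothesis hPsi : gaussian_field_with_spectral_measure (sigma_arcs theta) Psi.
Notation ray := (ray u Psi).

Let theta0 : 0 < theta. Proof. by case/andP: htheta. Qed.
Let kap0 := arc_density_gt0 theta0.
Let p0 := pi_gt0 R.

(** An inequality of Turan type. For nonnegative amplitudes [(\sum_i m i) ^+ 2] is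
    the symbol at frequency 0, outside the spectrum; [asymb_extrapolation] with a
    degree proportional to [l] recovers it from the frequencies between
    [sin (u - theta)] and [sin (u + theta)], at an exponential cost. *)
Lemma ray_turan_lb : theta < u -> exists C : nat,
  forall (I : finType) (l : nat) (t m : I -> R), (0 < l)%N ->
  (forall i, 0 <= t i <= l%:R) -> (forall i, 0 <= m i) ->
  expR (- (C * l)%:R) * (\sum_i m i) ^+ 2 <= varX P (fun w => \sum_i m i * ray (t i) w).
Proof.
move=> tu; have [u0 u1] := andP hu; have [t0 t1] := andP htheta.
have band := sin_band hu htheta.
set l0 := sin (u - theta) in band; set l1 := sin (u + theta) in band.
have l00 : 0 < l0 by apply: sin_gt0_pi; apply/andP; split; lra.
(* [[a / D, b / D]] is a subinterval of the band with [b = a + 1]; with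
   [eta = 1 / (D * W * l)], it is [[eta * k0, eta * M.+1]] for [k0 = a * W * l] and
   [M.+1 = b * W * l], and [W] is so large that [2 ^+ b * q <= 1 / 4] *)
pose D := Num.bound (2 / (l1 - l0)).
have D2 : 2 / (l1 - l0) < D%:R by apply: archi_boundP; rewrite divr_ge0// subr_ge0 ltW.
have Dp : 0 < D%:R :> R by apply: lt_trans D2; rewrite divr_gt0// subr_gt0.
have D0 : (0 < D)%N by rewrite -(ltr0n R).
have {}D2 : 2 <= (l1 - l0) * D%:R by move: D2; rewrite ltr_pdivrMr ?subr_gt0// mulrC => /ltW.
pose a := (Num.truncn (l0 * D%:R)).+1; pose b := a.+1.
have /andP[a0 a1] : (Num.truncn (l0 * D%:R))%:R <= l0 * D%:R < a%:R.
  by apply: Num.Theory.truncn_itv; rewrite mulr_ge0// ltW.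
have bE : b%:R = (Num.truncn (l0 * D%:R))%:R + 2 :> R by rewrite -natrD addn2.
have b1 : b%:R <= l1 * D%:R by move: D2; rewrite bE mulrBl; lra.
have abS : b = a.+1 by [].
clearbody b.
pose W := (Num.bound (8 * pi * 2 ^+ b : R)).+1.
have Wb : 8 * pi * 2 ^+ b <= W%:R :> R.
  apply: ltW; apply: lt_le_trans (archi_boundP _) _; last by rewrite ler_nat leqnSn.
  by apply: mulr_ge0; [rewrite mulr_ge0 ?(ltW p0)|exact: exprn_ge0].
have W0 : 0 < W%:R :> R by rewrite ltr0n.
pose q : R := 2 * pi / (D%:R * W%:R).
have DW0 : 0 < D%:R * W%:R :> R by rewrite mulr_gt0.
have q0 : 0 <= q by rewrite /q divr_ge0 ?mulr_ge0 ?(ltW p0).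
have q2 : 2 ^+ b * q <= 1 / 4.
  rewrite /q mulrA ler_pdivrMr//.
  have : W%:R <= D%:R * W%:R :> R by rewrite ler_peMl// ler1n.
  by lra.
have b21 : 1 <= 2 ^+ b :> R by rewrite exprn_ege1// ler1n.
have q4 : q <= 1 / 4 by apply: le_trans q2; rewrite ler_peMl.
have B0 : 0 <= 2 ^+ b * q by apply: mulr_ge0.
pose C0 := Num.bound (4 * (D%:R * W%:R) / arc_density theta).
have C00 : 0 <= 4 * (D%:R * W%:R) / arc_density theta.
  by apply: divr_ge0; [rewrite mulr_ge0// ltW|exact: ltW].
have hC0 : 4 * (D%:R * W%:R) / arc_density theta <= expR C0%:R.
  by apply: le_trans (natr_le_expR _); apply: ltW; exact: archi_boundP.
exists (C0 + 1 + 8 * (b * W))%N => I l t m lp tl m0.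
have l_0 : 0 < l%:R :> R by rewrite ltr0n.
pose N := (W * l)%N.
have N0 : (0 < N)%N by rewrite muln_gt0.
have Np : 0 < N%:R :> R by rewrite ltr0n.
pose eta : R := (D%:R * N%:R)^-1.
have eta0 : 0 < eta by rewrite invr_gt0 mulr_gt0.
pose M := (b * N).-1; pose k0 := (a * N)%N.
have bN0 : (0 < b * N)%N by rewrite muln_gt0 abS.
have MS : M.+1 = (b * N)%N by rewrite /M prednK.
have kM : (k0 <= M)%N by rewrite -ltnS MS /k0 ltn_pmul2r// abS.
have Mk : (M - k0).+1 = N by rewrite -subSn// MS /k0 -mulnBl abS subSnn mul1n.
have hM : 2 ^+ M * q ^+ (M - k0).+1 <= 1 / 4.
  rewrite Mk; apply: (@le_trans _ _ ((2 ^+ b * q) ^+ N)).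
    rewrite [(2 ^+ b * q) ^+ N]exprMn -[(2 ^+ b) ^+ N]exprM ler_wpM2r ?exprn_ge0//.
    by rewrite ler_weXn2l ?ler1n// -MS leqnSn.
  rewrite -(prednK N0) exprS -[leRHS]mulr1; apply: ler_pM => //; first exact: exprn_ge0.
  by apply: exprn_ile1 => //; lra.
have tq i : 2 * pi * eta * t i <= q.
  have /andP[ti0 til] := tl i.
  have -> : q = 2 * pi * eta * l%:R.
    rewrite /q /eta /N natrM; field; rewrite !gt_eqF//.
  by rewrite ler_wpM2l// !mulr_ge0 ?(ltW p0) ?(ltW eta0).
have := @asymb_extrapolation R I m t M k0 eta q eta0 m0 (fun i => (andP (tl i)).1) tq q4 kM hM.
have e1 : eta * k0%:R = a%:R / D%:R by rewrite /eta /k0 natrM; field; rewrite !gt_eqF.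
have e2 : eta * M.+1%:R = b%:R / D%:R by rewrite MS /eta natrM; field; rewrite !gt_eqF.
rewrite e1 e2 => h.
have al0 : l0 <= a%:R / D%:R by rewrite ler_pdivlMr// ltW.
have ab : a%:R / D%:R <= b%:R / D%:R :> R by rewrite ler_pM2r ?invr_gt0// ler_nat abS leqnSn.
have bl1 : b%:R / D%:R <= l1 by rewrite ler_pdivrMr.
have := @ray_varX_ge _ _ _ P u theta Psi hu htheta hPsi _ m t (asymb m t) (symb m t) _ _ al0 ab bl1
  (@continuous_symb _ _ _ _) (is_derive_asymb m t).
have hh : forall x, a%:R / D%:R <= x <= b%:R / D%:R -> 0 <= symb m t x <= symb m t x.
  by move=> x _; rewrite symb_ge0 lexx.
move=> /(_ hh); apply: le_trans.
set G := asymb m t _ - _ in h *; set S := (\sum_i m i) ^+ 2 in h *.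
have S0 : 0 <= S by exact: sqr_ge0.
have p9 : 0 < 9 ^+ M :> R by rewrite exprn_gt0.
have hG : eta * S / 4 / 9 ^+ M <= G by rewrite ler_pdivrMr// [G * _]mulrC.
apply: le_trans (ler_wpM2l (ltW kap0) hG).
have -> : arc_density theta * (eta * S / 4 / 9 ^+ M) = arc_density theta * eta / 4 / 9 ^+ M * S by ring.
rewrite ler_wpM2r// expRN -[leRHS]invrK lef_pV2 ?posrE ?invr_gt0 ?divr_gt0 ?mulr_gt0 ?expR_gt0//.
have -> : (arc_density theta * eta / 4 / 9 ^+ M)^-1 = (4 * (D%:R * W%:R) / arc_density theta) * l%:R * 9 ^+ M.
  by rewrite /eta /N natrM; field; rewrite !gt_eqF.
rewrite mulnDl mulnDl mul1n natrD natrD !expRD.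
apply: ler_pM; [exact: mulr_ge0|exact: ltW| |].
  apply: ler_pM => //; last exact: natr_le_expR.
  by apply: le_trans hC0 _; rewrite ler_expR ler_nat leq_pmulr.
have e9 : 9 <= expR 8 :> R by have := @expR_ge1Dx R 8; lra.
apply: (@le_trans _ _ (expR 8 ^+ M)); first by rewrite lerXn2r ?nnegrE ?expR_ge0.
rewrite -expRM_natl ler_expR -mulnA natrM mulrC ler_wpM2l// ler_nat -mulnA -/N.
by rewrite -MS leqnSn.
Qed.

Definition ray_nodes (h : R) (n : nat) : seq (T -> R) := [seq ray (j%:R * h) | j <- iota 0 n].

(** With [z = expi (2 * pi * h * l)], the terms of degree less than [n] in
    [z ^+ p = (1 + (z - 1)) ^+ p] are combinations of the first [n] nodes. In the rest,
    [x ^+ k <= 2 ^- n * (2 * x) ^+ k] for [n <= k], and the binomial sum of the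
    right sides is at most an exponential. *)
Lemma ray_taylor (n p : nat) (h : R) : 0 <= h ->
  exists Z, inspan (ray_nodes h n) Z /\
    varX P (fun w => ray (p%:R * h) w + Z w) <= (2 ^- n * expR (4 * pi * (p%:R * h))) ^+ 2.
Proof.
move=> h0.
pose b (j : nat) : R := - \sum_(k < n) (-1) ^+ (k + j) * 'C(p, k)%:R * 'C(k, j)%:R.
exists (fun w => \sum_(j < n) b j * ray (j%:R * h) w); split.
  have -> : (fun w => \sum_(j < n) b j * ray (j%:R * h) w) =
      (fun w => \sum_(j <- iota 0 n) b j * ray (j%:R * h) w).
    by apply/funext => w; rewrite -(big_mkord xpredT (fun j => b j * ray (j%:R * h) w)) /index_iota subn0.
  rewrite /ray_nodes; elim: (iota 0 n) => [|j s IH] /=; first by apply/funext => w; rewrite big_nil.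
  exists (b j), (fun w => \sum_(j <- s) b j * ray (j%:R * h) w); split => //.
  by apply/funext => w; rewrite big_cons.
pose a (i : 'I_n.+1) : R := oapp (fun j : 'I_n => b j) 1 (unlift ord0 i).
pose t (i : 'I_n.+1) : R := oapp (fun j : 'I_n => j%:R * h) (p%:R * h) (unlift ord0 i).
have -> : (fun w => ray (p%:R * h) w + \sum_(j < n) b j * ray (j%:R * h) w) =
    (fun w => \sum_i a i * ray (t i) w).
  apply/funext => w; rewrite big_ord_recl /a /t unlift_none /= mul1r; congr (_ + _).
  by apply: eq_bigr => j _; rewrite liftK.
apply: (ray_varX_sup u htheta hPsi) => l /andP[l1 l2].
rewrite symb_nsq -cabs_sqr ler_pXn2r ?nnegrE ?cabs_ge0 ?mulr_ge0 ?invr_ge0 ?exprn_ge0 ?expR_ge0//.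
pose z := expi (2 * pi * h * l).
have -> : \sum_i (a i)%:C%C * expi (2 * pi * t i * l) =
    \sum_(k < (p + n).+1 | ~~ (k < n)%N) (z - 1) ^+ k *+ 'C(p, k).
  have zp : expi (2 * pi * (p%:R * h) * l) = \sum_(k < (p + n).+1) (z - 1) ^+ k *+ 'C(p, k).
    rewrite -(@expr1D_wide _ (z - 1) p (p + n) (leq_addr _ _)) addrC subrK /z expiX.
    by congr expi; ring.
  rewrite big_ord_recl {1}/a {1}/t unlift_none /= mul1r zp (bigID (fun k : 'I_(p + n).+1 => (k < n)%N)) /=.
  rewrite addrAC -[RHS]add0r; congr (_ + _).
  rewrite -(big_ord_widen (p + n).+1 (fun k => (z - 1) ^+ k *+ 'C(p, k))) ?leqW ?leq_addl//.
  have E j : expi (2 * pi * (t (lift ord0 j)) * l) = z ^+ j.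
    by rewrite /t liftK /= /z expiX; congr expi; ring.
  under [X in _ + X]eq_bigr do rewrite E /a liftK /= /b rmorphN mulNr.
  rewrite sumrN; apply/eqP; rewrite subr_eq0; apply/eqP.
  rewrite [RHS](eq_bigr (fun j : 'I_n => \sum_(k < n) ((-1) ^+ (k + j) * 'C(p, k)%:R * 'C(k, j)%:R)%:C%C * z ^+ j)); last first.
    by move=> j _; rewrite rmorph_sum mulr_suml.
  rewrite exchange_big; apply: eq_bigr => k _ /=.
  have kn : (k <= n.-1)%N by have := ltn_ord k; lia.
  have -> : (z - 1) ^+ k = (-1) ^+ k * (1 + - z) ^+ k by rewrite -exprMn mulN1r opprB addrC.
  have nS : n.-1.+1 = n by rewrite prednK// (leq_trans _ (ltn_ord k)).
  rewrite (expr1D_wide (- z) kn) nS mulr_sumr -sumrMnl; apply: eq_bigr => j _.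
  rewrite !rmorphM /= !rmorph_nat rmorphXn /= rmorphN1 exprD [(- z) ^+ j]exprNn.
  exact: monomial_regroup_left.
apply: le_trans (cabs_sum _ _ _) _.
have zx : cabs (z - 1) <= 2 * pi * h.
  rewrite -opprB cabsN; apply: le_trans (cabs_expi_sub1 _) _.
  have h2 : 0 <= 2 * pi * h by rewrite !mulr_ge0 ?(ltW p0).
  by rewrite normrM (ger0_norm h2) ler_piMr// ler_norml l1.
apply: (@le_trans _ _ (\sum_(k < (p + n).+1) 2 ^- n * ((2 * (2 * pi * h)) ^+ k *+ 'C(p, k)))).
  rewrite big_mkcond; apply: ler_sum => k _; case: ifPn => [nk|_]; last first.
    by rewrite mulr_ge0 ?invr_ge0 ?exprn_ge0 ?mulrn_wge0 ?exprn_ge0 ?mulr_ge0 ?(ltW p0).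
  rewrite -mulr_natr -[_%:R](rmorph_nat (real_complex R)) cabsM cabs_real ger0_norm// cabsX.
  rewrite -[(2 * (2 * pi * h)) ^+ k *+ _]mulr_natr [2 ^- n * (_ * _)]mulrA ler_wpM2r// exprMn [2 ^- n * (_ * _)]mulrA.
  apply: (@le_trans _ _ ((2 * pi * h) ^+ k)); first by rewrite lerXn2r ?nnegrE ?cabs_ge0 ?mulr_ge0 ?(ltW p0).
  rewrite ler_peMl ?exprn_ge0 ?mulr_ge0 ?(ltW p0)// mulrC ler_pdivlMr ?exprn_gt0// mul1r.
  by rewrite ler_weXn2l ?ler1n// leqNgt.
rewrite -mulr_sumr ler_wpM2l ?invr_ge0 ?exprn_ge0//.
rewrite -(@expr1D_wide R _ p (p + n) (leq_addr _ _)).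
have -> : expR (4 * pi * (p%:R * h)) = expR (2 * (2 * pi * h)) ^+ p.
  by rewrite -expRM_natl; congr expR; ring.
by rewrite lerXn2r ?nnegrE ?expR_ge0 ?addr_ge0 ?mulr_ge0 ?(ltW p0)// expR_ge1Dx.
Qed.

End extrapolated_variances.

(** * Upper bounds for the probability of a constant sign *)

Section upper_bounds.
Context d (T : measurableType d) (R : realType) (P : probability T R).
Context (u theta : R) (Psi : R * R -> {RV P >-> R}).
Hypothesis (hu : 0 <= u <= pi / 4) (htheta : 0 < theta <= pi / 4).
Hypothesis hPsi : gaussian_field_with_spectral_measure (sigma_arcs theta) Psi.
Notation ray := (ray u Psi).

Let theta0 : 0 < theta. Proof. by case/andP: htheta. Qed.
Let kap0 := arc_density_gt0 theta0.
Let p0 := pi_gt0 R.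
Let gH := gspace_rayspan u hPsi.

Definition half_grid_event (e : R) (n : nat) : set T :=
  [set w | forall k : 'I_n, 0 <= e * ray (k%:R / 2) w].

Lemma varX_sign (I : finType) (e : R) (a t : I -> R) : e ^+ 2 = 1 ->
  varX P (fun w => \sum_i a i * (e * ray (t i) w)) = varX P (fun w => \sum_i a i * ray (t i) w).
Proof.
move=> e1; rewrite /varX; congr Ex; apply/funext => w.
under eq_bigr do rewrite mulrCA.
by rewrite -mulr_sumr exprMn e1 mul1r.
Qed.

Lemma rayspan_sign e t : rayspan u Psi (fun w => e * ray t w).
Proof. by apply: (gspaceZ gH); exact: rayspan_ray. Qed.

Lemma measurable_half_grid_event e n : measurable (half_grid_event e n).
Proof.
apply: measurable_forall => k; apply: measurable_ge_rv.
exact: (gspace_meas gH (rayspan_sign _ _)).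
Qed.

Lemma sum_stride_le (F : nat -> R) (p N : nat) : (0 < p)%N -> (forall k, (k < p * N)%N -> 0 <= F k) ->
  \sum_(j < N) F (p * j)%N <= \sum_(k < p * N) F k.
Proof.
move=> p1; elim: N => [|N IH] F0; first by rewrite muln0 !big_ord0.
rewrite big_ord_recr /= mulnS addnC -(big_mkord xpredT F) (big_cat_nat (n := p * N))//= ?leq_addr//.
rewrite big_mkord; apply: lerD.
  by apply: IH => k kp; apply: F0; rewrite mulnS; apply: ltn_addl.
rewrite -{2}(add0n (p * N)%N) big_addn addnC addnK big_mkord.
rewrite (bigD1 (Ordinal p1))//= add0n lerDl; apply: sumr_ge0 => i _.
by apply: F0; rewrite mulnS ltn_add2r.
Qed.

Lemma small_ball_scale (c : R) : 0 < c -> exists2 al : R, 0 < al & 2 <= al ^+ 2 * c.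
Proof.
move=> c0; exists (1 + 2 / c); first by rewrite addr_gt0// divr_gt0.
have -> : (1 + 2 / c) ^+ 2 * c = c + 4 + 4 / c by field; rewrite gt_eqF.
have h : 0 <= 4 / c by rewrite divr_ge0// ltW.
by lra.
Qed.

(** If all samples have the sign [e], then either their sum is at least
    [eta * N], a Gaussian tail event for a variance of order [N], or the
    samples spaced by [D], which are among the terms of that sum, are
    nonnegative with a sum at most [eta * N], and [small_ball_sum] applies. *)
Lemma persistence_upper_linear : exists (D : nat) (c : R), [/\ (0 < D)%N, 0 < c &
  forall (N : nat) (e : R), (0 < N)%N -> e ^+ 2 = 1 ->
  pr P (half_grid_event e (2 * D * N)) <= 3 * expR (- (c * N%:R))].
Proof.
have [D [c0 [D0 c00 hD]]] := ray_spaced_lb hu htheta hPsi.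
have [al al0 alc] := small_ball_scale c00.
(* so large that the gain [ln (1 + M / 4) / 2] exceeds the loss [ln 4] by 1 *)
pose M := (Num.bound (64 * expR 2 : R)).+1.
have M1 : 16 * expR 2 <= 1 + M%:R / 4 :> R.
  have : 64 * expR 2 <= M%:R :> R.
    apply: ltW; apply: lt_le_trans (archi_boundP _) _; last by rewrite ler_nat leqnSn.
    by rewrite mulr_ge0// expR_ge0.
  by lra.
have Mp : 0 < M%:R :> R by rewrite ltr0n.
pose eta : R := (2 * al * M%:R)^-1.
have eta0 : 0 < eta by rewrite invr_gt0 !mulr_gt0.
have alM : al * M%:R * (2 * eta) <= 1.
  by rewrite le_eqVlt; apply/orP; left; apply/eqP; rewrite /eta; field; rewrite !gt_eqF.
pose v := 3 * arc_density theta * (4 * D%:R + 2 * pi).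
have v0 : 0 < v by rewrite !mulr_gt0// addr_gt0 ?mulr_gt0 ?ltr0n.
exists D, (Num.min 1 (eta ^+ 2 / (v * 4))); split=> //.
  by rewrite lt_min ltr01; apply: divr_gt0; [exact: exprn_gt0|exact: mulr_gt0].
move=> N e N0 e1; have Np : 0 < N%:R :> R by rewrite ltr0n.
set c := Num.min _ _; set n := (2 * D * N)%N.
pose S w := \sum_(k < n) 1 * (e * ray (k%:R / 2) w).
have HS : rayspan u Psi S by apply: (gspace_lcomb gH) => k; exact: rayspan_sign.
have vS : varX P S <= v * N%:R.
  rewrite /S varX_sign//; apply: le_trans (ray_sum_var hu htheta hPsi n) _.
  rewrite /v -[leRHS]mulrA ler_wpM2l ?mulr_ge0 ?(ltW kap0)// mulrDl /n !natrM.
  have : 1 <= N%:R :> R by rewrite ler1n.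
  by have := mulr_ge0 (ltW p0) (ler0n R N); nra.
pose Y (j : 'I_N) w := e * ray (0 + D%:R * j%:R) w.
have vY x : c0 * \sum_j x j ^+ 2 <= varX P (fun w => \sum_j x j * Y j w).
  by rewrite /Y varX_sign//; exact: hD.
have Y0 j : rayspan u Psi (Y j) by exact: rayspan_sign.
have := small_ball_sum gH (isT : (0 < M)%N) Y0 vY al0 alc eta0 alM.
set B2 := [set w | _ /\ _] => hB.
pose B1 := [set w | eta * N%:R <= S w].
have mB1 : measurable B1 by apply: measurable_ge_rv; exact: (gspace_meas gH).
have mB2 : measurable B2 by apply: measurable_small_sum => j; exact: (gspace_meas gH).
have cov : half_grid_event e n `<=` B1 `|` B2.
  move=> w hw; case: (leP (eta * N%:R) (S w)) => hS; [by left|right].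
  have Yk (j : 'I_N) : exists2 k : 'I_n, True & Y j w = e * ray (k%:R / 2) w.
    have jn : (2 * D * j < n)%N by rewrite /n ltn_pmul2l ?muln_gt0// ltn_ord.
    exists (Ordinal jn) => //; rewrite /Y; congr (e * ray _ w) => /=.
    by rewrite !natrM; field.
  split => [j|]; first by have [k _ ->] := Yk j; exact: hw.
  apply: le_trans (ltW hS); rewrite /S.
  have := @sum_stride_le (fun k => 1 * (e * ray (k%:R / 2) w)) (2 * D) N.
  rewrite muln_gt0 D0 => /(_ isT) h; apply: le_trans (h _).
    apply: ler_sum => j _; rewrite mul1r /Y le_eqVlt; apply/orP; left; apply/eqP.
    by congr (e * ray _ w); rewrite !natrM; field.
  by move=> k kn; rewrite mul1r; exact: (hw (Ordinal kn)).
apply: (le_trans (le_prU P (measurable_half_grid_event _ _) mB1 mB2 cov)).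
have h1 : pr P B1 <= 2 * expR (- (c * N%:R)).
  apply: (le_trans (cgauss_tail (gspace_gauss gH HS) vS (mulr_gt0 v0 Np) (mulr_gt0 eta0 Np))).
  rewrite ler_pM2l// ler_expR lerN2.
  have -> : (eta * N%:R) ^+ 2 / (v * N%:R * 4) = eta ^+ 2 / (v * 4) * N%:R by field; rewrite !gt_eqF.
  by rewrite ler_pM2r// ge_min lexx orbT.
have h2 : pr P B2 <= expR (- (c * N%:R)).
  rewrite -(ler_pM2r (expR_gt0 (N%:R * (ln (1 + M%:R / 4) / 2)))); apply: (le_trans hB).
  rewrite -expRD; apply: (@le_trans _ _ (expR (N%:R * ln 4))).
    by rewrite expRM_natl lnK// posrE.
  rewrite ler_expR.
  have l16 : 2 * ln 4 + 2 <= ln (1 + M%:R / 4) :> R.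
    have -> : 2 * ln 4 + 2 = ln (16 * expR 2) :> R.
      rewrite lnM ?posrE ?expR_gt0// expRK; congr (_ + 2).
      have -> : 16 = 4 ^+ 2 :> R by ring.
      by rewrite lnXn// mulr_natl.
    by rewrite ler_ln// posrE ?mulr_gt0 ?expR_gt0// addr_gt0// divr_gt0.
  have c1 : c <= 1 by rewrite ge_min lexx.
  have := ler_wpM2r (ltW Np) c1; have := ler_wpM2l (ltW Np) l16; lra.
by lra.
Qed.

Lemma exists_large_binomial (n : nat) : exists k : 'I_n.+1, 2 ^+ n <= n.+1%:R * 'C(n, k)%:R :> R.
Proof.
have [[k hk]|h] := pselect (exists k : 'I_n.+1, 2 ^+ n <= n.+1%:R * 'C(n, k)%:R :> R); first by exists k.
have lt (k : 'I_n.+1) : n.+1%:R * 'C(n, k)%:R < 2 ^+ n :> R.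
  by rewrite ltNge; apply/negP => hk; apply: h; exists k.
have : \sum_(k < n.+1) n.+1%:R * 'C(n, k)%:R < \sum_(k < n.+1) 2 ^+ n :> R.
  by apply: ltr_sum => [|k _]; [by apply/hasP; exists ord0; rewrite ?mem_index_enum|exact: lt].
have -> : \sum_(k < n.+1) n.+1%:R * 'C(n, k)%:R = n.+1%:R * 2 ^+ n :> R.
  rewrite -mulr_sumr; congr (_ * _).
  have := @expr1D_wide R 1 n n (leqnn _); rewrite -[1 + 1]/2 => ->.
  by apply: eq_bigr => k _; rewrite expr1n.
by rewrite sumr_const card_ord mulr_natl ltxx.
Qed.

(** The same dichotomy with binomial averages in place of single samples. Their
    sum has a variance of order [rho ^+ N], so the threshold [eta] can be taken
    exponentially small in [N] and still be unlikely to be exceeded: the tail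
    is of order [expR (- (expR (be * N / 2) / 4))]. Below the threshold the
    [N] spaced samples, each with a weight of at least [1 / N.+1] in its binomial
    average, have an exponentially small mean, and [small_ball_sum] gains a
    factor [expR (be * N / 16)] for each of them. *)
Lemma persistence_upper_quadratic : theta < u ->
  exists (D N0 : nat) (c : R), [/\ (0 < D)%N, 0 < c &
  forall (N : nat) (e : R), (N0 <= N)%N -> e ^+ 2 = 1 ->
  pr P (half_grid_event e (2 * D * N)) <= 3 * expR (- (c * N%:R ^+ 2))].
Proof.
move=> tu.
have [D [c0 [D0 c00 hD]]] := ray_spaced_lb hu htheta hPsi.
have [al al0 alc] := small_ball_scale c00.
have [rho /andP[rho0 rho1] hrho] := ray_binomial_var hu htheta hPsi tu.
pose be := - ln rho.
have be0 : 0 < be by rewrite oppr_gt0 ln_lt0// rho0.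
have rhoE n : rho ^+ n = expR (- (be * n%:R)).
  by rewrite mulrC /be mulrN opprK expRM_natl lnK// posrE.
pose Q : R := 256 * 256 * al / be ^+ 2.
have Q0 : 0 <= Q by apply: divr_ge0; [apply: mulr_ge0; [lra|exact: ltW]|exact: sqr_ge0].
exists D.+1, (Num.bound Q).+1, (Num.min (be ^+ 2 / 64) (be / 16)); split=> //.
  by rewrite lt_min; apply/andP; split; apply: divr_gt0 => //; exact: exprn_gt0.
move=> N e; set c := Num.min _ _ => NN e1.
have N0 : (0 < N)%N by apply: leq_trans NN.
have Np : 0 < N%:R :> R by rewrite ltr0n.
have NQ : Q <= N%:R.
  apply: ltW; apply: lt_le_trans (archi_boundP Q0) _; rewrite ler_nat; exact: ltnW.
set n := (2 * D.+1 * N)%N.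
pose eta : R := expR (- (be * N%:R / 4)).
have eta0 : 0 < eta by exact: expR_gt0.
pose eta' := N.+1%:R * eta.
have eta'0 : 0 < eta' by rewrite mulr_gt0// ltr0n.
have big : 256 * al * N%:R <= expR (be * N%:R / 8).
  apply: le_trans (expR_ge_sqr _); last by rewrite divr_ge0// mulr_ge0 ?ltW.
  have -> : (be * N%:R / 8 / 2) ^+ 2 = be ^+ 2 * N%:R / 256 * N%:R by field.
  rewrite (ler_pM2r Np) ler_pdivlMr; last by lra.
  move: NQ; rewrite /Q ler_pdivrMr ?exprn_gt0//; lra.
have small : al * (16 * eta') * 8 <= expR (- (be * N%:R / 8)).
  have hN : N.+1%:R <= 2 * N%:R :> R by rewrite -natr1 mulr2n mulrDl mul1r lerD2l ler1n.
  have -> : expR (- (be * N%:R / 8)) = expR (be * N%:R / 8) * eta.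
    by rewrite /eta -expRD; congr expR; field.
  have := ler_wpM2r (ltW eta0) big.
  have := ler_wpM2r (ltW eta0) (ler_wpM2l (ltW al0) hN).
  rewrite /eta'; lra.
have small1 : 2 * al * eta' <= 1.
  have : expR (- (be * N%:R / 8)) <= 1.
    by rewrite -[leRHS]expR0 ler_expR oppr_le0 divr_ge0// mulr_ge0 ?ltW.
  have := mulr_ge0 (ltW al0) (ltW eta'0); lra.
have a2 : 0 < 2 * al * eta' by rewrite !mulr_gt0.
pose M := Num.truncn (2 * al * eta')^-1.
have /andP[M1 M2] : M%:R <= (2 * al * eta')^-1 < M.+1%:R.
  by apply: Num.Theory.truncn_itv; rewrite invr_ge0 ltW.
have M0 : (0 < M)%N.
  rewrite lt0n; apply/eqP => Mz; move: M2; rewrite Mz invf_lt1//; lra.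
have alM : al * M%:R * (2 * eta') <= 1.
  by move: M1; rewrite -[_^-1]div1r ler_pdivlMr//; lra.
have Mlog : 2 * ln 4 + be * N%:R / 8 <= ln (1 + M%:R / 4).
  have -> : 2 * ln 4 + be * N%:R / 8 = ln (16 * expR (be * N%:R / 8)).
    rewrite lnM ?posrE ?expR_gt0// expRK; congr (_ + _).
    have -> : 16 = 4 ^+ 2 :> R by ring.
    by rewrite lnXn// mulr_natl.
  rewrite ler_ln ?posrE ?mulr_gt0 ?expR_gt0 ?addr_gt0 ?divr_gt0 ?ltr0n//.
  have h1 : 16 * expR (be * N%:R / 8) <= (8 * al * eta')^-1.
    rewrite -[leRHS]div1r ler_pdivlMr ?mulr_gt0//.
    have := ler_wpM2r (expR_ge0 (be * N%:R / 8)) small.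
    rewrite -expRD addNr expR0; lra.
  have h2 : (8 * al * eta')^-1 = (2 * al * eta')^-1 / 4 by field; rewrite !gt_eqF.
  have M3 : M.+1%:R = M%:R + 1 :> R by rewrite natr1.
  lra.
pose X (i : 'I_N) w := \sum_(k < N.+1) (2 ^- N * 'C(N, k)%:R) * (e * ray (k%:R / 2 + D%:R * i%:R) w).
pose S w := \sum_(p : 'I_N * 'I_N.+1) (2 ^- N * 'C(N, p.2)%:R) * (e * ray (p.2%:R / 2 + D%:R * p.1%:R) w).
have SX w : S w = \sum_i X i w.
  by rewrite /S /X -(pair_bigA _ (fun (i : 'I_N) (k : 'I_N.+1) => (2 ^- N * 'C(N, k)%:R) * (e * ray (k%:R / 2 + D%:R * i%:R) w))).
have HS : rayspan u Psi S by apply: (gspace_lcomb gH) => p; exact: rayspan_sign.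
have vS : varX P S <= N%:R ^+ 2 * rho ^+ N by rewrite /S varX_sign.
have [k0 hk0] := exists_large_binomial N.
pose Y (j : 'I_N) w := e * ray (k0%:R / 2 + D%:R * j%:R) w.
have vY x : c0 * \sum_j x j ^+ 2 <= varX P (fun w => \sum_j x j * Y j w).
  by rewrite /Y varX_sign//; exact: hD.
have HY j : rayspan u Psi (Y j) by exact: rayspan_sign.
have := small_ball_sum gH M0 HY vY al0 alc eta'0 alM.
set B2 := [set w | _ /\ _] => hB.
pose B1 := [set w | eta * N%:R <= S w].
have mB1 : measurable B1 by apply: measurable_ge_rv; exact: (gspace_meas gH).
have mB2 : measurable B2 by apply: measurable_small_sum => j; exact: (gspace_meas gH).
have cov : half_grid_event e n `<=` B1 `|` B2.
  move=> w hw; case: (leP (eta * N%:R) (S w)) => hS; [by left|right].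
  have f0 (i : 'I_N) (k : 'I_N.+1) : 0 <= e * ray (k%:R / 2 + D%:R * i%:R) w.
    have kn : (k + 2 * D * i < n)%N.
      rewrite /n mulnS mulnDl -addSn; apply: leq_add; last by rewrite leq_mul2l (ltnW (ltn_ord i)) orbT.
      by rewrite mul2n -addnn -addn1; apply: leq_add => //; rewrite -ltnS.
    have := hw (Ordinal kn); congr (0 <= e * ray _ w) => /=.
    by rewrite natrD !natrM; field.
  split => [j|]; first exact: f0.
  have YX j : Y j w <= N.+1%:R * X j w.
    rewrite /X (bigD1 k0)//= mulrDr; apply: (@le_trans _ _ (N.+1%:R * (2 ^- N * 'C(N, k0)%:R * Y j w))).
      rewrite mulrA ler_peMl//; first exact: f0.
      by rewrite mulrCA mulrC ler_pdivlMr ?exprn_gt0// mul1r.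
    rewrite lerDl mulr_ge0//; apply: sumr_ge0 => k _.
    by rewrite mulr_ge0 ?f0// mulr_ge0// invr_ge0 exprn_ge0.
  apply: (@le_trans _ _ (N.+1%:R * S w)).
    by rewrite SX mulr_sumr; apply: ler_sum.
  by rewrite /eta' -mulrA ler_wpM2l// ltW.
apply: (le_trans (le_prU P (measurable_half_grid_event _ _) mB1 mB2 cov)).
have v0 : 0 < N%:R ^+ 2 * rho ^+ N by apply: mulr_gt0; exact: exprn_gt0.
have N20 : 0 <= N%:R ^+ 2 :> R by exact: sqr_ge0.
have h1 : pr P B1 <= 2 * expR (- (c * N%:R ^+ 2)).
  apply: (le_trans (cgauss_tail (gspace_gauss gH HS) vS v0 (mulr_gt0 eta0 Np))).
  rewrite ler_pM2l// ler_expR lerN2 rhoE.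
  have -> : (eta * N%:R) ^+ 2 / (N%:R ^+ 2 * expR (- (be * N%:R)) * 4) = expR (be * N%:R / 2) / 4.
    have -> : expR (be * N%:R / 2) = eta ^+ 2 * (expR (- (be * N%:R)))^-1.
      by rewrite -expRN -expRM_natl -expRD; congr expR; field.
    by field; rewrite !gt_eqF ?expR_gt0.
  have := @expR_ge_sqr R (be * N%:R / 2); rewrite divr_ge0 ?mulr_ge0 ?(ltW be0)// => /(_ isT).
  have -> : (be * N%:R / 2 / 2) ^+ 2 = be ^+ 2 / 64 * N%:R ^+ 2 * 4 by field.
  have : c <= be ^+ 2 / 64 by rewrite ge_min lexx.
  move=> /(ler_wpM2r N20); lra.
have h2 : pr P B2 <= expR (- (c * N%:R ^+ 2)).
  rewrite -(ler_pM2r (expR_gt0 (N%:R * (ln (1 + M%:R / 4) / 2)))); apply: (le_trans hB).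
  rewrite -expRD; apply: (@le_trans _ _ (expR (N%:R * ln 4))).
    by rewrite expRM_natl lnK// posrE.
  rewrite ler_expR.
  have c1 : c <= be / 16 by rewrite ge_min lexx orbT.
  have := ler_wpM2r N20 c1; have := ler_wpM2l (ltW Np) Mlog; rewrite expr2; lra.
by lra.
Qed.

End upper_bounds.

(** * Lower bounds for the probability of positivity on a grid *)

Section cameron_martin.
Context d (T : measurableType d) (R : realType) (P : probability T R).
Variable H : (T -> R) -> Prop.
Hypothesis gH : gspace P H.

(** [quadratic_duality] for the covariance matrix; [X] is the combination of the
    [f i] with the dual weights. *)
Lemma nonneg_duality (I : finType) (f : I -> T -> R) (K : I -> R) (V : R) :
  (forall i, H (f i)) -> (forall i, 1 <= K i) -> 0 < V ->
  (forall m : I -> R, (forall i, 0 <= m i) ->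
    (\sum_i m i * K i) ^+ 2 <= V * varX P (fun w => \sum_i m i * f i w)) ->
  exists X, [/\ H X, forall i, K i <= cov P X (f i) & varX P X <= V].
Proof.
move=> Hf K1 V0 hV.
pose n := #|I|; pose ev (k : 'I_n) : I := enum_val k.
have HX (m : 'I_n -> R) : H (fun w => \sum_k m k * f (ev k) w) by exact: (gspace_lcomb gH).
have qE (m : 'I_n -> R) : varX P (fun w => \sum_k m k * f (ev k) w) =
    \sum_i \sum_j m i * m j * cov P (f (ev i)) (f (ev j)) by exact: (varX_lcomb gH).
have := @quadratic_duality R n (fun i j => cov P (f (ev i)) (f (ev j))) (K \o ev) V.
case.
- by move=> i j; exact: covC.
- by move=> i; exact: K1.
- move=> m m0; rewrite -qE.
  pose m' i := m (enum_rank i).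
  have reix (F : I -> R) : \sum_i F i = \sum_k F (ev k).
    by rewrite (reindex ev)//; apply: onW_bij; exact: enum_val_bij.
  have E1 : \sum_i m' i * K i = \sum_k m k * (K \o ev) k.
    by rewrite reix; apply: eq_bigr => k _; rewrite /m' /ev enum_valK.
  have E2 : (fun w => \sum_i m' i * f i w) = (fun w => \sum_k m k * f (ev k) w).
    by apply/funext => w; rewrite reix; apply: eq_bigr => k _; rewrite /m' /ev enum_valK.
  by rewrite -E1 -E2; apply: hV => i; exact: m0.
- exact: V0.
- move=> m [m0 mK mV]; exists (fun w => \sum_k m k * f (ev k) w); split => //.
  + move=> i; have := mK (enum_rank i); rewrite /= /ev enum_rankK => /le_trans; apply.
    by rewrite (cov_suml gH).
  + by rewrite qE.
Qed.

(** Shifting along a Gaussian variable [X] of variance at most [V] whose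
    covariance with every [f i] is at least [K i] turns a one-sided bound
    [1 - K i <= f i] into positivity, at a cost controlled by [V]. *)
Lemma lower_by_shift (I : finType) (i0 : I) (f : I -> T -> R) (K : I -> R) (V be : R) :
  (forall i, H (f i)) -> (forall i, 1 <= K i) -> 0 < V -> 0 <= be ->
  (forall m : I -> R, (forall i, 0 <= m i) ->
    (\sum_i m i * K i) ^+ 2 <= V * varX P (fun w => \sum_i m i * f i w)) ->
  expR (- be) <= pr P [set w | forall i, 1 - K i <= f i w] ->
  expR (- (7 * be + 17 + 2 * V)) <= pr P [set w | forall i, 1 <= f i w].
Proof.
move=> Hf K1 V0 be0 hV hE.
have [X [HX XK XV]] := nonneg_duality Hf K1 V0 hV.
have vX : 0 < varX P X.
  rewrite lt_neqAle varX_ge0 andbT eq_sym; apply/eqP => v0.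
  have := cov_sqr_le gH HX (Hf i0); rewrite v0 mul0r.
  have := le_trans (K1 i0) (XK i0); set c := cov _ _ _ => c1; nra.
pose s := Num.sqrt (varX P X).
have s0 : 0 < s by rewrite sqrtr_gt0.
have s2 : s ^+ 2 = varX P X by rewrite sqr_sqrtr// ltW.
(* at [b] standard deviations the tail of [X] is at most half of [expR (- be)] *)
pose b := Num.sqrt (4 * (be + 2)).
have b0 : 0 <= b by exact: sqrtr_ge0.
have b2 : b ^+ 2 = 4 * (be + 2) by rewrite sqr_sqrtr//; lra.
have X0 i : 0 <= cov P X (f i) by apply: le_trans (XK i); apply: le_trans (K1 i).
have := @shift_lower _ _ _ P H gH I f X (fun=> 1) b Hf HX vX X0 b0 s erefl.
set B1 := [set w | forall i, 1 - cov P X (f i) <= f i w].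
have bs0 : 0 < b * s.
  by rewrite mulr_gt0// sqrtr_gt0; lra.
have h1 : pr P [set w | b * s <= X w] <= 2 * expR (- (be + 2)).
  apply: (le_trans (cgauss_tail (gspace_gauss gH HX) (lexx _) vX bs0)).
  by rewrite exprMn s2 b2 le_eqVlt; apply/orP; left; apply/eqP; congr (_ * expR (- _)); field; rewrite gt_eqF.
have h2 : expR (- be) <= pr P B1.
  apply: (le_trans hE); apply: le_pr.
  - by apply: measurable_forall => i; apply: measurable_ge_rv; exact: (gspace_meas gH).
  - by apply: measurable_forall => i; apply: measurable_ge_rv; exact: (gspace_meas gH).
  - by move=> w /= h i; apply: le_trans (h i); rewrite lerB.
have e2 : 4 * expR (- (be + 2)) <= expR (- be).
  rewrite opprD expRD mulrCA ler_piMr ?expR_ge0// expRN ler_pdivrMr ?expR_gt0// mul1r.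
  have -> : 2 = 1 + 1 :> R by ring.
  rewrite expRD; have := @expR_ge1Dx R 1; set e := expR 1 => h; nra.
have h3 : expR (- be) / 2 <= pr P B1 - pr P [set w | b * s <= X w] by lra.
have h4 : expR (- ((b + s + 1) ^+ 2 / 2)) / 3 <= pr P [set w | (b + s) * s <= X w].
  by apply: cgauss_lower; [exact: (gspace_gauss gH)|exact: vX|rewrite addr_ge0// ltW].
apply: le_trans; apply: (@le_trans _ _ (expR (- be) / 2 * (expR (- ((b + s + 1) ^+ 2 / 2)) / 3))); last first.
  by apply: ler_pM => //; rewrite divr_ge0// expR_ge0.
have -> : expR (- be) / 2 * (expR (- ((b + s + 1) ^+ 2 / 2)) / 3) =
    6^-1 * expR (- be - (b + s + 1) ^+ 2 / 2) by rewrite expRD; field.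
have e6 : expR (- 3) <= 6^-1 :> R.
  rewrite expRN lef_pV2 ?posrE ?expR_gt0//.
  have -> : 3 = 1 + 1 + 1 :> R by ring.
  by rewrite !expRD; have := @expR_ge1Dx R 1; set e := expR 1 => h; nra.
have h5 : (b + s + 1) ^+ 2 <= 3 * (4 * (be + 2) + V + 1).
  apply: (@le_trans _ _ (3 * (b ^+ 2 + s ^+ 2 + 1))); last by rewrite b2 s2; lra.
  have := sqr_ge0 (b - s); have := sqr_ge0 (b - 1); have := sqr_ge0 (s - 1); nra.
apply: (@le_trans _ _ (expR (-3) * expR (- be - (b + s + 1) ^+ 2 / 2))); last by rewrite ler_wpM2r ?expR_ge0.
by rewrite -expRD ler_expR; lra.
Qed.

End cameron_martin.

Section grids.
Context d (T : measurableType d) (R : realType) (P : probability T R).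
Context (u theta : R) (Psi : R * R -> {RV P >-> R}).
Hypothesis (hu : 0 <= u <= pi / 4) (htheta : 0 < theta <= pi / 4).
Hypothesis hPsi : gaussian_field_with_spectral_measure (sigma_arcs theta) Psi.
Notation ray := (ray u Psi).

Let theta0 : 0 < theta. Proof. by case/andP: htheta. Qed.
Let p0 := pi_gt0 R.
Let gH := gspace_rayspan u hPsi.
Let Hray := rayspan_ray u Psi.

Lemma ray_diff_varX (s t : R) : varX P (fun w => ray s w - ray t w) <= (2 * pi * (s - t)) ^+ 2.
Proof.
pose a (b : bool) : R := if b then 1 else -1; pose tt (b : bool) := if b then s else t.
have -> : (fun w => ray s w - ray t w) = (fun w => \sum_b a b * ray (tt b) w).
  by apply/funext => w; rewrite big_bool /a /tt /= mul1r mulN1r.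
apply: (ray_varX_sup u htheta hPsi) => l /andP[l1 l2].
rewrite /symb !big_bool /a /tt /= !mul1r !mulN1r.
apply: (le_trans (chord_le _ _)).
have -> : 2 * pi * s * l - 2 * pi * t * l = l * (2 * pi * (s - t)) by ring.
rewrite exprMn ler_piMl ?sqr_ge0// expr2; nra.
Qed.

Lemma ray_varX_le1 (t : R) : varX P (ray t) <= 1.
Proof.
pose a (b : bool) : R := if b then 1 else 0.
have -> : ray t = (fun w => \sum_b a b * ray t w).
  by apply/funext => w; rewrite big_bool /a /= mul1r mul0r addr0.
apply: (ray_varX_sup u htheta hPsi (t := fun _ : bool => t)) => l _.
by rewrite /symb !big_bool /a /= !mul1r !mul0r !addr0 cos2Dsin2.
Qed.

Definition grid_event (l a : nat) (de : R) : set T :=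
  [set w | forall p : 'I_(2 ^ a).+1, de <= ray (p%:R * (l%:R / 2 ^+ a)) w].

Lemma measurable_grid_event l a de : measurable (grid_event l a de).
Proof.
apply: measurable_forall => k; apply: measurable_ge_rv.
exact: (gspace_meas gH (Hray _)).
Qed.

Lemma ray_chaining (t : R) (a : nat) : exists V : T -> R, [/\ intg P V, forall w, 0 <= V w,
  forall p w, (p <= 2 ^ a)%N -> ray (t + p%:R / 2 ^+ a) w ^+ 2 <= V w & Ex P V <= 72 * 64].
Proof.
apply: (chaining gH (g := fun p => ray (t + p%:R / 2 ^+ a))).
- by move=> p; exact: Hray.
- by apply: le_trans (ray_varX_le1 _) _; lra.
- move=> m k ma km; rewrite /dyadic_incr; apply: (le_trans (ler_wpM2l _ (ray_diff_varX _ _))); first exact: exprn_ge0.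
  have -> : t + (k.+1 * 2 ^ (a - m))%:R / 2 ^+ a - (t + (k * 2 ^ (a - m))%:R / 2 ^+ a) = (2 ^+ m)^-1 :> R.
    have -> : 2 ^+ a = 2 ^+ (a - m) * 2 ^+ m :> R by rewrite -exprD subnK.
    rewrite !natrM -natr1 natrX; field.
    by rewrite !expf_neq0.
  have p4 : pi <= 4 :> R by have [/andP[_ h] _] := pihalf_02_cos_pihalf R; lra.
  have -> : 2 ^+ m * (2 * pi * (2 ^+ m)^-1) ^+ 2 = (2 * pi) ^+ 2 * (1 / 2) ^+ m :> R.
    by rewrite [(1 / 2) ^+ m]expr_div_n expr1n; field; rewrite expf_neq0.
  apply: ler_pM; [exact: sqr_ge0|by rewrite exprn_ge0// divr_ge0| |].
    have h8 : 2 * pi <= 8 :> R by lra.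
    have h0 : 0 <= 2 * pi :> R by rewrite mulr_ge0 // ltW.
    by rewrite expr2; have := ler_pM h0 h0 h8 h8; lra.
  by rewrite lerXn2r ?nnegrE//; lra.
Qed.

(** These summable weights allow a pigeonhole over all integer profiles at an
    exponential cost, irrespective of the bound [M] on the values. *)
Lemma pattern_weight (l M : nat) : \sum_(K : {ffun 'I_l -> 'I_M}) (2^-1 : R) ^+ (\sum_k K k)%N <= 2 ^+ l.
Proof.
rewrite (eq_bigr (fun K : {ffun 'I_l -> 'I_M} => \prod_k (2^-1 : R) ^+ K k)); last first.
  by move=> K _; rewrite -expr_sum.
rewrite -(bigA_distr_bigA (fun (k : 'I_l) (j : 'I_M) => (2^-1 : R) ^+ j)) /= prodr_const card_ord.
rewrite lerXn2r ?nnegrE//; first by apply: sumr_ge0 => j _; rewrite exprn_ge0// invr_ge0.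
apply: (le_trans (geom_sum_le _ _)); first by lra.
by have -> : 1 - 2^-1 = 2^-1 :> R; [field|rewrite invrK].
Qed.

(** By chaining on each unit cell, with probability at least [1 / 2] the field is
    bounded below by [- K k] on the cell [k], for some integer profile [K] with
    [\sum_k K k ^+ 2] of order [l]. A pigeonhole over the profiles finds a fixed
    [K] for which this has probability at least [expR (- (b1 * l))]. For this
    [K], the Cauchy-Schwarz inequality over cells and [ray_local_lb] give the
    hypothesis of [lower_by_shift] with [V] of order [l]. *)
Lemma persistence_lower_linear : u <= theta -> exists2 C : R, 0 < C &
  forall l a : nat, (0 < l)%N -> expR (- (C * l%:R)) <= pr P (grid_event l a 1).
Proof.
move=> ut; have [c c0 hc] := ray_local_lb hu htheta hPsi ut.
pose B : R := 72 * 64.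
pose C1 : R := 4 * B + 2; pose b1 : R := C1 + 3.
pose C3 := 4 * C1 / c.
have B0 : 0 < B by rewrite /B; lra.
have C10 : 0 < C1 by rewrite /C1; lra.
have C30 : 0 < C3 by rewrite /C3 divr_gt0// mulr_gt0.
exists (7 * b1 + 17 + 2 * C3); first by rewrite /b1; lra.
move=> l a l0; have lp : 0 < l%:R :> R by rewrite ltr0n.
have l1 : 1 <= l%:R :> R by rewrite ler1n.
pose I : finType := ('I_l * 'I_(2 ^ a).+1)%type.
pose t (i : I) : R := i.1%:R + i.2%:R / 2 ^+ a.
pose f (i : I) := ray (t i).
have [V hV] : exists V : 'I_l -> T -> R, forall k, [/\ intg P (V k), forall w, 0 <= V k w,
    forall p w, (p <= 2 ^ a)%N -> ray (k%:R + p%:R / 2 ^+ a) w ^+ 2 <= V k w & Ex P (V k) <= B].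
  have [V hV] := choice (fun k : 'I_l => ray_chaining k%:R a).
  by exists V.
pose M := (Num.truncn (C1 * l%:R)).+1.
pose adm (K : {ffun 'I_l -> 'I_M.+1}) := [&& [forall k, (0 < K k)%N] & ((\sum_k K k ^ 2)%N%:R <= C1 * l%:R)].
pose EK (K : {ffun 'I_l -> 'I_M.+1}) : set T := [set w | forall i : I, - (K i.1)%:R <= f i w].
have mEK K : measurable (EK K).
  by apply: measurable_forall => i; apply: measurable_ge_rv; exact: (gspace_meas gH (Hray _)).
pose VS w := \sum_k V k w.
have iVS : intg P VS by apply: intg_sum => k; case: (hV k).
have EVS : Ex P VS <= B * l%:R.
  rewrite Ex_sum; last by move=> k; case: (hV k).
  apply: (@le_trans _ _ (\sum_(k < l) B)); first by apply: ler_sum => k _; case: (hV k).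
  by rewrite sumr_const card_ord mulr_natr.
have VS0 w : 0 <= VS w by apply: sumr_ge0 => k _; case: (hV k).
have mVS : measurable_fun setT VS by move: iVS => /integrableP[/measurable_EFinP].
pose bad := [set w | 2 * B * l%:R <= VS w].
have mbad : measurable bad by exact: measurable_ge_rv.
have hbad : pr P bad <= 1 / 2.
  have x0 : 0 < 2 * B * l%:R by rewrite mulr_gt0// /B; lra.
  apply: (le_trans (markov_pr x0 mbad iVS VS0 (fun w h => h))).
  rewrite ler_pdivrMr//; lra.
have adm_le (K : {ffun 'I_l -> 'I_M.+1}) : adm K -> (\sum_k K k)%N%:R <= C1 * l%:R.
  move=> /andP[_]; apply: le_trans; rewrite ler_nat; apply: leq_sum => k _.
  by case: (nat_of_ord (K k)) => // n; rewrite expnS leq_pmulr// expn_gt0.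
have cover w : (~` bad) w -> exists K, (if adm K then EK K else set0) w.
  move=> /negP; rewrite -ltNge => Vw.
  pose r k := Num.sqrt (V k w); pose q k := (Num.truncn (r k)).+1.
  have Vk0 k : 0 <= V k w by case: (hV k).
  have r2 k : r k ^+ 2 = V k w by rewrite sqr_sqrtr.
  have r0 k : 0 <= r k by exact: sqrtr_ge0.
  have rq k : r k < (q k)%:R /\ (q k)%:R <= r k + 1.
    have /andP[h1 h2] := Num.Theory.truncn_itv (r0 k).
    by split=> //; rewrite /q -natr1 lerD2r.
  have q2 k : (q k ^ 2)%N%:R <= 2 * V k w + 2.
    rewrite natrX -r2; have [_ h] := rq k.
    apply: (@le_trans _ _ ((r k + 1) ^+ 2)); first by rewrite ler_pXn2r// nnegrE ?addr_ge0.
    by have := sqr_ge0 (r k - 1); lra.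
  have qs : (\sum_k q k ^ 2)%N%:R <= C1 * l%:R.
    rewrite natr_sum; apply: (@le_trans _ _ (\sum_k (2 * V k w + 2))); first by apply: ler_sum => k _; exact: q2.
    rewrite big_split /= -mulr_sumr sumr_const card_ord -[2 *+ l]mulr_natr -/(VS w) /C1; lra.
  have qM k : (q k < M.+1)%N.
    rewrite ltnS /M; have h := Num.Theory.truncn_itv (mulr_ge0 (ltW C10) (ltW lp)).
    have : (q k)%:R < (Num.truncn (C1 * l%:R)).+1%:R :> R.
      apply: le_lt_trans (andP h).2; apply: le_trans qs; rewrite ler_nat.
      rewrite (bigD1 k)//=; apply: (@leq_trans (q k ^ 2)); last exact: leq_addr.
      by rewrite expnS leq_pmulr// expn_gt0.
    by rewrite ltr_nat => /ltnW.
  exists [ffun k => Ordinal (qM k)]; rewrite ifT.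
    move=> [k p] /=; rewrite /f /t /= ffunE /=.
    have [_ _ hp _] := hV k; have := hp p w; rewrite -ltnS ltn_ord => /(_ isT).
    have [rk _] := rq k; rewrite -r2 => h.
    have : `|ray (k%:R + p%:R / 2 ^+ a) w| <= r k.
      by rewrite -(ler_pXn2r (ltn0Sn 1)) ?nnegrE// real_normK// num_real.
    by rewrite ler_norml => /andP[h1 _]; lra.
  rewrite /adm; apply/andP; split; first by apply/forallP => k; rewrite ffunE.
  by under eq_bigr do rewrite ffunE.
have [K [aK hK]] : exists K, adm K /\ expR (- (b1 * l%:R)) <= pr P (EK K).
  apply: contrapT => hno.
  have lt K : adm K -> pr P (EK K) <= 4^-1 * (2 ^- l * 2^-1 ^+ (\sum_k K k)%N).
    move=> aK; apply: (@le_trans _ _ (expR (- (b1 * l%:R)))).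
      by apply: ltW; rewrite ltNge; apply/negP => h; apply: hno; exists K.
    rewrite exprVn -!invfM expRN lef_pV2 ?posrE ?expR_gt0 ?mulr_gt0 ?exprn_gt0//.
    have e2 : 2 <= expR 1 :> R by have := @expR_ge1Dx R 1; lra.
    apply: (@le_trans _ _ (expR 1 ^+ (2 + (l + \sum_k K k)))).
      rewrite !exprD; apply: ler_pM => //; rewrite ?mulr_ge0 ?exprn_ge0//.
        by rewrite expr2; nra.
      by apply: ler_pM; rewrite ?exprn_ge0// lerXn2r ?nnegrE ?expR_ge0.
    rewrite -expRM_natl mulr1 ler_expR !natrD /b1; have := adm_le _ aK; lra.
  have := @le_pr_sum _ _ _ P _ (~` bad) (fun K => if adm K then EK K else set0) (measurableC mbad) _ cover.
  have mB K : measurable (if adm K then EK K else set0) by case: ifP.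
  move=> /(_ mB); rewrite pr_setC//.
  have : \sum_K pr P (if adm K then EK K else set0) <= 4^-1.
    apply: (@le_trans _ _ (\sum_(K : {ffun 'I_l -> 'I_M.+1}) 4^-1 * (2 ^- l * 2^-1 ^+ (\sum_k K k)%N))).
      apply: ler_sum => K _; case: ifP => [/lt//|_].
      by rewrite /pr measure0 /= !mulr_ge0 ?invr_ge0 ?exprn_ge0 ?invr_ge0.
    rewrite -!mulr_sumr ler_piMr ?invr_ge0// mulrC ler_pdivrMr ?exprn_gt0// mul1r.
    exact: pattern_weight.
  lra.
have /andP[/forallP K1 K2] := aK.
have V0 : 0 < C3 * l%:R by rewrite mulr_gt0.
have be0 : 0 <= b1 * l%:R by rewrite mulr_ge0// /b1; lra.
have fH i : rayspan u Psi (f i) by exact: Hray.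
have t01 (p : 'I_(2 ^ a).+1) : 0 <= (p%:R / 2 ^+ a : R) <= 1.
  rewrite divr_ge0 ?exprn_ge0//= ler_pdivrMr ?exprn_gt0// mul1r -natrX ler_nat -ltnS.
  exact: ltn_ord.
have dual (m : I -> R) : (forall i, 0 <= m i) ->
    (\sum_i m i * (1 + (K i.1)%:R)) ^+ 2 <= C3 * l%:R * varX P (fun w => \sum_i m i * f i w).
  move=> m0.
  have tcell i j : i.1 = j.1 -> `|t i - t j| <= 1.
    move=> ij; rewrite /t ij ler_norml.
    have /andP[h1 h2] := t01 i.2; have /andP[h3 h4] := t01 j.2; apply/andP; split; lra.
  have hv := hc I l t (fun i => i.1) m tcell m0.
  set mu := fun k => \sum_(i | i.1 == k) m i.
  have -> : \sum_i m i * (1 + (K i.1)%:R) = \sum_k mu k * (1 + (K k)%:R).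
    rewrite (partition_big (fun i : I => i.1) xpredT)//=; apply: eq_bigr => k _.
    by rewrite /mu mulr_suml; apply: eq_bigr => i /eqP ->.
  apply: (le_trans (Cauchy_sum _ _)).
  have hK2 : \sum_k (1 + (K k)%:R) ^+ 2 <= 4 * (C1 * l%:R).
    apply: le_trans (ler_wpM2l (ler0n R 4) K2); rewrite natr_sum mulr_sumr; apply: ler_sum => k _.
    have : 1 <= (K k)%:R :> R by rewrite ler1n.
    by rewrite natrX; set z := _%:R => z1; nra.
  have mu0 : 0 <= \sum_k mu k ^+ 2 by apply: sumr_ge0 => k _; exact: sqr_ge0.
  apply: (le_trans (ler_wpM2l mu0 hK2)).
  have -> : C3 * l%:R * varX P (fun w => \sum_i m i * f i w) =
      (4 * (C1 * l%:R)) * (c^-1 * varX P (fun w => \sum_i m i * f i w)).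
    by rewrite /C3; field; rewrite gt_eqF.
  rewrite mulrC ler_wpM2l ?mulr_ge0 ?(ltW C10)// mulrC ler_pdivlMr// mulrC.
  exact: hv.
have := @lower_by_shift _ _ _ P _ gH I (Ordinal l0, ord0) f (fun i => 1 + (K i.1)%:R) (C3 * l%:R) (b1 * l%:R)
  fH _ V0 be0 dual _.
have K1' : forall i : I, 1 <= 1 + (K i.1)%:R :> R by move=> i; rewrite lerDl.
have hE : expR (- (b1 * l%:R)) <= pr P [set w | forall i : I, 1 - (1 + (K i.1)%:R) <= f i w].
  apply: (le_trans hK); rewrite le_eqVlt; apply/orP; left; apply/eqP; congr (pr P _).
  apply/seteqP; split => w /= h i; first by rewrite opprD addrA subrr add0r.
  by have := h i; rewrite opprD addrA subrr add0r.
move=> /(_ K1' hE) hfin.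
apply: le_trans (le_trans hfin _); first by rewrite ler_expR lerN2; lra.
apply: le_pr.
- by apply: measurable_forall => i; apply: measurable_ge_rv; exact: (gspace_meas gH).
- exact: measurable_grid_event.
- move=> w /= h p.
  have n2 : 2 ^+ a != 0 :> R by rewrite expf_neq0.
  have [p2|p2] := ltnP p (2 ^ a).
    have kl : (p * l %/ 2 ^ a < l)%N by rewrite ltn_divLR ?expn_gt0// mulnC ltn_pmul2l.
    have rl : ((p * l) %% 2 ^ a < (2 ^ a).+1)%N by rewrite ltnS ltnW// ltn_pmod// expn_gt0.
    have := h (Ordinal kl, Ordinal rl); rewrite /f /t /=; congr (1 <= ray _ w).
    have := divn_eq (p * l) (2 ^ a) => /(congr1 (fun n => n%:R : R)).
    by rewrite natrD !natrM natrX => e; rewrite mulrA e; field.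
  have pE : nat_of_ord p = (2 ^ a)%N by apply/eqP; rewrite eqn_leq p2 -ltnS ltn_ord.
  have ll : (l.-1 < l)%N by rewrite prednK.
  have := h (Ordinal ll, ord_max); rewrite /f /t /=; congr (1 <= ray _ w).
  by rewrite pE natrX divff// mulrC divfK// -{2}(prednK l0) natr1.
Qed.

(** A process whose increments have variance at most [min (La * 4 ^- m) ep]
    at dyadic scale [m] satisfies the chaining hypothesis with constant [A]
    as soon as [ep] is negligible up to the scale [M0] after which the first
    bound is summable. *)
Lemma two_scale_bound (La ep A v : R) (M0 m : nat) : 0 <= A ->
  La * (2 / 3) ^+ M0 <= A -> ep * (8 / 3) ^+ M0 <= A -> 0 <= La -> 0 <= ep ->
  v <= La * (4^-1) ^+ m -> v <= ep -> 2 ^+ m * v <= A * (3 / 4) ^+ m.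
Proof.
move=> A0 h1 h2 La0 ep0 v1 v2; case: (leqP M0 m) => Mm.
  apply: (le_trans (ler_wpM2l (exprn_ge0 m (ler0n R 2)) v1)).
  have -> : 2 ^+ m * (La * 4^-1 ^+ m) = La * (2 / 3) ^+ m * (3 / 4) ^+ m.
    by rewrite -mulrA -!exprMn mulrCA -exprMn; congr (_ * _ ^+ _); field.
  rewrite ler_wpM2r ?exprn_ge0 ?divr_ge0//; apply: le_trans h1.
  by rewrite ler_wpM2l// ler_wiXn2l//; lra.
apply: (le_trans (ler_wpM2l (exprn_ge0 m (ler0n R 2)) v2)).
have -> : 2 ^+ m * ep = ep * (8 / 3) ^+ m * (3 / 4) ^+ m.
  by rewrite -mulrA -exprMn mulrC; congr (_ * _ ^+ _); field.
rewrite ler_wpM2r ?exprn_ge0 ?divr_ge0//; apply: le_trans h2.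
rewrite ler_wpM2l// ler_weXn2l//; first by lra.
exact: ltnW.
Qed.

(** The first [n] nodes predict the field on the grid up to the error in
    [ray_taylor]. Once they are peeled off, each being required to be at most
    [de / n], the residuals have increments that are bounded both by those of
    the field and by the prediction error, and chaining makes all of them at
    most [de] with probability at least [1 / 2]. *)
Lemma ray_small_ball (l a n M0 : nat) (de : R) : 0 < de -> (0 < n)%N -> de <= n%:R ->
  (2 * pi * l%:R) ^+ 2 * (2 / 3) ^+ M0 <= de ^+ 2 / 144 ->
  4 * (2 ^- n * expR (4 * pi * l%:R)) ^+ 2 * (8 / 3) ^+ M0 <= de ^+ 2 / 144 ->
  (de / n%:R / 3) ^+ n / 2 <=
    pr P [set w | forall p : 'I_(2 ^ a).+1, `|ray (p%:R * (l%:R / 2 ^+ a)) w| <= 2 * de].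
Proof.
move=> de0 n0 den hLa hep; pose h : R := l%:R / 2 ^+ a.
have a2 : 0 < 2 ^+ a :> R by rewrite exprn_gt0.
have h0 : 0 <= h by rewrite divr_ge0// ltW.
have np : 0 < n%:R :> R by rewrite ltr0n.
pose I : finType := 'I_(2 ^ a).+1.
pose g (p : I) := ray (p%:R * h).
pose ep := 2 ^- n * expR (4 * pi * l%:R) : R.
have ep0 : 0 <= ep by rewrite mulr_ge0 ?expR_ge0// invr_ge0 exprn_ge0.
pose ys := ray_nodes u Psi h n.
have ysH Y : List.In Y ys -> rayspan u Psi Y.
  rewrite /ys /ray_nodes; elim: (iota 0 n) => [//|j s IH] /= [<-|//]; exact: Hray.
have x01 : 0 <= de / n%:R <= 1 by rewrite divr_ge0 ?(ltW de0)//= ler_pdivrMr// mul1r.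
have [g' [g'H g'var hpr]] := small_ball_peel gH de ysH (fun p : I => Hray (p%:R * h))
  (fun p => ray_varX_le1 _) x01.
have szys : size ys = n by rewrite size_map size_iota.
move: hpr; rewrite szys.
have -> : n%:R * (de / n%:R) + de = 2 * de by field; rewrite gt_eqF.
apply: le_trans; rewrite ler_wpM2l//.
  by apply: exprn_ge0; rewrite divr_ge0 ?divr_ge0 ?(ltW de0).
pose A := de ^+ 2 / 144.
pose G (p : nat) : T -> R := g' (inord p).
have near p : (p <= 2 ^ a)%N -> exists Z, inspan ys Z /\ varX P (fun w => ray (p%:R * h) w + Z w) <= ep ^+ 2.
  move=> pa; have [Z [hZ vZ]] := ray_taylor hu htheta hPsi n p h0.
  exists Z; split=> //; apply: (le_trans vZ).
  have ph : p%:R * h <= l%:R.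
    by rewrite /h mulrCA ler_piMr// ler_pdivrMr// mul1r -natrX ler_nat.
  rewrite lerXn2r ?nnegrE// ?mulr_ge0 ?expR_ge0 ?invr_ge0 ?exprn_ge0//.
  rewrite /ep ler_wpM2l ?invr_ge0 ?exprn_ge0// ler_expR ler_wpM2l//.
  by rewrite mulr_ge0// ltW.
have single (p : I) Z : inspan ys Z -> varX P (g' p) <= varX P (fun w => g p w + Z w).
  move=> hZ; have := g'var (fun q => (q == p)%:R) Z hZ.
  have E (F : I -> T -> R) : (fun w => \sum_q (q == p)%:R * F q w) = F p.
    by apply/funext => w; rewrite (bigD1 p)//= eqxx mul1r big1 ?addr0// => q /negbTE ->; rewrite mul0r.
  rewrite E; congr (_ <= varX P _); apply/funext => w; congr (_ + _).
  by rewrite (bigD1 p)//= eqxx mul1r big1 ?addr0// => q /negbTE ->; rewrite mul0r.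
have pair (p q : I) Z : inspan ys Z ->
    varX P (fun w => g' p w - g' q w) <= varX P (fun w => (g p w - g q w) + Z w).
  move=> hZ; have := g'var (fun r => (r == p)%:R - (r == q)%:R) Z hZ.
  have E (F : I -> R) : \sum_r ((r == p)%:R - (r == q)%:R) * F r = F p - F q.
    under eq_bigr do rewrite mulrBl; rewrite sumrB; congr (_ - _).
      by rewrite (bigD1 p)//= eqxx mul1r big1 ?addr0// => r /negbTE ->; rewrite mul0r.
    by rewrite (bigD1 q)//= eqxx mul1r big1 ?addr0// => r /negbTE ->; rewrite mul0r.
  by under eq_fun do rewrite E; under [in leRHS]eq_fun do rewrite E.
have A0 : 0 <= A by rewrite divr_ge0 ?sqr_ge0.
have GH p : rayspan u Psi (G p) by exact: g'H.
have h83 : 1 <= (8 / 3) ^+ M0 :> R by apply: exprn_ege1; lra.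
have G0 : varX P (G 0%N) <= A.
  have [Z [hZ vZ]] := near 0%N isT.
  apply: le_trans (single (inord 0) Z hZ) _; rewrite /g inordK//.
  apply: (le_trans vZ); apply: le_trans hep; rewrite -/ep.
  have := sqr_ge0 ep; set e2 := ep ^+ 2 => e20.
  have := ler_wpM2l e20 h83; nra.
have incr m k : (m <= a)%N -> (k < 2 ^ m)%N ->
    2 ^+ m * varX P (fun w => dyadic_incr (G ^~ w) a m k) <= A * (3 / 4) ^+ m.
  move=> ma km; rewrite /dyadic_incr /G.
  set p1 := (k.+1 * _)%N; set p2 := (k * _)%N.
  have e2 : (2 ^ a = 2 ^ m * 2 ^ (a - m))%N by rewrite -expnD subnKC.
  have p1a : (p1 <= 2 ^ a)%N by rewrite e2 leq_mul2r km orbT.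
  have p2a : (p2 <= 2 ^ a)%N by rewrite e2 leq_mul2r (ltnW km) orbT.
  have [Z1 [hZ1 vZ1]] := near p1 p1a; have [Z2 [hZ2 vZ2]] := near p2 p2a.
  have v1 : varX P (fun w => g' (inord p1) w - g' (inord p2) w) <= (2 * pi * l%:R) ^+ 2 * 4^-1 ^+ m.
    apply: le_trans (pair _ _ _ (inspan0 ys)) _.
    under eq_fun do rewrite addr0.
    apply: (le_trans (ray_diff_varX _ _)); rewrite !inordK ?ltnS//.
    have -> : p1%:R * h - p2%:R * h = l%:R / 2 ^+ m.
      have -> : h = l%:R / (2 ^+ m * 2 ^+ (a - m)) by rewrite /h -exprD subnKC.
      rewrite /p1 /p2 !natrM natrX -natr1; field.
      by rewrite !expf_neq0.
    have -> : 4^-1 = 2^-1 ^+ 2 :> R by field.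
    by rewrite -exprM mulnC exprM -exprMn exprVn mulrA.
  have v2 : varX P (fun w => g' (inord p1) w - g' (inord p2) w) <= 4 * ep ^+ 2.
    apply: le_trans (pair _ _ _ (inspanB hZ1 hZ2)) _.
    have -> : (fun w => g (inord p1) w - g (inord p2) w + (Z1 w - Z2 w)) =
       (fun w => (ray (p1%:R * h) w + Z1 w) - (ray (p2%:R * h) w + Z2 w)).
      by apply/funext => w; rewrite /g !inordK ?ltnS//; ring.
    apply: le_trans (varXB_le gH _ _) _.
    - by apply: (gspaceD gH); [exact: Hray|exact: (inspan_H gH ysH)].
    - by apply: (gspaceD gH); [exact: Hray|exact: (inspan_H gH ysH)].
    lra.
  apply: (two_scale_bound A0 hLa hep _ _ v1 v2); first exact: sqr_ge0.
  by rewrite mulr_ge0 ?sqr_ge0.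
have [V [iV V0 gV EV]] := chaining gH GH G0 incr.
have mV : measurable_fun setT V by move: iV => /integrableP[/measurable_EFinP].
have d2 : 0 < de ^+ 2 by rewrite exprn_gt0.
pose bad := [set w | de ^+ 2 <= V w].
have mbad : measurable bad by exact: measurable_ge_rv.
have hbad : pr P bad <= 1 / 2.
  apply: (le_trans (markov_pr d2 mbad iV V0 (fun w h => h))).
  rewrite ler_pdivrMr//; apply: (le_trans EV); rewrite /A; lra.
have mgood : measurable [set w | forall p : I, `|g' p w| <= de].
  apply: measurable_forall => p; apply: measurable_le_rv; apply: measurableT_comp => //.
  exact: (gspace_meas gH (g'H p)).
have : pr P (~` bad) <= pr P [set w | forall p : I, `|g' p w| <= de].
  apply: le_pr => //; first exact: measurableC.
  move=> w /negP; rewrite -ltNge => Vw p /=.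
  have := gV p w; rewrite -ltnS ltn_ord => /(_ isT); rewrite /G inord_val => hg.
  rewrite -(ler_pXn2r (ltn0Sn 1)) ?nnegrE ?(ltW de0)// real_normK ?num_real//.
  exact: le_trans hg (ltW Vw).
rewrite pr_setC//; lra.
Qed.

(** By [ray_turan_lb] the duality hypothesis holds for the field divided by an
    exponentially small [de], with [K = 3] and [V = 1]. So it suffices that the field be
    at least [- 2 * de] with probability [expR (- O(l ^+ 2))]; this follows from
    [ray_small_ball] with [n] of order [l] nodes, each confined to an interval of
    length exponentially small in [l]. *)
Lemma persistence_lower_quadratic : theta < u -> exists2 C : R, 0 < C &
  forall l : nat, (0 < l)%N -> exists2 de : R, 0 < de &
  forall a : nat, expR (- (C * l%:R ^+ 2)) <= pr P (grid_event l a de).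
Proof.
move=> tu.
have aux (x y z : R) : x <= y * z -> 1 <= z -> 7 * x + 17 + 2 * 1 <= (7 * y + 19) * z by lra.
have [c5 hturan] := ray_turan_lb hu htheta hPsi tu.
(* [n = q * l] nodes, enough for the prediction error [2 ^- n] to remain
   negligible after multiplication by [(8 / 3) ^+ M0] *)
pose q := (9 * c5 + 206)%N; pose b : R := q%:R * (4 + q%:R + c5%:R) + 1.
have b0 : 0 <= b by rewrite /b addr_ge0// mulr_ge0// !addr_ge0.
exists (7 * b + 19); first by lra.
move=> l l0; set L : R := l%:R.
have L1 : 1 <= L by rewrite /L ler1n.
have L0 : 0 <= L by lra.
pose de : R := expR (- (c5%:R * L / 2)) / 3.
have de0 : 0 < de by rewrite divr_gt0 ?expR_gt0.
have de2 : de ^+ 2 = expR (- (c5%:R * L)) / 9.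
  rewrite /de expr_div_n -expRM_natl; congr (expR _ / _); first by field.
  by ring.
exists de => // a.
have pw (k : nat) (x : R) : x <= 2 ^+ k -> x <= expR (k%:R * L).
  move=> xk; apply: (le_trans xk); apply: (le_trans (pow2_le_expR k)).
  by rewrite ler_expR ler_peMr.
have small : expR (- ((c5%:R + 12) * L)) <= de ^+ 2 / 144.
  rewrite de2 -mulrA -invfM ler_pdivlMr; last by lra.
  have h9 : 9 <= expR (4%:R * L) :> R by apply: pw; rewrite !exprS expr0; lra.
  have h144 : 144 <= expR (8%:R * L) :> R by apply: pw; rewrite !exprS expr0; lra.
  apply: (@le_trans _ _ (expR (- ((c5%:R + 12) * L)) * (expR (4%:R * L) * expR (8%:R * L)))).
    by rewrite ler_wpM2l ?expR_ge0//; apply: ler_pM.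
  by rewrite -!expRD ler_expR; lra.
pose M0 := (4 * (c5 + 20) * l)%N; pose n := (q * l)%N.
have [e2 e4] := @expR1_bounds R.
have nE : n%:R = q%:R * L by rewrite natrM.
have qE : q%:R = 9 * c5%:R + 206 :> R by rewrite natrD natrM.
have ME : M0%:R = 4 * (c5%:R + 20) * L by rewrite !natrM natrD.
have p4 : pi <= 4 :> R by have [/andP[_ h] _] := pihalf_02_cos_pihalf R; lra.
have pi0 := pi_ge0 R.
have hLa : (2 * pi * l%:R) ^+ 2 * (2 / 3) ^+ M0 <= de ^+ 2 / 144.
  apply: le_trans small; rewrite -/L.
  have h1 : (2 * pi * L) ^+ 2 <= expR (8%:R * L).
    apply: (@le_trans _ _ (64 * L ^+ 2)).
      have -> : 64 * L ^+ 2 = (8 * L) ^+ 2 by ring.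
      rewrite ler_pXn2r ?nnegrE ?mulr_ge0// ler_wpM2r//; lra.
    have -> : expR (8%:R * L) = expR (6%:R * L) * expR L ^+ 2.
      by rewrite -expRM_natl -expRD; congr expR; ring.
    apply: ler_pM; rewrite ?sqr_ge0//; first by apply: pw; rewrite !exprS expr0; lra.
    by rewrite ler_pXn2r ?nnegrE ?expR_ge0// natr_le_expR.
  have h2 : (2 / 3) ^+ M0 <= expR (- ((c5%:R + 20) * L)).
    have -> : expR (- ((c5%:R + 20) * L)) = expR (-1) ^+ ((c5 + 20) * l)%N :> R.
      by rewrite -expRM_natl natrM natrD; congr expR; ring.
    rewrite /M0 -mulnA exprM; apply: lerXn2r; rewrite ?nnegrE ?expR_ge0 ?exprn_ge0 ?divr_ge0//.
    rewrite expRN -[expR 1]invrK invrK -[leLHS]invrK lef_pV2 ?posrE ?expR_gt0 ?invr_gt0 ?exprn_gt0 ?divr_gt0//.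
    rewrite -exprVn invf_div; apply: (le_trans e4); rewrite !exprS expr0; lra.
  apply: (@le_trans _ _ (expR (8%:R * L) * expR (- ((c5%:R + 20) * L)))).
    by apply: ler_pM; rewrite ?sqr_ge0 ?exprn_ge0 ?divr_ge0.
  by rewrite -expRD ler_expR; lra.
have hep : 4 * (2 ^- n * expR (4 * pi * l%:R)) ^+ 2 * (8 / 3) ^+ M0 <= de ^+ 2 / 144.
  apply: le_trans small; rewrite -/L.
  have h1 : 4 <= expR (2%:R * L) by apply: pw; rewrite !exprS expr0; lra.
  have h2 : (2 ^- n * expR (4 * pi * L)) ^+ 2 <= expR (32 * L - n%:R).
    rewrite exprMn -exprVn exprAC expRD -expRM_natl [leRHS]mulrC; apply: ler_pM.
    - by rewrite exprn_ge0// sqr_ge0.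
    - exact: expR_ge0.
    - have -> : expR (- n%:R) = (expR 1)^-1 ^+ n :> R.
        by rewrite -expRN -expRM_natl mulrN1.
      apply: lerXn2r; rewrite ?nnegrE ?sqr_ge0 ?invr_ge0 ?expR_ge0//.
      have -> : 2^-1 ^+ 2 = 4^-1 :> R by field.
      by rewrite lef_pV2 ?posrE ?expR_gt0.
    - by rewrite ler_expR mulrA ler_wpM2r//; lra.
  have h3 : (8 / 3) ^+ M0 <= expR (2 * M0%:R) :> R.
    have -> : expR (2 * M0%:R) = expR 2 ^+ M0 :> R by rewrite -expRM_natl mulrC.
    apply: lerXn2r; rewrite ?nnegrE ?expR_ge0 ?divr_ge0//.
    by have := @expR_ge1Dx R 2; lra.
  apply: (@le_trans _ _ (expR (2%:R * L) * expR (32 * L - n%:R) * expR (2 * M0%:R))).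
    apply: ler_pM; [by apply: mulr_ge0 => //; exact: sqr_ge0|by rewrite exprn_ge0// divr_ge0| |exact: h3].
    by apply: ler_pM; rewrite ?sqr_ge0.
  by rewrite -!expRD ler_expR ME nE qE; lra.
have n0 : (0 < n)%N by rewrite muln_gt0 l0 /q addnS.
have n1 : 1 <= n%:R :> R by rewrite ler1n.
have den : de <= n%:R.
  apply: le_trans n1; rewrite /de ler_pdivrMr// mul1r.
  apply: (@le_trans _ _ 1); last by lra.
  by rewrite -[leRHS]expR0 ler_expR oppr_le0 divr_ge0// mulr_ge0.
have hsb := ray_small_ball a de0 n0 den hLa hep.
pose be := n%:R * (4 + n%:R + c5%:R * L) + 1 : R.
have be0 : 0 <= be by rewrite /be addr_ge0// mulr_ge0// !addr_ge0// mulr_ge0.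
have hE : expR (- be) <= (de / n%:R / 3) ^+ n / 2.
  rewrite /be opprD expRD; apply: ler_pM; rewrite ?expR_ge0//; last first.
    by rewrite expRN lef_pV2 ?posrE ?expR_gt0.
  have -> : expR (- (n%:R * (4 + n%:R + c5%:R * L))) = expR (- (4 + n%:R + c5%:R * L)) ^+ n :> R.
    by rewrite -expRM_natl mulrN.
  apply: lerXn2r; rewrite ?nnegrE ?expR_ge0 ?divr_ge0 ?(ltW de0)//.
  have -> : de / n%:R / 3 = expR (- (c5%:R * L / 2)) / (9 * n%:R).
    by rewrite /de; field; rewrite gt_eqF ?ltr0n.
  rewrite ler_pdivlMr ?mulr_gt0 ?ltr0n//.
  apply: (@le_trans _ _ (expR (- (4 + n%:R + c5%:R * L)) * (expR 4%:R * expR n%:R))).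
    rewrite ler_wpM2l ?expR_ge0//; apply: ler_pM => //; last exact: natr_le_expR.
    by apply: le_trans (pow2_le_expR 4); rewrite !exprS expr0; lra.
  rewrite -!expRD ler_expR; have : 0 <= c5%:R * L by rewrite mulr_ge0.
  lra.
have hE2 := le_trans hE hsb.
pose t (p : 'I_(2 ^ a).+1) : R := p%:R * (L / 2 ^+ a).
pose f p w := de^-1 * ray (t p) w.
have fH p : rayspan u Psi (f p) by apply: (gspaceZ gH); exact: Hray.
have dual (m : 'I_(2 ^ a).+1 -> R) : (forall i, 0 <= m i) ->
    (\sum_i m i * 3) ^+ 2 <= 1 * varX P (fun w => \sum_i m i * f i w).
  move=> m0.
  have -> : (fun w => \sum_i m i * f i w) = (fun w => de^-1 * \sum_i m i * ray (t i) w).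
    by apply/funext => w; rewrite mulr_sumr; apply: eq_bigr => i _; rewrite mulrCA.
  rewrite (varXZ gH); last by apply: (gspace_lcomb gH) => i; exact: Hray.
  rewrite mul1r exprVn mulrC ler_pdivlMr ?exprn_gt0// -mulr_suml exprMn de2.
  have tl i : 0 <= t i <= l%:R.
    rewrite /t mulr_ge0 ?divr_ge0 ?exprn_ge0//= mulrCA ler_piMr// ler_pdivrMr ?exprn_gt0// mul1r.
    by rewrite -natrX ler_nat -ltnS.
  have := hturan _ l t m l0 tl m0; rewrite natrM -/L.
  by set S := _ ^+ 2 => h; have -> : S * 3 ^+ 2 * (expR (- (c5%:R * L)) / 9) = expR (- (c5%:R * L)) * S by field.
have K1 : forall i : 'I_(2 ^ a).+1, 1 <= 3 :> R by move=> i; lra.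
have hE3 : expR (- be) <= pr P [set w | forall i, 1 - 3 <= f i w].
  apply: (le_trans hE2); apply: le_pr.
  - by apply: measurable_forall => p; apply: measurable_le_rv; apply: measurableT_comp.
  - by apply: measurable_forall => p; apply: measurable_ge_rv; exact: (gspace_meas gH (fH p)).
  - move=> w /= h p; have := h p; rewrite ler_norml => /andP[h1 _].
    rewrite /f mulrC ler_pdivlMr//.
    by rewrite (_ : (1 - 3) * de = - (2 * de))//; ring.
have := @lower_by_shift _ _ _ P _ gH _ ord0 f (fun=> 3) 1 be fH K1 ltr01 be0 dual hE3.
have -> : [set w | forall i, 1 <= f i w] = grid_event l a de.
  apply/seteqP; split => w /= h p; have := h p; rewrite /f /t.
    by rewrite mulrC ler_pdivlMr// mul1r.
  by move=> hp; rewrite mulrC ler_pdivlMr// mul1r.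
apply: le_trans; rewrite ler_expR lerN2 -/L.
have beL : be <= b * L ^+ 2.
  rewrite /be /b nE.
  have L2 : 1 <= L ^+ 2 by rewrite expr_ge1.
  have LL : L <= L ^+ 2 by rewrite expr2 ler_peMl.
  have -> : q%:R * L * (4 + q%:R * L + c5%:R * L) + 1 =
     4 * q%:R * L + q%:R * (q%:R + c5%:R) * L ^+ 2 + 1 by ring.
  have q0 : 0 <= 4 * q%:R :> R by rewrite mulr_ge0.
  have h4 := ler_wpM2l q0 LL; move: (q%:R : R) (c5%:R : R) h4 => x y h4.
  have -> : (x * (4 + x + y) + 1) * L ^+ 2 = 4 * x * L ^+ 2 + x * (x + y) * L ^+ 2 + L ^+ 2 by ring.
  by apply: lerD => //; rewrite lerD2r.
by apply: aux => //; rewrite expr_ge1.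
Qed.

End grids.

(** * From grid events to the event of no zeroes *)

Section dyadic_grids.
Context {R : realType}.
Implicit Types (f : R -> R) (L t c : R).

Lemma le_on_dyadics f L c : continuous f -> 0 < L ->
  (forall a (p : 'I_(2 ^ a).+1), c <= f (p%:R * (L / 2 ^+ a))) ->
  forall t, 0 <= t <= L -> c <= f t.
Proof.
move=> cf L0 H t /andP[t0 tL]; rewrite leNgt; apply/negP => ft.
have : \forall s \near t, f s < c by exact: (cf t (fun y => y < c) (lt_nbhsl ft)).
case/nbhs_ballP => r /= r0 /(_ _)Hr.
pose a := Num.bound (L / r).
have pa : 0 < 2 ^+ a :> R by rewrite exprn_gt0.
have h0 : 0 < L / 2 ^+ a by rewrite divr_gt0.
have hr : L / 2 ^+ a < r.
  rewrite ltr_pdivrMr // mulrC -ltr_pdivrMr //.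
  apply: (le_lt_trans (ler_norm _)); apply: (lt_le_trans (archi_boundP (normr_ge0 _))).
  rewrite (_ : Num.bound `|L / r| = a); last by rewrite ger0_norm // divr_ge0 // ltW.
  by rewrite -natrX ler_nat ltnW // ltn_expl.
have q0 : 0 <= t / (L / 2 ^+ a) by rewrite divr_ge0 // ltW.
have /andP[q1 q2] := truncn_itv q0.
set q := Num.truncn _ in q1 q2.
have qa : (q < (2 ^ a).+1)%N.
  rewrite ltnS -(ler_nat R) natrX; apply: (le_trans q1).
  by rewrite ler_pdivrMr // mulrC divfK ?gt_eqF.
have /= := H a (Ordinal qa); rewrite leNgt => /negP; apply; apply: Hr.
rewrite /ball /=; have {}q2 : t / (L / 2 ^+ a) < q%:R + 1 by rewrite natr1.
move: q2 q1; rewrite ltr_pdivrMr // mulrDl mul1r ler_pdivlMr // => q2 q1.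
by rewrite ger0_norm ?subr_ge0 // ltrBlDl; apply: (lt_trans q2); rewrite ltrD2l.
Qed.

Lemma dyadic_in_segment L a (p : 'I_(2 ^ a).+1) : 0 < L -> 0 <= p%:R * (L / 2 ^+ a) <= L.
Proof.
move=> L0; have pa : 0 < 2 ^+ a :> R by rewrite exprn_gt0.
have h0 : 0 <= p%:R * (L / 2 ^+ a) by rewrite mulr_ge0 // divr_ge0 // ltW.
rewrite h0 mulrA ler_pdivrMr // mulrC.
by rewrite ler_pM2l // -natrX ler_nat -ltnS ltn_ord.
Qed.

Lemma nonvanishing_sign f L : continuous f -> 0 < L ->
  (forall t, 0 <= t <= L -> f t != 0) ->
  (forall t, 0 <= t <= L -> 0 < f t) \/ (forall t, 0 <= t <= L -> 0 < - f t).
Proof.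
move=> cf L0 nz; have nz0 : f 0 != 0 by apply: nz; rewrite lexx ltW.
have opp t : 0 <= t <= L -> ~ (Num.min (f 0) (f t) <= 0 <= Num.max (f 0) (f t)).
  move=> /andP[t0 tL] /(IVT t0) []; first exact: continuous_subspaceT.
  move=> c; rewrite in_itv /= => /andP[c0 ct] fc.
  by have := nz c; rewrite c0 fc eqxx (le_trans ct tL) => /(_ isT).
have [f0|f0] := ltrP 0 (f 0); [left|right] => t tL.
  rewrite ltNge; apply/negP => ft; apply: (opp t tL).
  by rewrite ge_min le_max ft (ltW f0) orbT.
rewrite oppr_gt0 ltNge; apply/negP => ft; apply: (opp t tL).
by rewrite ge_min le_max ft f0 orbT.
Qed.

(** The minimum of [f] is positive. This expresses positivity on a segment
    through countably many conditions, hence as a measurable event. *)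
Lemma gt0_on_dyadics f L : continuous f -> 0 < L ->
  (forall t, 0 <= t <= L -> 0 < f t) <->
  exists n : nat, forall a (p : 'I_(2 ^ a).+1), n.+1%:R^-1 <= f (p%:R * (L / 2 ^+ a)).
Proof.
move=> cf L0; split=> [H|[n H] t tL]; last first.
  by apply: lt_le_trans (le_on_dyadics cf L0 H tL); rewrite invr_gt0.
have [c cL cmin] := EVT_min (ltW L0) (continuous_subspaceT cf).
have fc : 0 < f c by apply: H; move: cL; rewrite in_itv.
exists (Num.bound (f c)^-1) => a p; apply: le_trans (cmin _ _); last first.
  by rewrite in_itv /=; exact: dyadic_in_segment.
rewrite invf_ple ?posrE //; apply: (le_trans (ler_norm _)); apply: ltW.
apply: (lt_trans (archi_boundP (normr_ge0 _))); rewrite ger0_norm ?invr_ge0 ?ltW //.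
by rewrite ltr_nat.
Qed.

End dyadic_grids.

Section no_zeroes.
Context d (T : measurableType d) (R : realType) (P : probability T R).
Context (u theta : R) (Psi : R * R -> {RV P >-> R}).
Hypothesis hPsi : gaussian_field_with_spectral_measure (sigma_arcs theta) Psi.
Notation ray := (ray u Psi).

Definition no_zeroes (L : R) : set T := [set w | nb_zeroes Psi (segment u L) w = 0%E].

Definition positive_event (e L : R) : set T :=
  [set w | forall t, 0 <= t <= L -> 0 < e * ray t w].

Lemma ray_continuous w : continuous (fun t => ray t w).
Proof.
move=> t; rewrite /ray.
have -> : (fun s => Psi (s * cos u, s * sin u) w) = (fun x => Psi x w) \o (fun s : R => (s * cos u, s * sin u)) by [].
apply: continuous_comp; last exact: field_continuous hPsi w _.
have c1 (k : R) : (fun s : R => s * k) @ t --> t * k by apply: cvgMr_tmp; exact: cvg_id.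
exact: cvg_pair (c1 _) (c1 _).
Qed.

Lemma no_zeroesE L : no_zeroes L = [set w | forall t, 0 <= t <= L -> ray t w != 0].
Proof.
apply/seteqP; split=> w /=; rewrite /no_zeroes /nb_zeroes /counting /=.
  case: ifP => // /asboolP fX [] /eqP; rewrite pnatr_eq0 finmap.cardfs_eq0 => /eqP /(fset_set_set0 fX) X0 t tL.
  apply/eqP => rt; have : (segment u L `&` [set x | Psi x w = 0]) (t * cos u, t * sin u).
    by split => //; exists t.
  by rewrite X0.
move=> H; rewrite (_ : _ `&` _ = set0); last first.
  by apply/seteqP; split => // x [[t tL ->]] /= rt; have := H t tL; rewrite /ray rt eqxx.
case: ifP => [_|/asboolP]; first by rewrite fset_set0 finmap.cardfs0.
by case.
Qed.

Lemma no_zeroes_sign L : 0 < L -> no_zeroes L = positive_event 1 L `|` positive_event (-1) L.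
Proof.
move=> L0; rewrite no_zeroesE; apply/seteqP; split=> w /=.
  move=> /(nonvanishing_sign (ray_continuous (w := w)) L0) [] H; [left|right] => t tL.
    by rewrite mul1r; exact: H.
  by rewrite mulN1r; exact: H.
by case=> H t tL; have := H t tL; rewrite ?mul1r ?mulN1r ?oppr_gt0; [move/gt_eqF->|move/lt_eqF->].
Qed.

Lemma measurable_positive_event e L : 0 < L -> measurable (positive_event e L).
Proof.
move=> L0.
rewrite (_ : positive_event e L = \bigcup_n \bigcap_a
    [set w | forall p : 'I_(2 ^ a).+1, n.+1%:R^-1 <= e * ray (p%:R * (L / 2 ^+ a)) w]).
  apply: bigcup_measurable => n _; apply: bigcap_measurable => [|a _]; first by exists 0%N.
  apply: measurable_forall => p; apply: measurable_ge_rv.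
  by apply: measurable_funM => //; exact: measurable_ray.
apply/seteqP; split=> w /=.
  have cf : continuous (fun t => e * ray t w).
    by move=> t; apply: cvgMl_tmp; exact: ray_continuous.
  by move/(gt0_on_dyadics cf L0) => [n H]; exists n => // a _; exact: H.
have cf : continuous (fun t => e * ray t w).
  by move=> t; apply: cvgMl_tmp; exact: ray_continuous.
by case=> n _ H; apply/(gt0_on_dyadics cf L0); exists n => a; exact: H.
Qed.

Lemma measurable_no_zeroes L : 0 < L -> measurable (no_zeroes L).
Proof.
by move=> L0; rewrite no_zeroes_sign //; apply: measurableU; exact: measurable_positive_event.
Qed.

Lemma no_zeroes_le_half_grid (L : R) (n : nat) : (n%:R / 2 <= L) -> 0 < L ->
  pr P (no_zeroes L) <= pr P (half_grid_event u Psi 1 n) + pr P (half_grid_event u Psi (-1) n).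
Proof.
move=> nL L0; apply: le_prU.
- exact: measurable_no_zeroes.
- exact: measurable_half_grid_event hPsi _ _.
- exact: measurable_half_grid_event hPsi _ _.
rewrite no_zeroes_sign // => w [] H; [left|right] => k; apply/ltW/H.
all: rewrite divr_ge0 //= (le_trans _ nL) // ler_pM2r ?invr_gt0 // ler_nat; exact: ltnW.
Qed.

Lemma grid_event_nested l de a : grid_event u Psi l a.+1 de `<=` grid_event u Psi l a de.
Proof.
move=> w H p; have p2 : (2 * p < (2 ^ a.+1).+1)%N.
  by rewrite ltnS expnS leq_mul2l -ltnS ltn_ord.
have := H (Ordinal p2); rewrite /= natrM exprS invfM.
by rewrite (_ : 2 * p%:R * _ = p%:R * (l%:R / 2 ^+ a)) //; field.
Qed.

(** The grids are nested, so a bound independent of the depth [a] passes to the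
    event that the field is at least [de] at all dyadic points, hence on the
    whole segment. *)
Lemma grid_event_le_no_zeroes (l : nat) (L de b : R) : 0 < L -> L <= l%:R -> 0 < de ->
  (forall a, b <= pr P (grid_event u Psi l a de)) -> b <= pr P (no_zeroes L).
Proof.
move=> L0 Ll de0 H.
have l0 : 0 < l%:R :> R by exact: lt_le_trans Ll.
have mG a := measurable_grid_event u hPsi l a de.
have mI : measurable (\bigcap_a grid_event u Psi l a de).
  by apply: bigcap_measurable => [|a _]; [exists 0%N|exact: mG].
have sub : \bigcap_a grid_event u Psi l a de `<=` no_zeroes L.
  rewrite no_zeroesE => w Hw t /andP[t0 tL].
  have : de <= ray t w.
    apply: (le_on_dyadics (ray_continuous (w := w)) l0).
      by move=> a p; exact: Hw.
    by rewrite t0 (le_trans tL).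
  by move/(lt_le_trans de0)/gt_eqF ->.
apply: le_trans (le_pr P mI (measurable_no_zeroes L0) sub).
rewrite -lee_fin pr_EFin //.
have cv : (P (grid_event u Psi l a de) @[a --> \oo] --> P (\bigcap_a grid_event u Psi l a de))%classic.
  apply: (nonincreasing_cvg_mu (F := fun a => grid_event u Psi l a de)) => //.
    exact: le_lt_trans (probability_le1 _ (mG _)) (ltry _).
  apply/nonincreasing_seqP => a; apply/subsetPset; exact: grid_event_nested.
rewrite -(cvg_lim _ cv) //; apply: lime_ge; first by apply/cvg_ex; exists (P (\bigcap_a grid_event u Psi l a de)).
by near=> a; rewrite -pr_EFin // lee_fin.
Unshelve. all: by end_near. Qed.

End no_zeroes.

Section asymptotics.
Context {R : realType}.
Implicit Types (p : R -> R) (k : nat).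

(** Only the values of the length at integers and at multiples of a fixed
  step are controlled; rounding up for the lower bound and down for the upper
  bound costs a constant factor in the exponent. *)
Lemma asymp_opp_of_bounds p k (C c : R) (D N0 : nat) :
  0 < C -> 0 < c -> (0 < D)%N -> (0 < k)%N ->
  (forall (l : nat) (L : R), (0 < l)%N -> 0 < L -> L <= l%:R -> expR (- (C * l%:R ^+ k)) <= p L) ->
  (forall (N : nat) (L : R), (0 < N)%N -> (N0 <= N)%N -> 0 < L -> (D * N)%:R <= L ->
    p L <= 6 * expR (- (c * N%:R ^+ k))) ->
  asymp_opp (fun L => lne (p L)%:E) (fun L => L ^+ k).
Proof.
move=> C0 c0 D0 k0 lower upper.
pose q : R := (2 * D%:R)^-1 ^+ k.
have D0' : 0 < D%:R :> R by rewrite ltr0n.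
have q0 : 0 < q by rewrite exprn_gt0 // invr_gt0 mulr_gt0.
exists (C * 2 ^+ k), (c * q / 2); split.
- by rewrite mulr_gt0 // exprn_gt0.
- by rewrite divr_gt0 // mulr_gt0.
near=> L.
have L1 : 1 <= L by near: L; exact: nbhs_pinfty_ge.
have L0 : 0 < L by exact: lt_le_trans L1.
have L2 : 2 * D%:R <= L by near: L; exact: nbhs_pinfty_ge.
have LN : 2 * D%:R * N0%:R <= L by near: L; exact: nbhs_pinfty_ge.
have L6 : 2 * ln 6 / (c * q) <= L by near: L; apply: nbhs_pinfty_ge; exact: num_real.
have LLk : L <= L ^+ k.
  by rewrite -{1}(expr1 L); apply: ler_weXn2l.
have pl : expR (- (C * 2 ^+ k * L ^+ k)) <= p L.
  have /andP[t1 t2] := truncn_itv (ltW L0); set l := Num.truncn L in t1 t2.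
  have l1 : l.+1%:R <= 2 * L by rewrite -natr1; lra.
  apply: le_trans (lower l.+1 L isT L0 (ltW t2)).
  rewrite ler_expR lerN2 -mulrA ler_pM2l // -exprMn.
  by apply: lerXn2r; rewrite ?nnegrE // mulr_ge0 // ltW.
have p0 : 0 < p L by exact: lt_le_trans (expR_gt0 _) pl.
rewrite lne_EFin // !lee_fin; apply/andP; split.
  by rewrite -ler_expR lnK.
have x0 : 0 <= L / D%:R by rewrite divr_ge0 // ltW.
have /andP[t1 t2] := truncn_itv x0; set N := Num.truncn (L / D%:R) in t1 t2.
have x2 : 2 <= L / D%:R by rewrite ler_pdivlMr.
have xN : L / D%:R <= 2 * N%:R.
  have : L / D%:R < N%:R + 1 by rewrite natr1.
  by move: x2; clear; lra.
have N0' : (0 < N)%N by rewrite -(ltr0n R); move: xN x2; clear; lra.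
have NN0 : (N0 <= N)%N.
  rewrite -(ler_nat R) -(ler_pM2l (_ : 0 < 2)) //; apply: le_trans xN.
  by rewrite ler_pdivlMr // mulrAC.
have DN : (D * N)%:R <= L by rewrite natrM mulrC -ler_pdivlMr.
have qN : q * L ^+ k <= N%:R ^+ k.
  rewrite /q -exprMn; apply: lerXn2r; rewrite ?nnegrE //.
    by rewrite mulr_ge0 ?invr_ge0 ?mulr_ge0 // ltW.
  by rewrite mulrC ler_pdivrMr ?mulr_gt0 // mulrCA mulrA -ler_pdivrMr.
rewrite -ler_expR lnK //; apply: (le_trans (upper N L N0' NN0 L0 DN)).
rewrite -[6](lnK (_ : 6 \is Num.pos)) ?posrE // -expRD ler_expR.
have a1 : c * (q * L ^+ k) <= c * N%:R ^+ k by rewrite ler_pM2l.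
have a2 : ln 6 <= c * q / 2 * L ^+ k.
  apply: le_trans (_ : c * q / 2 * L <= _); last by rewrite ler_pM2l // divr_gt0 // mulr_gt0.
  move: L6; rewrite ler_pdivrMr ?mulr_gt0 // => L6.
  by rewrite mulrAC ler_pdivlMr // mulrC (mulrC _ L).
have e : c * q / 2 * L ^+ k = c * (q * L ^+ k) / 2 by rewrite mulrAC -[c * q * _]mulrA.
move: a1 a2; rewrite e; set x := c * _; set y := c * _; clear; lra.
Unshelve. all: by end_near. Qed.

End asymptotics.

Section persistence.
Context d (T : measurableType d) (R : realType) (P : probability T R).
Context (u theta : R) (Psi : R * R -> {RV P >-> R}).
Hypothesis hPsi : gaussian_field_with_spectral_measure (sigma_arcs theta) Psi.

Lemma log_no_zeroes_asymp k : (0 < k)%N ->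
  (exists2 C, 0 < C & forall l : nat, (0 < l)%N -> exists2 de : R, 0 < de &
     forall a, expR (- (C * l%:R ^+ k)) <= pr P (grid_event u Psi l a de)) ->
  (exists (D N0 : nat) (c : R), [/\ (0 < D)%N, 0 < c & forall (N : nat) e, (0 < N)%N ->
     (N0 <= N)%N -> e ^+ 2 = 1 ->
     pr P (half_grid_event u Psi e (2 * D * N)) <= 3 * expR (- (c * N%:R ^+ k))]) ->
  asymp_opp (fun L => lne (P (no_zeroes u Psi L))) (fun L => L ^+ k).
Proof.
move=> k0 [C C0 lower] [D [N0 [c [D0 c0 upper]]]].
have : asymp_opp (fun L => lne (pr P (no_zeroes u Psi L))%:E) (fun L => L ^+ k).
  apply: (asymp_opp_of_bounds C0 c0 D0 k0 (N0 := N0)) => [l L l0 L0 Ll|N L N1 NN0 L0 DNL].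
    by have [de de0 H] := lower l l0; exact: (grid_event_le_no_zeroes hPsi L0 Ll de0 H).
  have DNL2 : (2 * D * N)%:R / 2 <= L by rewrite -mulnA natrM mulrAC divff ?mul1r.
  apply: (le_trans (no_zeroes_le_half_grid u hPsi DNL2 L0)).
  have := lerD (upper N 1 N1 NN0 (expr1n _ 2)) (upper N (-1) N1 NN0 (_ : (-1) ^+ 2 = 1)).
  by rewrite -mulrDl sqrrN expr1n => /(_ erefl); rewrite -natrD.
case=> c1 [c2 [c10 c20 H]]; exists c1, c2; split => //.
near=> L; rewrite -pr_EFin; first by near: L.
by apply: (measurable_no_zeroes u hPsi); near: L; exact: nbhs_pinfty_gt.
Unshelve. all: by end_near. Qed.

End persistence.

Theorem proposition1p6 (R : realType) (u theta : R)
    (hu : 0 <= u <= pi / 4) (htheta : 0 < theta <= pi / 4)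
    (d : measure_display) (T : measurableType d) (P : probability T R)
    (Psi : R * R -> {RV P >-> R})
    (hPsi : gaussian_field_with_spectral_measure (sigma_arcs theta) Psi) :
  let logP := fun L : R => lne (P [set w | nb_zeroes Psi (segment u L) w = 0%E]) in
  (u <= theta -> asymp_opp logP (fun L => L)) /\
  (theta < u -> asymp_opp logP (fun L => L ^+ 2)).
Proof.
split=> hut.
  have [C C0 lower] := persistence_lower_linear hu htheta hPsi hut.
  have [D [c [D0 c0 upper]]] := persistence_upper_linear hu htheta hPsi.
  apply: (@log_no_zeroes_asymp _ _ _ _ u theta Psi hPsi 1) => //.
    exists C => // l l0; exists 1 => // a; rewrite expr1; exact: lower.
  by exists D, 0%N, c; split => // N e N1 _ e1; rewrite expr1; exact: upper.
have [C C0 lower] := persistence_lower_quadratic hu htheta hPsi hut.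
have [D [N0 [c [D0 c0 upper]]]] := persistence_upper_quadratic hu htheta hPsi hut.
apply: (log_no_zeroes_asymp hPsi) => //; first by exists C.
by exists D, N0, c; split => // N e _; exact: upper.
Qed.
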